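(* Let $k$ be an algebraically closed field, $Q=(I,A)$ a finite quiver and $G\subseteq\mathrm{Aut}(Q)$ a finite group with $\mathrm{char}\,k\nmid|G|$. If $\lambda=(\lambda_i)\in k^I$ satisfies $\lambda_i=\lambda_j$ for any $i,j\in I$ in the same $G$-orbit, then there is an equivalence of categories $$\Pi_Q^\lambda G\text{-}\mathbf{Mod}\simeq\Pi_{Q_G}^\eta\text{-}\mathbf{Mod},$$ where $\eta=(\eta_{(i,\rho)})\in k^{I_G}$ with $\eta_{(i,\rho)}=\frac{\dim_k\rho}{|G_i|}\lambda_i$. In particular, $\Pi_QG\text{-}\mathbf{Mod}\simeq\Pi_{Q_G}\text{-}\mathbf{Mod}$.
   Context: **Deformed preprojective and skew group algebras.** $\overline Q$ is the double quiver of $Q$ (add $a':j\to i$ for each arrow $a:i\to j$). $\Pi_Q^\lambda=k\overline Q/\mathcal I$ with $\mathcal I$ generated by $\sum_{a\in A,h(a)=i}aa'-\sum_{a\in A,t(a)=i}a'a-\lambda_ie_i$ ($i\in I$), where $h,t$ denote head and tail and $e_i$ is the idempotent at $i$; $\Pi_Q=\Pi_Q^0$. $G$ acts on $\overline Q$ by $g(a')=g(a)'$. For an algebra $\Lambda$ with $G$-action, the skew group algebra $\Lambda G$ is spanned by elements $ga$ ($g\in G$, $a\in\Lambda$) with $ga\cdot hb=gh\,h^{-1}(a)b$; $\Lambda$ and $kG$ are viewed as subalgebras, and $g(a)=gag^{-1}$. $\Lambda\text{-}\mathbf{Mod}$ is the category of $\Lambda$-modules. **The bimodules $\widetilde A_{i,j}$.**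 For $i,j\in I$: $G_i$ is the stabilizer of $i$ (equivalently of $e_i$) in $G$; $\mathcal O_i$ is the $G$-orbit of $i$; $A_{i,j}=e_j(\mathrm{rad}(kQ)/\mathrm{rad}^2(kQ))e_i$, where $\mathrm{rad}(kQ)$ is the Jacobson radical of $kQ$; $\overline A_{i,j}=A_{i,j}\oplus A_{j,i}^*$ with $A_{j,i}^*=\mathrm{Hom}_k(A_{j,i},k)$. (When $Q$ has no oriented cycles, $A_{i,j}$ is the span of the arrows $i\to j$ of $Q$ and $\overline A_{i,j}$ is identified with the span of the arrows $i\to j$ of $\overline Q$.) Put $\langle(a_1,a_2),(b_1,b_2)\rangle_{i,j}=b_2(a_1)+a_2(b_1)$ on $\overline A_{i,j}\times\overline A_{j,i}$, and $\varepsilon_{i,j}=\mathrm{id}_{A_{i,j}}\oplus(-\mathrm{id}_{A_{j,i}^*})$. Let $\widetilde I\subseteq I$ be a set of representatives of the $G$-orbits; for $i\in\mathcal O_{i_0}$, $i_0\in\widetilde I$, fix $\kappa_i\in G$ with $\kappa_ii_0=i$. For $i,j\in\widetilde I$ let $E_{i,j}$ be a set of representatives of the $G$-orbits on $\mathcal O_i\times\mathcal O_j$, and let $$\widetilde A_{i,j}=\bigoplus_{(i',j')\in E_{i,j}}G_j\kappa_{j'}^{-1}\overline A_{i',j'}\kappa_{i'}G_i$$ (the span of all $h\kappa_{j'}^{-1}a\kappa_{i'}g$ with $h\in G_j$, $g\in G_i$, $a\in\overline A_{i',j'}$, with products taken as in the skew group algebra $(k\overline Q)G$, so $gag^{-1}=g(a)$),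 a $(kG_j,kG_i)$-bimodule independent of the choice of $E_{i,j}$. Define a non degenerate pairing $\widetilde A_{i,j}\times\widetilde A_{j,i}\to k$ (writing elements of $\widetilde A_{j,i}$ by means of the representatives $(j'',i'')$ with $(i'',j'')\in E_{i,j}$) by $$\langle h_1\kappa_{j'}^{-1}a\kappa_{i'}g_1,\ g_2\kappa_{i''}^{-1}b\kappa_{j''}h_2\rangle'_{i,j}=\langle\kappa_{j''}h_2h_1\kappa_{j'}^{-1}a\kappa_{i'}g_1g_2\kappa_{i''}^{-1},\,b\rangle_{i',j'}$$ if $(i',j')=(i'',j'')$ and $\kappa_{j''}h_2h_1\kappa_{j'}^{-1}\kappa_{i'}g_1g_2\kappa_{i''}^{-1}=e$ (the unit of $G$), and $0$ otherwise; and let $\varepsilon'_{i,j}(h_1\kappa_{j'}^{-1}a\kappa_{i'}g_1)=\frac1{|G_i||G_j|}h_1\kappa_{j'}^{-1}\varepsilon_{i',j'}(a)\kappa_{i'}g_1$. **The quiver $Q_G$.** Its vertex set is $I_G=\bigcup_{i\in\widetilde I}\{i\}\times\mathrm{irr}(G_i)$, where $\mathrm{irr}(G_i)$ is a set of representatives of the isomorphism classes of irreducible $k$-representations of $G_i$. Its space of arrows from $(i,\rho)$ to $(j,\sigma)$ is $A'_{(i,\rho),(j,\sigma)}=\mathrm{Hom}_{G_j}(\widetilde A_{i,j}\otimes_{G_i}\rho,\sigma)^*$ ($k$-dual). For $f\in\mathrm{Hom}_{G_j}(\widetilde A_{i,j}\otimes_{G_i}\rho,\sigma)$ and $g\in\mathrm{Hom}_{G_i}(\widetilde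 A_{j,i}\otimes_{G_j}\sigma,\rho)$ put $$\langle f,g\rangle_{(i,\rho),(j,\sigma)}=\sum_a\mathrm{Tr}\,\phi_a,\quad \phi_a:\rho\to\rho,\ \phi_a(r)=g(a^*\otimes f(a\otimes r)),\qquad \varepsilon_{(j,\sigma),(i,\rho)}(f)=-f\circ(\varepsilon'_{i,j}\otimes\mathrm{id}_\rho),$$ where $a$ runs over a basis of $\widetilde A_{i,j}$ and $a^*$ is the corresponding dual basis element of $\widetilde A_{j,i}$ for $\langle-,-\rangle'_{i,j}$. This pairing is non degenerate; it gives a non degenerate pairing between $A'_{(i,\rho),(j,\sigma)}$ and $A'_{(j,\sigma),(i,\rho)}$, and through it $\mathrm{Hom}_{G_j}(\widetilde A_{i,j}\otimes_{G_i}\rho,\sigma)$ is identified with $A'_{(j,\sigma),(i,\rho)}$, so that $\varepsilon_{(j,\sigma),(i,\rho)}$ becomes an automorphism of $A'_{(j,\sigma),(i,\rho)}$. One has $\varepsilon_{(j,\sigma),(i,\rho)}=-{}^t\varepsilon_{(i,\rho),(j,\sigma)}$; in this sense $Q_G$ is already a double quiver. **The algebra $\Pi^\eta_{Q_G}$.** For $\eta\in k^{I_G}$, $\Pi_{Q_G}^\eta$ is the path algebra $kQ_G$ modulo the $\eta$-preprojective relations: for each $(i,\rho)\in I_G$, $$\sum_{(j,\sigma)\in I_G}\ \sum_{\alpha}\varepsilon_{(j,\sigma),(i,\rho)}(\alpha^* )\,\alpha-\eta_{(i,\rho)}e_{(i,\rho)}=0,$$ where $\alpha$ runs over a basis of $A'_{(i,\rho),(j,\sigma)}$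 and $\alpha^*$ is the dual basis element of $A'_{(j,\sigma),(i,\rho)}$. $\Pi_{Q_G}=\Pi_{Q_G}^0$.
   Formalization: A_{i,j} is the span of the arrows i→j for every finite Q (rad(kQ) read as the arrow ideal); with the Jacobson radical the claim fails for oriented cycles, e.g. one loop, G trivial, λ=0 would give k[x,y]-Mod ≃ k-Mod. For acyclic Q the two agree. *)

(* Defs.v *)
From HB Require Import structures.
From mathcomp Require Import all_boot all_order all_algebra all_fingroup.
From mathcomp Require Import mxrepresentation.
From mathcomp Require Import boolp classical_sets.
From mathcomp Require Import finmap.
From mathcomp Require Import monalg.
From mathcomp Require Import generic_quotient.

Set Implicit Arguments.
Unset Strict Implicit.
Unset Printing Implicit Defensive.

Import GRing.Theory.
Local Open Scope quotient_scope.
Local Open Scope ring_scope.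

Record quiver := Quiver {
  vertex :> finType;
  arrow : finType;
  qtail : arrow -> vertex;
  qhead : arrow -> vertex }.

Section Paths.
Variable Q : quiver.

(* [(i, s)] is the path that starts at [i] and runs through the arrows of [s],
   the first element of [s] first; [(i, [::])] is the trivial path at [i].    *)
Fixpoint is_path (i : Q) (s : seq (arrow Q)) : bool :=
  if s is a :: s' then (qtail a == i) && is_path (qhead a) s' else true.

Definition path_end (p : Q * seq (arrow Q)) : Q := last p.1 [seq qhead a | a <- p.2].

Record qpath := QPath { qpath_val :> Q * seq (arrow Q);
                        qpath_valid : is_path qpath_val.1 qpath_val.2 }.
HB.instance Definition _ := [isSub for qpath_val].
HB.instance Definition _ := [Choice of qpath by <:].

Lemma is_path_cat i s t :
  is_path i (s ++ t) = is_path i s && is_path (path_end (i, s)) t.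
Proof.
by elim: s i => [|a s IHs] i //=; rewrite IHs /= andbA /path_end /=.
Qed.

Definition triv_path (i : Q) : qpath := @QPath (i, [::]) isT.

Lemma arrow_path_subproof (a : arrow Q) : is_path (qtail a) [:: a].
Proof. by rewrite /= eqxx. Qed.

Definition arrow_path (a : arrow Q) : qpath :=
  @QPath (qtail a, [:: a]) (arrow_path_subproof a).

(* Products are written from right to left: [p * q] runs through [q] first. *)
Definition path_comp (p q : qpath) : option qpath :=
  if path_end q == p.1
  then insub (q.1, q.2 ++ p.2) else None.

End Paths.

Section LinearExtension.
Variables (k : closedFieldType) (K : choiceType) (M : lmodType k).

Definition lin_ext (F : K -> M) (x : {malg k[K]}) : M :=
  \sum_(p <- msupp x) x@_p *: F p.

Local Open Scope fset_scope.
Lemma lin_extEw (F : K -> M) (d : {fset K}) x : msupp x `<=` d ->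
  lin_ext F x = \sum_(p <- d) x@_p *: F p.
Proof.
move=> le; rewrite [LHS](big_fset_incl _ le) => //= p _ /mcoeff_outdom ->.
by rewrite scale0r.
Qed.

Lemma lin_ext_is_linear F : linear (lin_ext F).
Proof.
move=> c x y; pose d := msupp x `|` msupp y `|` msupp (c *: x + y).
have [sx sy sxy] : [/\ msupp x `<=` d, msupp y `<=` d & msupp (c *: x + y) `<=` d].
  split; rewrite /d; first exact/fsubsetU/orP/or_introl/fsubsetUl.
    exact/fsubsetU/orP/or_introl/fsubsetUr.
  exact: fsubsetUr.
rewrite (lin_extEw _ sx) (lin_extEw _ sy) (lin_extEw _ sxy) scaler_sumr -big_split.
by apply: eq_bigr => p _; rewrite /= mcoeffD mcoeffZ scalerDl scalerA.
Qed.
HB.instance Definition _ F :=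
  GRing.isLinear.Build k {malg k[K]} M *:%R (lin_ext F) (lin_ext_is_linear F).

Lemma lin_extU F p : lin_ext F << p >> = F p.
Proof. by rewrite (lin_extEw _ msuppU_le) big_seq_fset1 mcoeffUU scale1r. Qed.

Lemma malg_linear_eq (f g : {linear {malg k[K]} -> M}) :
  (forall p, f << p >> = g << p >>) -> f =1 g.
Proof.
move=> fg x; rewrite [x]monalgE !linear_sum; apply: eq_bigr => p _ /=.
have -> : << x@_p *g p >> = x@_p *: << p >> :> {malg k[K]}.
  by apply/malgP => q; rewrite mcoeffZ !mcoeffU mulrnAr mulr1.
by rewrite !linearZ /= fg.
Qed.

End LinearExtension.

Section PathAlgebra.
Variables (k : closedFieldType) (Q : quiver).

(* Finitely supported functions from the set of paths to [k]. *)
Definition path_alg : Type := {malg k[qpath Q]}.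
HB.instance Definition _ := GRing.Lmodule.on path_alg.

Definition path_mul_basis (p q : qpath Q) : path_alg :=
  if path_comp p q is Some r then << r >> else 0.

Definition path_mul (x y : path_alg) : path_alg :=
  lin_ext (fun p => lin_ext (path_mul_basis p) y) x.

Definition vtx (i : Q) : path_alg := << triv_path i >>.
Definition arr (a : arrow Q) : path_alg := << arrow_path a >>.

Definition path_one : path_alg := \sum_i vtx i.

Lemma path_compP (p q : qpath Q) : path_end q = p.1 ->
  exists2 r, path_comp p q = Some r & val r = (q.1, q.2 ++ p.2).
Proof.
move=> e; rewrite /path_comp e eqxx; case: insubP => [r _ rE|]; first by exists r.
rewrite /= is_path_cat qpath_valid /=.
have -> : (q.1, q.2) = q by rewrite -surjective_pairing.
by rewrite e qpath_valid.
Qed.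

Lemma path_compN (p q : qpath Q) : path_end q != p.1 -> path_comp p q = None.
Proof. by rewrite /path_comp => /negbTE ->. Qed.

Lemma path_mulE p q : path_mul << p >> << q >> = path_mul_basis p q.
Proof. by rewrite /path_mul !lin_extU. Qed.

Lemma path_mulDl : left_distributive path_mul +%R.
Proof. by move=> x y z; rewrite /path_mul linearD. Qed.

Lemma path_mulZl c x y : path_mul (c *: x) y = c *: path_mul x y.
Proof. by rewrite /path_mul linearZ. Qed.

Lemma path_mul_is_linear x : linear (path_mul x).
Proof.
move=> c y z; rewrite /path_mul /lin_ext scaler_sumr -big_split.
apply: eq_bigr => p _ /=; rewrite -/(lin_ext (path_mul_basis p) _) linearP.
by rewrite scalerDr !scalerA mulrC.
Qed.
HB.instance Definition _ x :=
  GRing.isLinear.Build k path_alg path_alg *:%R (path_mul x) (path_mul_is_linear x).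

Definition path_mulr y x := path_mul x y.
Lemma path_mulr_is_linear y : linear (path_mulr y).
Proof. by move=> c x z; rewrite /path_mulr path_mulDl path_mulZl. Qed.
HB.instance Definition _ y :=
  GRing.isLinear.Build k path_alg path_alg *:%R (path_mulr y) (path_mulr_is_linear y).

Lemma path_end_comp (p q r : qpath Q) :
  path_end q = p.1 -> val r = (q.1, q.2 ++ p.2) -> path_end r = path_end p.
Proof.
move=> e rE; rewrite /path_end -[qpath_val r]/(val r) rE /= map_cat last_cat.
by rewrite -/(path_end q) e.
Qed.

Lemma path_mulA_basis p q r :
  path_mul << p >> (path_mul << q >> << r >>)
  = path_mul (path_mul << p >> << q >>) << r >>.
Proof.
rewrite !path_mulE /path_mul_basis.
have [eqr|neqr] := eqVneq (path_end r) q.1; last first.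
  rewrite (path_compN neqr) linear0.
  have [epq|npq] := eqVneq (path_end q) p.1; last first.
    by rewrite (path_compN npq) -/(path_mulr _ _) linear0.
  have [s -> sE] := path_compP epq; rewrite path_mulE /path_mul_basis path_compN //.
  by rewrite -[qpath_val s]/(val s) sE.
have [t -> tE] := path_compP eqr; rewrite path_mulE /path_mul_basis.
have et := path_end_comp eqr tE.
have [epq|npq] := eqVneq (path_end q) p.1; last first.
  by rewrite (path_compN npq) path_compN ?et // -/(path_mulr _ _) linear0.
have [s -> sE] := path_compP epq.
have es : path_end r = s.1 by rewrite -[qpath_val s]/(val s) sE.
rewrite path_mulE /path_mul_basis; have [u -> uE] := path_compP es.
have etp : path_end t = p.1 by rewrite et.
have [v -> vE] := path_compP etp; congr << _ >>; apply/val_inj.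
rewrite uE vE -[qpath_val s]/(val s) -[qpath_val t]/(val t) sE tE /=.
by rewrite catA.
Qed.

Lemma path_mulA : associative path_mul.
Proof.
move=> x y z.
pose f1 : {linear path_alg -> path_alg} := path_mulr (path_mul y z).
pose f2 : {linear path_alg -> path_alg} := path_mulr z \o path_mulr y.
apply: (malg_linear_eq (f := f1) (g := f2)) => p; rewrite /f1 /f2 /= /path_mulr.
pose g1 : {linear path_alg -> path_alg} := path_mul << p >> \o path_mulr z.
pose g2 : {linear path_alg -> path_alg} := path_mulr z \o path_mul << p >>.
apply: (malg_linear_eq (f := g1) (g := g2)) => q; rewrite /g1 /g2 /= /path_mulr.
pose h1 : {linear path_alg -> path_alg} := path_mul << p >> \o path_mul << q >>.
pose h2 : {linear path_alg -> path_alg} := path_mul (path_mul << p >> << q >>).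
apply: (malg_linear_eq (f := h1) (g := h2)) => r; rewrite /h1 /h2 /=.
exact: path_mulA_basis.
Qed.

Lemma path_mul1 : left_id path_one path_mul.
Proof.
move=> x; pose f : {linear path_alg -> path_alg} := path_mul path_one.
pose g : {linear path_alg -> path_alg} := idfun.
apply: (malg_linear_eq (f := f) (g := g)) => p; rewrite /f /g /=.
rewrite -/(path_mulr _ _) /path_one linear_sum /= /path_mulr (bigD1 (path_end p)) //=.
rewrite big1 ?addr0 => [|i ni]; rewrite path_mulE /path_mul_basis.
  have [|r -> rE] := @path_compP (triv_path (path_end p)) p; first by [].
  by congr << _ >>; apply/val_inj; rewrite rE /= cats0 -surjective_pairing.
by rewrite path_compN //= eq_sym.
Qed.

Lemma path_mulr1 : right_id path_one path_mul.
Proof.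
move=> x; pose f : {linear path_alg -> path_alg} := path_mulr path_one.
pose g : {linear path_alg -> path_alg} := idfun.
apply: (malg_linear_eq (f := f) (g := g)) => p; rewrite /f /g /= /path_mulr.
rewrite /path_one linear_sum /= (bigD1 (val p).1) //=.
rewrite big1 ?addr0 => [|i ni]; rewrite path_mulE /path_mul_basis.
  have [|r -> rE] := @path_compP p (triv_path p.1); first by [].
  by congr << _ >>; apply/val_inj; rewrite rE /= -surjective_pairing.
by rewrite path_compN.
Qed.

Lemma path_mulDr : right_distributive path_mul +%R.
Proof. by move=> x y z; rewrite linearD. Qed.

HB.instance Definition _ := GRing.Zmodule_isPzRing.Build path_alg
  path_mulA path_mul1 path_mulr1 path_mulDl path_mulDr.

End PathAlgebra.


Section QuotientRing.
Variables (R : pzRingType) (S : R -> Prop).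

Inductive two_sided_ideal : R -> Prop :=
| ideal_gen x : S x -> two_sided_ideal x
| ideal0 : two_sided_ideal 0
| idealD x y : two_sided_ideal x -> two_sided_ideal y -> two_sided_ideal (x + y)
| idealMl a x : two_sided_ideal x -> two_sided_ideal (a * x)
| idealMr x a : two_sided_ideal x -> two_sided_ideal (x * a).

Definition ideal_pred : {pred R} := fun x => `[< two_sided_ideal x >].

Lemma ideal_predP x : reflect (two_sided_ideal x) (x \in ideal_pred).
Proof. exact: asboolP. Qed.

Fact ideal_zmod_closed : zmod_closed ideal_pred.
Proof.
split=> [|x y /ideal_predP Ix /ideal_predP Iy]; apply/ideal_predP.
  exact: ideal0.
by apply: idealD Ix _; rewrite -mulN1r; apply: idealMl.
Qed.
HB.instance Definition _ := GRing.isZmodClosed.Build R ideal_pred ideal_zmod_closed.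

Definition ring_quot : Type := Quotient.quot ideal_pred.
HB.instance Definition _ := GRing.Zmodule.on ring_quot.
HB.instance Definition _ := EqQuotient.on ring_quot.

Definition to_quot (x : R) : ring_quot := \pi_ring_quot x.

Lemma to_quotP x y : to_quot x = to_quot y <-> two_sided_ideal (x - y).
Proof.
rewrite /to_quot; split=> [/eqP|Ixy].
  by rewrite -[X in is_true X -> _](Quotient.idealrBE ideal_pred) => /ideal_predP.
by apply/eqP; rewrite -[X in is_true X](Quotient.idealrBE ideal_pred); apply/ideal_predP.
Qed.

Lemma repr_quotK (u : ring_quot) : to_quot (repr u) = u.
Proof. exact: reprK. Qed.

Lemma to_quotD x y : to_quot (x + y) = to_quot x + to_quot y.
Proof. exact: (Quotient.pi_add ideal_pred). Qed.

Lemma to_quot_repr x : two_sided_ideal (x - repr (to_quot x)).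
Proof. by apply/to_quotP; rewrite repr_quotK. Qed.

Definition quot_mul (u v : ring_quot) : ring_quot := to_quot (repr u * repr v).

Lemma to_quotM x y : quot_mul (to_quot x) (to_quot y) = to_quot (x * y).
Proof.
apply/esym/to_quotP; have Ix := to_quot_repr x; have Iy := to_quot_repr y.
rewrite -[X in two_sided_ideal X](subrKA (x * repr (to_quot y))) -mulrBr -mulrBl.
by apply: idealD; [apply: idealMl | apply: idealMr].
Qed.

Fact quot_mulA : associative quot_mul.
Proof.
move=> u v w; rewrite -(repr_quotK u) -(repr_quotK v) -(repr_quotK w).
by rewrite !to_quotM mulrA.
Qed.

Fact quot_mul1 : left_id (to_quot 1) quot_mul.
Proof. by move=> u; rewrite -(repr_quotK u) to_quotM mul1r. Qed.

Fact quot_mulr1 : right_id (to_quot 1) quot_mul.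
Proof. by move=> u; rewrite -(repr_quotK u) to_quotM mulr1. Qed.

Fact quot_mulDl : left_distributive quot_mul +%R.
Proof.
move=> u v w; rewrite -(repr_quotK u) -(repr_quotK v) -(repr_quotK w).
by rewrite -to_quotD !to_quotM mulrDl to_quotD.
Qed.

Fact quot_mulDr : right_distributive quot_mul +%R.
Proof.
move=> u v w; rewrite -(repr_quotK u) -(repr_quotK v) -(repr_quotK w).
by rewrite -to_quotD !to_quotM mulrDr to_quotD.
Qed.

HB.instance Definition _ := GRing.Zmodule_isPzRing.Build ring_quot
  quot_mulA quot_mul1 quot_mulr1 quot_mulDl quot_mulDr.

End QuotientRing.

Record ring_action (gT : finGroupType) (R : pzRingType) := RingAction {
  ract :> gT -> R -> R;
  ract_id : forall x, ract 1%g x = x;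
  ract_comp : forall g h x, ract (g * h)%g x = ract g (ract h x);
  ractD : forall g x y, ract g (x + y) = ract g x + ract g y;
  ract1 : forall g, ract g 1 = 1;
  ractM : forall g x y, ract g (x * y) = ract g x * ract g y }.

Section QuotientAction.
Variables (gT : finGroupType) (R : pzRingType) (act : ring_action gT R).
Variables (S : R -> Prop) (actS : forall g x, S x -> S (act g x)).

Lemma ract0 g : act g 0 = 0.
Proof. by apply: (addrI (act g 0)); rewrite -ractD !addr0. Qed.

Lemma ractN g x : act g (- x) = - act g x.
Proof. by apply: (addrI (act g x)); rewrite -ractD !subrr ract0. Qed.

Lemma ideal_act g x : two_sided_ideal S x -> two_sided_ideal S (act g x).
Proof.
elim=> {x} [x Sx||x y _ Ix _ Iy|a x _ Ix|x a _ Ix].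
- exact/ideal_gen/actS.
- by rewrite ract0; apply: ideal0.
- by rewrite ractD; apply: idealD.
- by rewrite ractM; apply: idealMl.
- by rewrite ractM; apply: idealMr.
Qed.

Definition quot_act (g : gT) (u : ring_quot S) : ring_quot S :=
  to_quot S (act g (repr u)).

Lemma quot_actE g x : quot_act g (to_quot S x) = to_quot S (act g x).
Proof.
apply/esym/to_quotP; rewrite -ractN -ractD; apply: ideal_act; exact: to_quot_repr.
Qed.

Fact quot_act_id u : quot_act 1%g u = u.
Proof. by rewrite -(repr_quotK u) quot_actE ract_id. Qed.
Fact quot_act_comp g h u : quot_act (g * h)%g u = quot_act g (quot_act h u).
Proof. by rewrite -(repr_quotK u) !quot_actE ract_comp. Qed.
Fact quot_actD g u v : quot_act g (u + v) = quot_act g u + quot_act g v.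
Proof.
by rewrite -(repr_quotK u) -(repr_quotK v) -to_quotD !quot_actE -to_quotD ractD.
Qed.
Fact quot_act1 g : quot_act g 1 = 1.
Proof. by rewrite [LHS]quot_actE ract1. Qed.
Fact quot_actM g u v : quot_act g (u * v) = quot_act g u * quot_act g v.
Proof.
rewrite -(repr_quotK u) -(repr_quotK v).
by rewrite [X in quot_act _ X]to_quotM !quot_actE [RHS]to_quotM ractM.
Qed.

Definition quot_action : ring_action gT (ring_quot S) :=
  RingAction quot_act_id quot_act_comp quot_actD quot_act1 quot_actM.

End QuotientAction.

(* The function [x] stands for the sum of the elements [g (x g)], [g : gT].    *)
Definition skew_alg (gT : finGroupType) (R : pzRingType) (act : ring_action gT R) :
  Type := {ffun gT -> R}.

Section SkewGroupAlgebra.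
Variables (gT : finGroupType) (R : pzRingType) (act : ring_action gT R).
Local Notation skew_alg := (skew_alg act).

HB.instance Definition _ := GRing.Zmodule.on skew_alg.

(* This is the bilinear extension of [ga * hb = (gh) (h^-1(a) b)]. *)
Definition skew_mul (x y : skew_alg) : skew_alg :=
  [ffun u => \sum_(p : gT * gT | (p.1 * p.2)%g == u) act p.2^-1%g (x p.1) * y p.2].

Definition skew_one : skew_alg := [ffun g => if g == 1%g then 1 else 0].

Lemma ract_sum g (I : Type) (r : seq I) (P : pred I) (F : I -> R) :
  act g (\sum_(i <- r | P i) F i) = \sum_(i <- r | P i) act g (F i).
Proof. exact: (big_morph (act g) (ractD act g) (ract0 act g)). Qed.

Lemma skew_mulE x y u : skew_mul x y u = \sum_h act h^-1%g (x (u * h^-1)%g) * y h.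
Proof.
rewrite ffunE (reindex (fun h => (u * h^-1, h)%g)) /=; last first.
  exists (fun p => p.2) => [h _ //|[g h]]; rewrite inE /= => /eqP <-.
  by rewrite mulgK.
by apply: eq_bigl => h; rewrite mulgKV eqxx.
Qed.

Fact skew_mulA : associative skew_mul.
Proof.
move=> x y z; apply/ffunP => u; rewrite !skew_mulE.
under eq_bigr do rewrite skew_mulE mulr_sumr.
under [RHS]eq_bigr do rewrite skew_mulE ract_sum mulr_suml.
rewrite exchange_big /=; apply: eq_bigr => h _.
rewrite (reindex_inj (mulIg h)) /=; apply: eq_bigr => g _.
rewrite mulgK invMg !mulgA ractM -ract_comp mulrA; congr (act _ (x _) * _ * _).
Qed.

Fact skew_mul1 : left_id skew_one skew_mul.
Proof.
move=> x; apply/ffunP => u; rewrite skew_mulE (bigD1 u) //= big1 ?addr0 => [|h nhu].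
  by rewrite mulgV ffunE eqxx ract1 mul1r.
by rewrite ffunE -eq_mulgV1 eq_sym (negbTE nhu) ract0 mul0r.
Qed.

Fact skew_mulr1 : right_id skew_one skew_mul.
Proof.
move=> x; apply/ffunP => u; rewrite skew_mulE (bigD1 1%g) //= big1 ?addr0 => [|h nh].
  by rewrite invg1 mulg1 ffunE eqxx mulr1 ract_id.
by rewrite ffunE (negbTE nh) mulr0.
Qed.

Fact skew_mulDl : left_distributive skew_mul +%R.
Proof.
move=> x y z; apply/ffunP => u; rewrite [RHS]ffunE !skew_mulE -big_split.
by apply: eq_bigr => h _; rewrite /= ffunE ractD mulrDl.
Qed.

Fact skew_mulDr : right_distributive skew_mul +%R.
Proof.
move=> x y z; apply/ffunP => u; rewrite [RHS]ffunE !skew_mulE -big_split.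
by apply: eq_bigr => h _; rewrite /= ffunE mulrDr.
Qed.

HB.instance Definition _ := GRing.Zmodule_isPzRing.Build skew_alg
  skew_mulA skew_mul1 skew_mulr1 skew_mulDl skew_mulDr.

Lemma skew_algM (x y : skew_alg) u :
  (x * y) u = \sum_h act h^-1%g (x (u * h^-1)%g) * y h.
Proof. exact: skew_mulE. Qed.

Definition skew_group (g : gT) : skew_alg := [ffun h => if h == g then 1 else 0].
Definition skew_ring (a : R) : skew_alg := [ffun h => if h == 1%g then a else 0].

Lemma skew_groupE g h : skew_group g h = if h == g then 1 else 0.
Proof. by rewrite [LHS]ffunE. Qed.

Lemma skew_ringE a h : skew_ring a h = if h == 1%g then a else 0.
Proof. by rewrite [LHS]ffunE. Qed.

End SkewGroupAlgebra.

Record category := Category {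
  obj :> Type;
  hom : obj -> obj -> Type;
  idmap : forall A, hom A A;
  compmap : forall A B C, hom B C -> hom A B -> hom A C;
  compmap1 : forall A B (f : hom A B), compmap f (idmap A) = f;
  comp1map : forall A B (f : hom A B), compmap (idmap B) f = f;
  compmapA : forall A B C D (f : hom C D) (g : hom B C) (h : hom A B),
    compmap f (compmap g h) = compmap (compmap f g) h }.

Record functor (C D : category) := Functor {
  fobj :> obj C -> obj D;
  fmap : forall A B : C, hom A B -> hom (fobj A) (fobj B);
  fmap1 : forall A, fmap (idmap A) = idmap (fobj A);
  fmapC : forall (A B E : C) (f : hom B E) (g : hom A B),
    fmap (compmap f g) = compmap (fmap f) (fmap g) }.

Definition functor_id (C : category) : functor C C :=
  @Functor C C (fun A => A) (fun _ _ f => f) (fun _ => erefl) (fun _ _ _ _ _ => erefl).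

Section FunctorComposition.
Variables (C D E : category) (F : functor D E) (G : functor C D).

Fact functor_comp1 A : fmap F (fmap G (idmap A)) = idmap (F (G A)).
Proof. by rewrite !fmap1. Qed.

Fact functor_compC (A B X : C) (f : hom B X) (g : hom A B) :
  fmap F (fmap G (compmap f g)) = compmap (fmap F (fmap G f)) (fmap F (fmap G g)).
Proof. by rewrite !fmapC. Qed.

Definition functor_comp : functor C E := Functor functor_comp1 functor_compC.
End FunctorComposition.

Record nat_iso (C D : category) (F G : functor C D) := NatIso {
  niso : forall A : C, hom (F A) (G A);
  niso_inv : forall A : C, hom (G A) (F A);
  nisoK : forall A, compmap (niso_inv A) (niso A) = idmap (F A);
  niso_invK : forall A, compmap (niso A) (niso_inv A) = idmap (G A);
  niso_nat : forall (A B : C) (f : hom A B),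
    compmap (niso B) (fmap F f) = compmap (fmap G f) (niso A) }.

Definition equivalent (C D : category) : Prop :=
  exists (F : functor C D) (G : functor D C),
    inhabited (nat_iso (functor_comp G F) (functor_id C)) /\
    inhabited (nat_iso (functor_comp F G) (functor_id D)).

Section ModuleCategory.
Variable R : pzRingType.

Lemma linear_eq (M N : lmodType R) (f g : {linear M -> N}) : f =1 g -> f = g.
Proof.
case: f g => f [[f1] [f2]] [g [[g1] [g2]]] /= /funext fg.
case: _ / fg in g1 g2 *.
by rewrite (Prop_irrelevance f1 g1) (Prop_irrelevance f2 g2).
Qed.

Definition mod_id (M : lmodType R) : {linear M -> M} := idfun.

Definition mod_comp (M N P : lmodType R) (f : {linear N -> P}) (g : {linear M -> N}) :
  {linear M -> P} := f \o g.

Fact mod_comp1 (M N : lmodType R) (f : {linear M -> N}) : mod_comp f (mod_id M) = f.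
Proof. by apply: linear_eq => x. Qed.
Fact mod_1comp (M N : lmodType R) (f : {linear M -> N}) : mod_comp (mod_id N) f = f.
Proof. by apply: linear_eq => x. Qed.
Fact mod_compA (M N P X : lmodType R) (f : {linear P -> X}) (g : {linear N -> P})
  (h : {linear M -> N}) : mod_comp f (mod_comp g h) = mod_comp (mod_comp f g) h.
Proof. by apply: linear_eq => x. Qed.

Definition Mod : category :=
  @Category (lmodType R) (fun M N => {linear M -> N}) mod_id mod_comp
    mod_comp1 mod_1comp mod_compA.

End ModuleCategory.


Record quiver_action (gT : finGroupType) (Q : quiver) := QuiverAction {
  vact :> gT -> Q -> Q;
  aact : gT -> arrow Q -> arrow Q;
  vact1 : forall i, vact 1%g i = i;
  vactM : forall g h i, vact (g * h)%g i = vact g (vact h i);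
  aact1 : forall a, aact 1%g a = a;
  aactM : forall g h a, aact (g * h)%g a = aact g (aact h a);
  tail_act : forall g a, qtail (aact g a) = vact g (qtail a);
  head_act : forall g a, qhead (aact g a) = vact g (qhead a) }.

(* An embedding of [gT] in the group of automorphisms of [Q]. *)
Definition faithful_action gT Q (act : quiver_action gT Q) : Prop :=
  forall g, (forall i, act g i = i) -> (forall a, aact act g a = a) -> g = 1%g.

Section ActionOnPathAlgebra.
Variables (k : closedFieldType) (gT : finGroupType) (Q : quiver).
Variable act : quiver_action gT Q.

Fact path_act_subproof g (p : qpath Q) : is_path (act g p.1) (map (aact act g) p.2).
Proof.
case: p => [[i s] /=]; elim: s i => [|a s IHs] i //= /andP[/eqP <- ps].
by rewrite tail_act eqxx /= head_act IHs.
Qed.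

Definition path_act g (p : qpath Q) : qpath Q :=
  @QPath Q (act g p.1, map (aact act g) p.2) (path_act_subproof g p).

Definition path_alg_act g : path_alg k Q -> path_alg k Q :=
  lin_ext (fun p => << path_act g p >>).
HB.instance Definition _ g := GRing.Linear.on (path_alg_act g).

Lemma path_alg_actU g (p : qpath Q) : path_alg_act g << p >> = << path_act g p >>.
Proof. exact: lin_extU. Qed.

Lemma path_alg_act_vtx g i : path_alg_act g (vtx k i) = vtx k (act g i).
Proof. by rewrite /vtx path_alg_actU; congr << _ >>; apply/val_inj. Qed.

Lemma path_alg_act_arr g a : path_alg_act g (arr k a) = arr k (aact act g a).
Proof.
rewrite /arr path_alg_actU; congr << _ >>; apply/val_inj.
by rewrite /= tail_act.
Qed.

Lemma vact_inj g : injective (act g).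
Proof. by apply: (can_inj (g := act g^-1%g)) => i; rewrite -vactM mulVg vact1. Qed.

Lemma aact_inj g : injective (aact act g).
Proof. by apply: (can_inj (g := aact act g^-1%g)) => i; rewrite -aactM mulVg aact1. Qed.

Fact path_alg_act_id x : path_alg_act 1%g x = x.
Proof.
apply: (malg_linear_eq (f := path_alg_act 1%g) (g := idfun)) => p.
rewrite [LHS]path_alg_actU; congr << _ >>; apply/val_inj => /=.
rewrite vact1 (eq_map (aact1 act)) map_id; by case: (qpath_val p).
Qed.

Fact path_alg_act_comp g h x :
  path_alg_act (g * h)%g x = path_alg_act g (path_alg_act h x).
Proof.
apply: (malg_linear_eq (f := path_alg_act (g * h)%g)
  (g := path_alg_act g \o path_alg_act h)) => p.
rewrite /= !path_alg_actU; congr << _ >>; apply/val_inj => /=.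
by rewrite vactM (eq_map (aactM act g h)) map_comp.
Qed.

Fact path_alg_actD g x y : path_alg_act g (x + y) = path_alg_act g x + path_alg_act g y.
Proof. exact: linearD. Qed.

Fact path_alg_act1 g : path_alg_act g 1 = 1.
Proof.
rewrite [1 in LHS]/(GRing.one _) /= /path_one linear_sum /=.
under eq_bigr do rewrite path_alg_act_vtx.
by rewrite [RHS](reindex_inj (@vact_inj g)).
Qed.

Lemma path_end_act g (p : qpath Q) : path_end (path_act g p) = act g (path_end p).
Proof.
rewrite /path_end /= -map_comp -(last_map (act g)) -map_comp.
by congr (last _ _); apply: eq_map => a /=; rewrite head_act.
Qed.

Fact path_alg_actM_basis g (p q : qpath Q) :
  path_alg_act g (path_mul_basis k p q) = path_mul_basis k (path_act g p) (path_act g q).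
Proof.
rewrite /path_mul_basis; have [e|n] := eqVneq (path_end q) p.1; last first.
  rewrite (path_compN n) path_compN ?linear0 //.
  by rewrite path_end_act /= (inj_eq (@vact_inj g)).
have [r -> rE] := path_compP e.
have [|s -> sE] := @path_compP Q (path_act g p) (path_act g q).
  by rewrite path_end_act e.
rewrite path_alg_actU; congr << _ >>; apply/val_inj.
by rewrite sE /= -[qpath_val r]/(val r) rE /= map_cat.
Qed.

Fact path_alg_actM g x y : path_alg_act g (x * y) = path_alg_act g x * path_alg_act g y.
Proof.
pose A := path_alg_act g.
pose f1 : {linear path_alg k Q -> path_alg k Q} := A \o path_mulr y.
pose f2 : {linear path_alg k Q -> path_alg k Q} := path_mulr (A y) \o A.
apply: (malg_linear_eq (f := f1) (g := f2)) => p; rewrite /f1 /f2 /= /path_mulr.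
pose h1 : {linear path_alg k Q -> path_alg k Q} := A \o path_mul << p >>.
pose h2 : {linear path_alg k Q -> path_alg k Q} := path_mul (A << p >>) \o A.
apply: (malg_linear_eq (f := h1) (g := h2)) => q; rewrite /h1 /h2 /=.
by rewrite path_mulE /A !path_alg_actU path_mulE path_alg_actM_basis.
Qed.

Definition path_alg_action : ring_action gT (path_alg k Q) :=
  RingAction path_alg_act_id path_alg_act_comp path_alg_actD path_alg_act1
    path_alg_actM.

End ActionOnPathAlgebra.

(* [inl a] is the arrow [a] and [inr a] is the added arrow [a']. *)
Definition dquiver (Q : quiver) : quiver :=
  @Quiver Q (arrow Q + arrow Q)%type
    (fun b => match b with inl a => qtail a | inr a => qhead a end)
    (fun b => match b with inl a => qhead a | inr a => qtail a end).

Section DoubleQuiver.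
Variables (k : closedFieldType) (gT : finGroupType) (Q : quiver).
Variable act : quiver_action gT Q.

Definition double_aact (g : gT) (b : arrow (dquiver Q)) : arrow (dquiver Q) :=
  match b with inl a => inl (aact act g a) | inr a => inr (aact act g a) end.

Fact double_aact1 b : double_aact 1%g b = b.
Proof. by case: b => a; rewrite /= aact1. Qed.
Fact double_aactM g h b : double_aact (g * h)%g b = double_aact g (double_aact h b).
Proof. by case: b => a; rewrite /= aactM. Qed.
Fact double_tail g (b : arrow (dquiver Q)) : qtail (double_aact g b) = act g (qtail b).
Proof. by case: b => a; rewrite /= ?tail_act ?head_act. Qed.
Fact double_head g (b : arrow (dquiver Q)) : qhead (double_aact g b) = act g (qhead b).
Proof. by case: b => a; rewrite /= ?tail_act ?head_act. Qed.

Definition double_action : quiver_action gT (dquiver Q) :=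
  @QuiverAction gT (dquiver Q) act double_aact (vact1 act) (vactM act)
    double_aact1 double_aactM double_tail double_head.

Definition preproj_relator (lam : Q -> k) (i : Q) : path_alg k (dquiver Q) :=
    \sum_(a : arrow Q | qhead a == i) @arr k (dquiver Q) (inl a) * @arr k (dquiver Q) (inr a)
  - \sum_(a : arrow Q | qtail a == i) @arr k (dquiver Q) (inr a) * @arr k (dquiver Q) (inl a)
  - lam i *: @vtx k (dquiver Q) i.

Definition preproj_relators lam (x : path_alg k (dquiver Q)) : Prop :=
  exists i, x = preproj_relator lam i.

Definition preproj (lam : Q -> k) : pzRingType := ring_quot (preproj_relators lam).

Definition qorbit (i : Q) : {set Q} := [set act g i | g : gT].

Definition orbit_invariant (lam : Q -> k) : Prop :=
  forall i j, j \in qorbit i -> lam i = lam j.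

Lemma orbit_invariant0 : orbit_invariant (fun _ => 0).
Proof. by []. Qed.

Lemma preproj_relators_act lam : orbit_invariant lam -> forall g x,
  preproj_relators lam x ->
  preproj_relators lam (path_alg_action k double_action g x).
Proof.
move=> lamG g x [i ->]; exists (act g i); rewrite /preproj_relator.
rewrite /path_alg_action /= !linearB linearZ /= path_alg_act_vtx.
rewrite [lam i](lamG i (act g i)); last exact: imset_f.
congr (_ - _ - _); rewrite linear_sum /= [RHS](reindex_inj (@aact_inj _ _ act g)) /=.
  apply: eq_big => a; first by rewrite head_act (inj_eq (@vact_inj _ _ act g)).
  by move=> _; rewrite [LHS]path_alg_actM; congr (_ * _); apply: path_alg_act_arr.
apply: eq_big => a; first by rewrite tail_act (inj_eq (@vact_inj _ _ act g)).
by move=> _; rewrite [LHS]path_alg_actM; congr (_ * _); apply: path_alg_act_arr.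
Qed.

Definition preproj_action lam (lamG : orbit_invariant lam) :
  ring_action gT (preproj lam) := quot_action (preproj_relators_act lamG).

End DoubleQuiver.


Section Bimodules.
Variables (k : closedFieldType) (gT : finGroupType) (Q : quiver).
Variable act : quiver_action gT Q.

Fact stab_group_set i : group_set [set g | act g i == i].
Proof.
apply/group_setP; split=> [|g h]; rewrite !inE ?vact1 //.
by rewrite vactM => /eqP gi /eqP ->; rewrite gi.
Qed.
Definition qstab i : {group gT} := Group (stab_group_set i).

Lemma stabP i g : reflect (act g i = i) (g \in qstab i).
Proof. by rewrite inE; apply: eqP. Qed.

(* The span of the arrows of the double quiver: the direct sum over all [i], [j]
   of the spaces [Abar i j] below.                                             *)
Definition dspan : Type := {ffun arrow (dquiver Q) -> k^o}.
HB.instance Definition _ := Vector.on dspan.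

Definition dvec (b : arrow (dquiver Q)) : dspan := [ffun c => (c == b)%:R].

(* [inr a] is the element of the dual basis at the arrow [a], so that this space
   is the span of the arrows [i -> j] of [Q] plus the dual of the span of the
   arrows [j -> i].  Here the radical of the path algebra is the ideal spanned by
   the nontrivial paths, for any [Q]; this ideal is the Jacobson radical when [Q]
   has no oriented cycle, and can be larger otherwise.                          *)
Definition Abar (i j : Q) : {vspace dspan} :=
  <<[seq dvec b | b : arrow (dquiver Q) <- enum (arrow (dquiver Q)) &
                  (qtail b == i) && (qhead b == j)]>>%VS.

Definition darr_act (g : gT) (a : dspan) : dspan :=
  [ffun b => a (double_aact act g^-1%g b)].

Definition darr_pair (a b : dspan) : k :=
  \sum_(c : arrow Q) (a (inl c) * b (inr c) + a (inr c) * b (inl c)).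

Definition darr_eps (a : dspan) : dspan :=
  [ffun b => if b is inl _ then a b else - a b].

(* The span of the elements [g b] of the skew group algebra of the path algebra
   of [dquiver Q], with [b] an arrow; [v] stands for the sum of the [g (v g)].
   The embedding is [skew_of_sarr]: by [skew_of_sarr_mul], [sarr_mul x y a] is
   the product [x a y].                                                        *)
Definition skew_arrows : Type := {ffun gT -> dspan}.
HB.instance Definition _ := Vector.on skew_arrows.

Definition sarr_lmul (h : gT) (v : skew_arrows) : skew_arrows :=
  [ffun g => v (h^-1 * g)%g].
Definition sarr_rmul (h : gT) (v : skew_arrows) : skew_arrows :=
  [ffun g => darr_act h^-1%g (v (g * h^-1)%g)].
Definition sarr_inj (a : dspan) : skew_arrows := [ffun g => if g == 1%g then a else 0].
Definition sarr_mul (x y : gT) (a : dspan) : skew_arrows :=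
  sarr_rmul y (sarr_lmul x (sarr_inj a)).

Definition path_of_darr (a : dspan) : path_alg k (dquiver Q) :=
  \sum_b a b *: arr k b.
Definition skew_of_sarr (v : skew_arrows) : skew_alg (path_alg_action k (double_action act)) :=
  [ffun g => path_of_darr (v g)].

Fact darr_act_is_linear g : linear (darr_act g).
Proof. by move=> c a b; apply/ffunP => d; rewrite !ffunE. Qed.
HB.instance Definition _ g :=
  GRing.isLinear.Build k dspan dspan *:%R (darr_act g) (darr_act_is_linear g).

Fact darr_eps_is_linear : linear darr_eps.
Proof.
by move=> c a b; apply/ffunP => [[d|d]]; rewrite !ffunE // opprD scalerN.
Qed.
HB.instance Definition _ := GRing.isLinear.Build k dspan dspan *:%R darr_eps darr_eps_is_linear.

Fact path_of_darr_is_linear : linear path_of_darr.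
Proof.
move=> c a b; rewrite /path_of_darr scaler_sumr -big_split; apply: eq_bigr => d _ /=.
by rewrite !ffunE scalerDl scalerA.
Qed.
HB.instance Definition _ :=
  GRing.isLinear.Build k dspan (path_alg k (dquiver Q)) *:%R path_of_darr
    path_of_darr_is_linear.

Fact sarr_lmul_is_linear h : linear (sarr_lmul h).
Proof. by move=> c v w; apply/ffunP => g; rewrite !ffunE. Qed.
HB.instance Definition _ h := GRing.isLinear.Build k skew_arrows skew_arrows *:%R
  (sarr_lmul h) (sarr_lmul_is_linear h).

Fact sarr_rmul_is_linear h : linear (sarr_rmul h).
Proof. by move=> c v w; apply/ffunP => g; rewrite !ffunE linearP. Qed.
HB.instance Definition _ h := GRing.isLinear.Build k skew_arrows skew_arrows *:%R
  (sarr_rmul h) (sarr_rmul_is_linear h).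

Fact sarr_inj_is_linear : linear sarr_inj.
Proof.
move=> c a b; apply/ffunP => g; rewrite !ffunE.
by case: eqP => // _; rewrite scaler0 addr0.
Qed.
HB.instance Definition _ := GRing.isLinear.Build k dspan skew_arrows *:%R
  sarr_inj sarr_inj_is_linear.

Fact sarr_mul_is_linear x y : linear (sarr_mul x y).
Proof. by move=> c a b; rewrite /sarr_mul !linearP. Qed.
HB.instance Definition _ x y := GRing.isLinear.Build k dspan skew_arrows *:%R
  (sarr_mul x y) (sarr_mul_is_linear x y).

Lemma darr_act_id a : darr_act 1%g a = a.
Proof. by apply/ffunP => b; rewrite ffunE invg1 double_aact1. Qed.

Lemma darr_act_comp g h a : darr_act (g * h)%g a = darr_act g (darr_act h a).
Proof. by apply/ffunP => b; rewrite !ffunE invMg double_aactM. Qed.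

Lemma path_of_darr_act g a :
  path_alg_act (double_action act) g (path_of_darr a) = path_of_darr (darr_act g a).
Proof.
rewrite /path_of_darr linear_sum /=.
rewrite [RHS](reindex_inj (@aact_inj _ _ (double_action act) g)) /=.
apply: eq_bigr => b _; rewrite linearZ /= path_alg_act_arr ffunE.
by rewrite -double_aactM mulVg double_aact1.
Qed.

Lemma skew_of_sarrE v g : skew_of_sarr v g = path_of_darr (v g).
Proof. by rewrite [LHS]ffunE. Qed.

Lemma skew_of_sarr_lmul h v :
  skew_of_sarr (sarr_lmul h v) = skew_group _ h * skew_of_sarr v.
Proof.
apply/ffunP => g; rewrite [LHS]skew_of_sarrE skew_algM [sarr_lmul h v g]ffunE.
rewrite (bigD1 (h^-1 * g)%g isT) [skew_group _ _ _]skew_groupE.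
rewrite [skew_of_sarr v _]skew_of_sarrE.
rewrite invMg invgK mulVKg eqxx ract1 mul1r.
rewrite big1 => [|g' n]; first exact/esym/addr0.
rewrite [skew_group _ _ _]skew_groupE; case: eqP => [e|_]; last by rewrite ract0 mul0r.
by case/eqP: n; rewrite -e invMg invgK mulgKV.
Qed.

Lemma skew_of_sarr_rmul h v :
  skew_of_sarr (sarr_rmul h v) = skew_of_sarr v * skew_group _ h.
Proof.
apply/ffunP => g; rewrite [LHS]skew_of_sarrE skew_algM [sarr_rmul h v g]ffunE.
rewrite (bigD1 h isT) big1 => [|g' n]; last first.
  by rewrite [skew_group _ _ _]skew_groupE (negbTE n) mulr0.
rewrite [skew_group _ _ _]skew_groupE.
rewrite eqxx.
rewrite [skew_of_sarr v _]skew_of_sarrE.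
apply: etrans (esym (addr0 _)).
apply: etrans (esym (mulr1 _)).
exact/esym/path_of_darr_act.
Qed.

Lemma skew_of_sarr_inj a :
  skew_of_sarr (sarr_inj a) = skew_ring _ (path_of_darr a).
Proof.
apply/ffunP => g; rewrite [LHS]skew_of_sarrE [RHS]skew_ringE [sarr_inj a g]ffunE.
by case: eqP => // _; apply: linear0.
Qed.

Lemma skew_of_sarr_mul x y a :
  skew_of_sarr (sarr_mul x y a)
  = skew_group _ x * skew_ring _ (path_of_darr a) * skew_group _ y.
Proof. by rewrite skew_of_sarr_rmul skew_of_sarr_lmul skew_of_sarr_inj. Qed.

(* [reps] represents the orbits on the vertices, and [pairs i j] those on the
   product of the orbits of [i] and [j].                                       *)
Record orbit_choices := OrbitChoices {
  reps : {set Q};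
  repsP : forall i, exists! i0, i0 \in reps /\ i \in qorbit act i0;
  kappa : Q -> gT;
  kappaP : forall i0 i, i0 \in reps -> i \in qorbit act i0 -> act (kappa i) i0 = i;
  pairs : Q -> Q -> {set Q * Q};
  pairs_orb : forall i j p, i \in reps -> j \in reps -> p \in pairs i j ->
    p.1 \in qorbit act i /\ p.2 \in qorbit act j;
  pairsP : forall i j i' j', i \in reps -> j \in reps ->
    i' \in qorbit act i -> j' \in qorbit act j ->
    exists! p, p \in pairs i j /\ exists g, p = (act g i', act g j') }.

Variable C : orbit_choices.

(* The sum over [p] is direct. *)
Definition Atilde (i j : Q) : {vspace skew_arrows} :=
  (\sum_(p in pairs C i j) \sum_(h in qstab j) \sum_(g in qstab i)
     linfun (sarr_mul (h * (kappa C p.2)^-1)%g (kappa C p.1 * g)%g) @: Abar p.1 p.2)%VS.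

(* On [g a] and [h b], this is [<g(a), b>] if [gh = 1] and [0] otherwise. Lemma
   [sarr_pairE] gives its value on the spanning elements of [Atilde i j] and
   [Atilde j i], and [sarr_eps_mul] does the same for [sarr_eps].              *)
Definition sarr_pair (v w : skew_arrows) : k :=
  \sum_g darr_pair (darr_act g (v g)) (w g^-1%g).

Definition sarr_eps (i j : Q) (v : skew_arrows) : skew_arrows :=
  (#|qstab i| * #|qstab j|)%:R^-1 *: ([ffun g => darr_eps (v g)] : skew_arrows).

Fact sarr_eps_is_linear i j : linear (sarr_eps i j).
Proof.
move=> c v w; rewrite /sarr_eps !scalerA mulrC -scalerA -scalerDr; congr (_ *: _).
by apply/ffunP => g; rewrite !ffunE linearP.
Qed.
HB.instance Definition _ i j := GRing.isLinear.Build k skew_arrows skew_arrows *:%R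
  (sarr_eps i j) (sarr_eps_is_linear i j).

End Bimodules.


Section BimoduleFacts.
Variables (k : closedFieldType) (gT : finGroupType) (Q : quiver).
Variables (act : quiver_action gT Q) (C : orbit_choices act).
Implicit Types (i j : Q) (a b : dspan k Q) (g h x y : gT).

Lemma AbarP i j a : a \in Abar k i j ->
  forall c, a c != 0 -> qtail c = i /\ qhead c = j.
Proof.
rewrite /Abar; set X := [seq _ | _ <- _ & _] => aX c.
rewrite (coord_span (X := in_tuple X) aX) sum_ffunE.
have [[-> ->] //|nc] := pselect (qtail c = i /\ qhead c = j).
rewrite big1 ?eqxx // => l _; rewrite ffunE /=.
have: X`_l \in X by apply: mem_nth; rewrite -[size X]/(size (in_tuple X)) ltn_ord.
case/mapP => b; rewrite mem_filter => /andP[/andP[/eqP ti /eqP hj] _] ->.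
rewrite ffunE; case: eqP => [cb|_]; last by rewrite scaler0.
by case: nc; rewrite cb.
Qed.

Lemma dvec_Abar (c : arrow (dquiver Q)) : dvec k c \in @Abar k Q (qtail c) (qhead c).
Proof.
apply/memv_span/mapP; exists c => //.
by rewrite mem_filter mem_enum !eqxx.
Qed.

Lemma darr_eps_Abar i j a : a \in Abar k i j -> darr_eps a \in Abar k i j.
Proof.
move=> aA; have -> : darr_eps a = \sum_c (darr_eps a c) *: dvec k c.
  apply/ffunP => d; rewrite sum_ffunE (bigD1 d) //= big1 => [|c nc].
    by rewrite addr0 [RHS]ffunE [dvec _ _ _]ffunE eqxx [RHS]mulr1.
  by rewrite ffunE [dvec _ _ _]ffunE eq_sym (negbTE nc) scaler0.
apply: memv_suml => c _.
have [->|nz] := eqVneq (darr_eps a c) 0; first by rewrite scale0r mem0v.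
have [|<- <-] := AbarP aA (c := c); last exact/memvZ/dvec_Abar.
by apply: contra_neq nz => ac; rewrite ffunE ac oppr0; case: (c).
Qed.

Lemma sarr_mulE x y a g :
  sarr_mul act x y a g = if g == (x * y)%g then darr_act act y^-1%g a else 0.
Proof.
rewrite !ffunE; have -> : (x^-1 * (g * y^-1) == 1)%g = (g == x * y)%g.
  by rewrite -(inj_eq (mulgI x)) mulKVg mulg1 -(inj_eq (mulIg y)) mulgKV.
case: eqP => // _; exact: linear0.
Qed.

Lemma darr_pair0r a : darr_pair a 0 = 0.
Proof. by apply: big1 => c _; rewrite !ffunE !mulr0 addr0. Qed.

Lemma darr_pair_act g a b : darr_pair (darr_act act g a) (darr_act act g b) = darr_pair a b.
Proof.
rewrite /darr_pair (reindex_inj (@aact_inj _ _ act g)) /=; apply: eq_bigr => c _.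
by rewrite !ffunE /= -!aactM !mulVg !aact1.
Qed.

Lemma sarr_pair_mul x y x' y' a b :
  sarr_pair act (sarr_mul act x y a) (sarr_mul act x' y' b) =
  if (y' * x * y * x' == 1)%g then darr_pair (darr_act act (y' * x)%g a) b else 0.
Proof.
rewrite /sarr_pair (bigD1 (x * y)%g) //= big1 => [|g ng]; last first.
  rewrite sarr_mulE (negbTE ng) linear0.
  by apply: big1 => c _; rewrite !ffunE !mul0r addr0.
rewrite addr0 !sarr_mulE eqxx -darr_act_comp mulgK.
have -> : ((x * y)^-1 == x' * y')%g = (y' * x * y * x' == 1)%g.
  rewrite eq_invg_mul !mulgA; apply/eqP/eqP => e.
    by apply: (mulIg y'); rewrite mul1g -!mulgA !(mulgA x) !mulgA in e *; rewrite -[RHS]mulg1 -e !mulgA.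
  by apply: (mulgI y'); rewrite mulg1 !mulgA e mul1g.
case: eqP => [_|_]; last exact: darr_pair0r.
by rewrite -[in LHS](darr_pair_act y') -!darr_act_comp mulgV darr_act_id.
Qed.

Lemma darr_actE g a c : darr_act act g a (double_aact act g c) = a c.
Proof. by rewrite ffunE -double_aactM mulVg double_aact1. Qed.

Lemma sarr_pairE i j p q h1 g1 g2 h2 a b :
  i \in reps C -> j \in reps C -> p \in pairs C i j -> q \in pairs C i j ->
  a \in Abar k p.1 p.2 -> b \in Abar k q.2 q.1 ->
  h1 \in qstab act j -> h2 \in qstab act j -> g1 \in qstab act i -> g2 \in qstab act i ->
  sarr_pair act
    (sarr_mul act (h1 * (kappa C p.2)^-1)%g (kappa C p.1 * g1)%g a)
    (sarr_mul act (g2 * (kappa C q.1)^-1)%g (kappa C q.2 * h2)%g b) =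
  if (p == q) && (kappa C q.2 * h2 * h1 * (kappa C p.2)^-1 * kappa C p.1 * g1
                  * g2 * (kappa C q.1)^-1 == 1)%g
  then darr_pair (darr_act act (kappa C q.2 * h2 * h1 * (kappa C p.2)^-1)%g a) b else 0.
Proof.
move=> iR jR pP qP aA bA _ _ _ _; rewrite sarr_pair_mul !mulgA.
have [//|npq] := eqVneq p q; case: ifP => // _; set z := (_ * _^-1)%g.
have orb1 l : l \in qorbit act l by apply/imsetP; exists 1%g; rewrite ?vact1.
apply: big1 => c _.
suff nz (d d' : arrow (dquiver Q)) : qtail d = qhead d' -> qhead d = qtail d' ->
    darr_act act z a d * b d' = 0.
  by rewrite !nz ?addr0.
move=> e1 e2; apply/eqP; rewrite mulf_eq0; apply/norP => -[ad bd'].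
have [qt qh] := AbarP bA bd'.
have [d0 dE] : exists d0, d = double_aact act z d0.
  by exists (double_aact act z^-1%g d); rewrite -double_aactM mulgV double_aact1.
move: ad; rewrite dE darr_actE => /(AbarP aA)[pt ph].
case/eqP: npq.
have [p1 p2] := pairs_orb iR jR pP.
have [r [_ rU]] := pairsP iR jR p1 p2.
rewrite -[p]rU; last by split=> //; exists 1%g; rewrite !vact1 -surjective_pairing.
apply/rU; split=> //; exists z; move: e1 e2.
by rewrite dE double_tail double_head pt ph qt qh => -> ->; rewrite -surjective_pairing.
Qed.

Lemma sarr_eps_mul i j x y a :
  sarr_eps act i j (sarr_mul act x y a)
  = (#|qstab act i| * #|qstab act j|)%:R^-1 *: sarr_mul act x y (darr_eps a).
Proof.
rewrite /sarr_eps; congr (_ *: _); apply/ffunP => g; rewrite ffunE !sarr_mulE.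
case: eqP => _; last exact: linear0.
by apply/ffunP => c; rewrite !ffunE; case: c.
Qed.

Lemma sarr_lmul_mul h x y a :
  sarr_lmul h (sarr_mul act x y a) = sarr_mul act (h * x)%g y a.
Proof.
apply/ffunP => g; rewrite ffunE !sarr_mulE -(inj_eq (mulgI h)) mulKVg.
by rewrite mulgA.
Qed.

Lemma sarr_rmul_mul h x y a :
  sarr_rmul act h (sarr_mul act x y a) = sarr_mul act x (y * h)%g a.
Proof.
apply/ffunP => g; rewrite ffunE !sarr_mulE -(inj_eq (mulIg h)) mulgKV mulgA.
case: eqP => _; last exact: linear0.
by rewrite invMg darr_act_comp.
Qed.

Lemma sarr_mul_Atilde i j p h g a : p \in pairs C i j ->
  h \in qstab act j -> g \in qstab act i -> a \in Abar k p.1 p.2 ->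
  sarr_mul act (h * (kappa C p.2)^-1)%g (kappa C p.1 * g)%g a \in Atilde k C i j.
Proof.
move=> pP hS gS aA; apply: (subvP (sumv_sup _ pP (subvv _))).
apply: (subvP (sumv_sup _ hS (subvv _))); apply: (subvP (sumv_sup _ gS (subvv _))).
rewrite -[X in X \in _](lfunE (sarr_mul act (h * (kappa C p.2)^-1)%g (kappa C p.1 * g)%g)).
exact: memv_img.
Qed.

Lemma Atilde_stable i j (f : {linear skew_arrows k gT Q -> skew_arrows k gT Q}) :
  (forall p h g a, p \in pairs C i j -> h \in qstab act j -> g \in qstab act i ->
    a \in Abar k p.1 p.2 ->
    f (sarr_mul act (h * (kappa C p.2)^-1)%g (kappa C p.1 * g)%g a) \in Atilde k C i j) ->
  forall v, v \in Atilde k C i j -> f v \in Atilde k C i j.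
Proof.
move=> Hf v vA; rewrite -[f v]lfunE memv_preim; move: v vA.
apply/subvP; apply/subv_sumP => p pP; apply/subv_sumP => h hS; apply/subv_sumP => g gS.
apply/subvP => _ /memv_imgP[a aA ->]; rewrite lfunE -memv_preim lfunE; exact: Hf.
Qed.

Lemma sarr_lmul_Atilde i j h v : h \in qstab act j ->
  v \in Atilde k C i j -> sarr_lmul h v \in Atilde k C i j.
Proof.
move=> hS; apply: (Atilde_stable (f := sarr_lmul h)) => p h' g a pP h'S gS aA /=.
by rewrite sarr_lmul_mul mulgA; apply: sarr_mul_Atilde; rewrite ?groupM.
Qed.

Lemma sarr_rmul_Atilde i j g v : g \in qstab act i ->
  v \in Atilde k C i j -> sarr_rmul act g v \in Atilde k C i j.
Proof.
move=> gS; apply: (Atilde_stable (f := sarr_rmul act g)) => p h g' a pP hS g'S aA /=.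
by rewrite sarr_rmul_mul -mulgA; apply: sarr_mul_Atilde; rewrite ?groupM.
Qed.

Lemma sarr_eps_Atilde i j v :
  v \in Atilde k C i j -> sarr_eps act i j v \in Atilde k C i j.
Proof.
apply: (Atilde_stable (f := sarr_eps act i j)) => p h g a pP hS gS aA /=.
rewrite sarr_eps_mul; apply/memvZ/sarr_mul_Atilde => //; exact: darr_eps_Abar.
Qed.

End BimoduleFacts.


(* The group acts on column vectors by left multiplication with the matrices
   of the representation, so that a representation is a left module.          *)
Record irr_reps (k : closedFieldType) (gT : finGroupType) (H : {group gT}) := IrrReps {
  irr_idx : finType;
  irr_dim : irr_idx -> nat;
  irr_rep : forall s, mx_representation k H (irr_dim s);
  irr_repP : forall s, mx_irreducible (irr_rep s);
  irr_rep_inj : forall s t, mx_rsim (irr_rep s) (irr_rep t) -> s = t;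
  irr_rep_all : forall n (rG : mx_representation k H n), mx_irreducible rG ->
    exists s, mx_rsim rG (irr_rep s) }.

(* The element dual to the [l]th element of the basis [X]. *)
Definition dual_vec (k : closedFieldType) (U W : vectType k) (B : U -> W -> k)
    (n : nat) (X : n.-tuple U) (l : 'I_n) : W :=
  xget 0 [set w | forall m : 'I_n, B (tnth X m) w = (m == l)%:R].

Section HomSpace.
Variables (k : closedFieldType) (gT : finGroupType) (Q : quiver).
Variables (act : quiver_action gT Q) (C : orbit_choices act).

Definition At (i j : Q) : vectType k := subvs_of (Atilde k C i j).

(* These operations preserve [Atilde]: see [val_At_lmul], [val_At_rmul] and
   [val_At_eps].                                                               *)
Definition At_lmul i j (h : gT) (a : At i j) : At i j :=
  vsproj (Atilde k C i j) (sarr_lmul h (vsval a)).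
Definition At_rmul i j (g : gT) (a : At i j) : At i j :=
  vsproj (Atilde k C i j) (sarr_rmul act g (vsval a)).
Definition At_eps i j (a : At i j) : At i j :=
  vsproj (Atilde k C i j) (sarr_eps act i j (vsval a)).
Definition At_pair i j (a : At i j) (b : At j i) : k :=
  sarr_pair act (vsval a) (vsval b).

Fact At_lmul_is_linear i j h : linear (@At_lmul i j h).
Proof. by move=> c a b; rewrite /At_lmul !linearP. Qed.
HB.instance Definition _ i j h :=
  GRing.isLinear.Build k (At i j) (At i j) *:%R (At_lmul h) (@At_lmul_is_linear i j h).

Fact At_rmul_is_linear i j g : linear (@At_rmul i j g).
Proof. by move=> c a b; rewrite /At_rmul !linearP. Qed.
HB.instance Definition _ i j g :=
  GRing.isLinear.Build k (At i j) (At i j) *:%R (At_rmul g) (@At_rmul_is_linear i j g).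

Fact At_eps_is_linear i j : linear (@At_eps i j).
Proof. by move=> c a b; rewrite /At_eps !linearP. Qed.
HB.instance Definition _ i j :=
  GRing.isLinear.Build k (At i j) (At i j) *:%R (@At_eps i j) (@At_eps_is_linear i j).

Lemma val_At_lmul i j h (a : At i j) : h \in qstab act j ->
  vsval (At_lmul h a) = sarr_lmul h (vsval a).
Proof. by move=> hS; rewrite vsprojK // sarr_lmul_Atilde // subvsP. Qed.

Lemma val_At_rmul i j g (a : At i j) : g \in qstab act i ->
  vsval (At_rmul g a) = sarr_rmul act g (vsval a).
Proof. by move=> gS; rewrite vsprojK // sarr_rmul_Atilde // subvsP. Qed.

Lemma val_At_eps i j (a : At i j) : vsval (At_eps a) = sarr_eps act i j (vsval a).
Proof. by rewrite vsprojK // sarr_eps_Atilde // subvsP. Qed.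

Section Equivariant.
Variables (i j : Q) (n m : nat).
Variables (rho : mx_representation k (qstab act i) n).
Variables (sigma : mx_representation k (qstab act j) m).

Definition lequivar (h : gT) (f : 'Hom(At i j, 'M[k]_(m, n))) :
    'Hom(At i j, 'M[k]_(m, n)) :=
  ((f \o linfun (At_lmul h)) - (linfun (mulmx (sigma h)) \o f))%VF.
Definition requivar (g : gT) (f : 'Hom(At i j, 'M[k]_(m, n))) :
    'Hom(At i j, 'M[k]_(m, n)) :=
  ((f \o linfun (At_rmul g)) - (linfun (mulmxr (rho g)) \o f))%VF.

(* The homomorphisms from the tensor product of [At i j] and [rho] over the
   stabilizer of [i], as balanced bilinear maps: [f a] is the matrix of the map
   [r |-> f (a (x) r)]. See [HomGP].                                           *)
Definition HomG : {vspace 'Hom(At i j, 'M[k]_(m, n))} :=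
  ((\bigcap_(h in qstab act j) lker (linfun (lequivar h)))
   :&: (\bigcap_(g in qstab act i) lker (linfun (requivar g))))%VS.

Fact lequivar_is_linear h : linear (lequivar h).
Proof.
move=> c f g; apply/lfunP => a.
rewrite /lequivar !(comp_lfunE, add_lfunE, opp_lfunE, scale_lfunE) !lfunE /=.
by rewrite mulmxDr -scalemxAr scalerBr opprD addrACA.
Qed.
HB.instance Definition _ h := GRing.isLinear.Build k _ _ *:%R (lequivar h)
  (lequivar_is_linear h).

Fact requivar_is_linear g : linear (requivar g).
Proof.
move=> c f f'; apply/lfunP => a.
rewrite /requivar !(comp_lfunE, add_lfunE, opp_lfunE, scale_lfunE) !lfunE /=.
by rewrite mulmxDl -scalemxAl scalerBr opprD addrACA.
Qed.
HB.instance Definition _ g := GRing.isLinear.Build k _ _ *:%R (requivar g)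
  (requivar_is_linear g).

Lemma HomGP f : f \in HomG <->
  (forall h a, h \in qstab act j -> f (At_lmul h a) = sigma h *m f a) /\
  (forall g a, g \in qstab act i -> f (At_rmul g a) = f a *m rho g).
Proof.
rewrite memv_cap; split=> [/andP[/subv_bigcapP lf /subv_bigcapP rf]|[lf rf]].
  split=> [h a hS|g a gS].
    have := lf h hS; rewrite -memvE memv_ker lfunE => /eqP/lfunP/(_ a).
    rewrite /lequivar !(add_lfunE, opp_lfunE, comp_lfunE) !lfunE /= => /eqP.
    by rewrite subr_eq0 => /eqP.
  have := rf g gS; rewrite -memvE memv_ker lfunE => /eqP/lfunP/(_ a).
  rewrite /requivar !(add_lfunE, opp_lfunE, comp_lfunE) !lfunE /= => /eqP.
  by rewrite subr_eq0 => /eqP.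
apply/andP; split; rewrite memvE; apply/subv_bigcapP => h hS;
  rewrite -memvE memv_ker lfunE; apply/eqP/lfunP => a;
  rewrite /= /lequivar /requivar !(add_lfunE, opp_lfunE, comp_lfunE) !lfunE /=.
  by rewrite lf // subrr.
by rewrite rf // subrr.
Qed.

End Equivariant.

End HomSpace.

Section EpsFacts.
Variables (k : closedFieldType) (gT : finGroupType) (Q : quiver).
Variables (act : quiver_action gT Q) (C : orbit_choices act).
Implicit Types (i j : Q).

Lemma At_eps_lmul i j h (a : At k C i j) : h \in qstab act j ->
  At_eps (At_lmul h a) = At_lmul h (At_eps a).
Proof.
move=> hS; apply/val_inj; rewrite /= val_At_eps !val_At_lmul // val_At_eps.
by apply/ffunP => g; rewrite !ffunE.
Qed.

Lemma At_eps_rmul i j g (a : At k C i j) : g \in qstab act i ->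
  At_eps (At_rmul g a) = At_rmul g (At_eps a).
Proof.
move=> gS; apply/val_inj; rewrite /= val_At_eps !val_At_rmul // val_At_eps.
apply/ffunP => h; rewrite !ffunE linearZ /=; congr (_ *: _).
by apply/ffunP => -[c|c]; rewrite !ffunE.
Qed.

End EpsFacts.

Section QuiverOfOrbits.
Variables (k : closedFieldType) (gT : finGroupType) (Q : quiver).
Variables (act : quiver_action gT Q) (C : orbit_choices act).
Variable irr : forall i : {i : Q | i \in reps C}, irr_reps k (qstab act (val i)).

Definition IG : finType := {i : {i : Q | i \in reps C} & irr_idx (irr i)}.
Definition IGv (x : IG) : Q := val (tag x).
Definition IGdim (x : IG) : nat := irr_dim (tagged x).
Definition IGrep (x : IG) : mx_representation k (qstab act (IGv x)) (IGdim x) :=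
  irr_rep (tagged x).

Definition HG (x y : IG) : vectType k := subvs_of (HomG C (IGrep x) (IGrep y)).

Definition HG_pair (x y : IG) (f : HG x y) (g : HG y x) : k :=
  let X := vbasis {: At k C (IGv x) (IGv y)} in
  \sum_l \tr (vsval g (dual_vec (@At_pair k gT Q act C (IGv x) (IGv y)) X l)
              *m vsval f (tnth X l)).

(* The projection is the identity here: see [val_HG_eps]. *)
Definition HG_eps (x y : IG) (f : HG x y) : HG x y :=
  vsproj (HomG C (IGrep x) (IGrep y))
    (- (vsval f \o linfun (@At_eps k gT Q act C (IGv x) (IGv y))))%VF.

Lemma val_HG_eps (x y : IG) (f : HG x y) :
  vsval (HG_eps f) = (- (vsval f \o linfun (@At_eps k gT Q act C (IGv x) (IGv y))))%VF.
Proof.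
rewrite vsprojK // rpredN; have /HomGP[fl fr] := subvsP f.
apply/HomGP; split=> [h a hS|g a gS]; rewrite !comp_lfunE !lfunE /=.
  by rewrite At_eps_lmul // fl.
by rewrite At_eps_rmul // fr.
Qed.

(* The space of arrows from [x] to [y]. *)
Definition AG (x y : IG) : vectType k := 'Hom(HG x y, k^o).

Fact HG_pair_is_linear x y (f : HG x y) : linear (HG_pair f : HG y x -> k^o).
Proof.
move=> c g h; rewrite /HG_pair scaler_sumr -big_split; apply: eq_bigr => l _ /=.
rewrite add_lfunE scale_lfunE mulmxDl mxtraceD -scalemxAl mxtraceZ.
by [].
Qed.
HB.instance Definition _ x y (f : HG x y) :=
  GRing.isLinear.Build k (HG y x) k^o *:%R (HG_pair f) (HG_pair_is_linear f).

(* The identification of [HG x y] with [AG y x], and its inverse. *)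
Definition AG_of_HG (x y : IG) (f : HG x y) : AG y x :=
  linfun (HG_pair f : HG y x -> k^o).
Definition HG_of_AG (x y : IG) (phi : AG y x) : HG x y :=
  xget 0 [set f | AG_of_HG f = phi].

Definition AG_pair (x y : IG) (psi : AG x y) (phi : AG y x) : k := psi (HG_of_AG phi).
Definition AG_eps (x y : IG) (phi : AG y x) : AG y x := AG_of_HG (HG_eps (HG_of_AG phi)).

Definition AG_basis (x y : IG) : (\dim {: AG x y}).-tuple (AG x y) := vbasis {: AG x y}.

(* The arrows from [x] to [y] are indexed by the basis [AG_basis x y]. *)
Definition QG : quiver :=
  @Quiver IG {p : IG * IG & 'I_(\dim {: AG p.1 p.2})}
    (fun a => (tag a).1) (fun a => (tag a).2).

Definition QG_arrow (x y : IG) (l : 'I_(\dim {: AG x y})) : arrow QG :=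
  existT (fun p : IG * IG => 'I_(\dim {: AG p.1 p.2})) (x, y) l.

Definition AG_path (x y : IG) (phi : AG x y) : path_alg k QG :=
  \sum_l coord (AG_basis x y) l phi *: arr k (QG_arrow l).

Definition preprojG_relator (eta : IG -> k) (x : IG) : path_alg k QG :=
    \sum_(y : IG) \sum_l
      AG_path (AG_eps (dual_vec (@AG_pair x y) (AG_basis x y) l))
      * AG_path (tnth (AG_basis x y) l)
  - eta x *: @vtx k QG x.

Definition preprojG_relators eta (z : path_alg k QG) : Prop :=
  exists x, z = preprojG_relator eta x.

Definition preprojG (eta : IG -> k) : pzRingType := ring_quot (preprojG_relators eta).

End QuiverOfOrbits.

(* Main.v *)
Require Import Defs.
From HB Require Import structures.
From mathcomp Require Import all_boot all_order all_algebra all_fingroup.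
From mathcomp Require Import mxrepresentation pgroup.
From mathcomp Require Import boolp classical_sets finmap ring monalg generic_quotient.
Set Implicit Arguments.
Unset Strict Implicit.
Unset Printing Implicit Defensive.
Import GRing.Theory.
Local Open Scope ring_scope.

(* Write A for the skew group algebra of the deformed preprojective algebra and
   B for the algebra of Q_G.  For x = (i, rho) let E_x be the matrix units
   E_x(a, b) = dim rho / |G_i| * sum_(g in G_i) rho(g^-1)_(b, a) g e_i of A;
   an arrow of Q_G from x to y is an element of E_y(0, 0) V E_x(0, 0), where V
   is the span of the products of group elements and arrows.  This gives a
   homomorphism from B onto the corner of A at the idempotent sum_x E_x(0, 0),
   which is full because the elements g E_x(a, 0) and E_x(0, a) g^-1, weighted
   by 1 / |G_i|, form a partition of unity.  All g in G are used instead of coset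
   representatives, so that the inverse is a homomorphism from A to matrices
   over B with rows and columns indexed by the triples (x, a, g), and an
   equivalence is obtained from the two homomorphisms and two partitions of
   unity.  The relations agree because the relators of both sides are Casimir
   elements: summing over a basis of arrows of Q_G and the dual basis amounts,
   by Schur orthogonality, to summing over the arrows of the double quiver. *)

(** Bijectivity onto the corner is never proved as such: both homomorphisms are defined on
    generators, and only their two composites are computed. Relations must therefore be checked
    twice, in A for the arrows of Q_G and in matrices over B for the double quiver. Both checks
    concern one matrix, the Casimir element taken between the representations at x and x'. In A it
    is computed outright, since the conjugates of the sum of e_i / |G_i| over representatives i add
    up to 1. In B only its trace is known, from the relation at x; but it commutes with the
    stabilizer, so by Schur's lemma it is scalar, or zero between non-isomorphic representations,
    and the trace determines it. This also explains eta: the trace contributes dim rho, and of the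
    factor 1 / (|G_i| |G_j|) in epsilon', the part 1 / |G_j| is absorbed by orbit-stabilizer
    counting while 1 / |G_i| survives. The choices of kappa and of pairs of orbit representatives
    disappear once the bimodule is recognised as e_j V e_i. All homomorphisms are multiplicative
    without preserving units, because their images of 1 are proper idempotents in general. *)

(** * Morita equivalences from matrix-valued homomorphisms *)

(* Not assumed to preserve units: the image of [1] is an idempotent matrix. *)
Record mxhom (A B : pzRingType) (T : finType) := MxHom {
  mxhom_fun :> A -> T -> T -> B;
  mxhomD : forall a b s t, mxhom_fun (a + b) s t = mxhom_fun a s t + mxhom_fun b s t;
  mxhomM : forall a b s t,
    mxhom_fun (a * b) s t = \sum_u mxhom_fun a s u * mxhom_fun b u t }.

Section InducedModule.
Variables (A B : pzRingType) (T : finType) (Th : mxhom A B T) (N : lmodType B).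

Definition mxhom_act (a : A) (n : {ffun T -> N}) : {ffun T -> N} :=
  [ffun t => \sum_u Th a t u *: n u].

Lemma mxhom_actDr a : {morph mxhom_act a : x y / x + y}.
Proof.
move=> x y; apply/ffunP => t; rewrite !ffunE -big_split.
by apply: eq_bigr => u _; rewrite ffunE scalerDr.
Qed.

Lemma mxhom_actDl x : {morph mxhom_act^~ x : a b / a + b}.
Proof.
move=> a b; apply/ffunP => t; rewrite !ffunE -big_split.
by apply: eq_bigr => u _; rewrite mxhomD scalerDl.
Qed.

Lemma mxhom_actM a b x : mxhom_act (a * b) x = mxhom_act a (mxhom_act b x).
Proof.
apply/ffunP => t; rewrite !ffunE.
under [RHS]eq_bigr do rewrite ffunE scaler_sumr.
rewrite exchange_big; apply: eq_bigr => u _ /=.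
rewrite mxhomM scaler_suml; apply: eq_bigr => v _; exact/esym/scalerA.
Qed.

Lemma mxhom_act0 a : mxhom_act a 0 = 0.
Proof. by apply: (addrI (mxhom_act a 0)); rewrite -mxhom_actDr !addr0. Qed.

Lemma mxhom_actN a x : mxhom_act a (- x) = - mxhom_act a x.
Proof.
by apply: (addrI (mxhom_act a x)); rewrite -mxhom_actDr !subrr mxhom_act0.
Qed.

(** As [Th 1] is only an idempotent matrix, [A] acts unitally just on its image in the column
    vectors over [N]. This image is the induced module. *)
Definition mxhom_fixed : {pred {ffun T -> N}} := fun x => mxhom_act 1 x == x.

Fact mxhom_fixed_zmod : zmod_closed mxhom_fixed.
Proof.
split=> [|x y /eqP xF /eqP yF]; apply/eqP; first exact: mxhom_act0.
by rewrite mxhom_actDr mxhom_actN xF yF.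
Qed.
HB.instance Definition _ :=
  GRing.isZmodClosed.Build {ffun T -> N} mxhom_fixed mxhom_fixed_zmod.

Record induced := Induced { induced_val :> {ffun T -> N}; _ : induced_val \in mxhom_fixed }.
HB.instance Definition _ := [isSub for induced_val].
HB.instance Definition _ := [Choice of induced by <:].
HB.instance Definition _ := [SubChoice_isSubZmodule of induced by <:].

Lemma induced_act_proof a (x : induced) : mxhom_act a x \in mxhom_fixed.
Proof. by apply/eqP; rewrite -mxhom_actM mul1r. Qed.
Definition induced_act a (x : induced) : induced := Induced (induced_act_proof a x).

Fact induced_actA a b x : induced_act a (induced_act b x) = induced_act (a * b) x.
Proof. by apply/val_inj; rewrite /= mxhom_actM. Qed.
Fact induced_act1 : left_id 1 induced_act.
Proof. by move=> x; apply/val_inj/eqP; exact: (valP x). Qed.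
Fact induced_actDr : right_distributive induced_act +%R.
Proof. by move=> a x y; apply/val_inj; rewrite /= mxhom_actDr. Qed.
Fact induced_actDl x : {morph induced_act^~ x : a b / a + b}.
Proof. by move=> a b; apply/val_inj; rewrite /= mxhom_actDl. Qed.
HB.instance Definition _ := GRing.Zmodule_isLmodule.Build A induced
  induced_actA induced_act1 induced_actDr induced_actDl.

Lemma val_inducedZ a (x : induced) t : (a *: x : induced) t = \sum_u Th a t u *: x u.
Proof. by rewrite [LHS]ffunE. Qed.

Lemma val_inducedP a (x y : induced) t : (a *: x + y : induced) t = (a *: x : induced) t + y t.
Proof. by rewrite [LHS]ffunE. Qed.

Lemma induced_sumE (I : finType) (F : I -> induced) t :
  (\sum_i F i : induced) t = \sum_i F i t.
Proof.
by elim/big_rec2: _ => [|i y x _ <-]; rewrite ffunE.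
Qed.

Lemma inducedP (x y : induced) : x =1 y -> x = y.
Proof. by move=> xy; apply/val_inj/ffunP. Qed.

End InducedModule.
Arguments mxhom_fixed {A B T} Th N.

Section InducedFunctor.
Variables (A B : pzRingType) (T : finType) (Th : mxhom A B T).

Section Map.
Variables (M N : lmodType B) (f : {linear M -> N}).

Lemma induced_map_proof (x : induced Th M) :
  [ffun t => f (x t)] \in mxhom_fixed Th N.
Proof.
apply/eqP/ffunP => t; rewrite !ffunE.
have /eqP/ffunP/(_ t) := valP x; rewrite ffunE => xt.
rewrite -[in RHS]xt linear_sum; apply: eq_bigr => u _; by rewrite ffunE linearZ.
Qed.
Definition induced_map (x : induced Th M) : induced Th N := Induced (induced_map_proof x).

Lemma induced_mapE x t : induced_map x t = f (x t).
Proof. by rewrite [LHS]ffunE. Qed.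

Fact induced_map_linear : linear induced_map.
Proof.
move=> a x y; apply: inducedP => t.
rewrite val_inducedP !induced_mapE val_inducedP linearD; congr (_ + _).
rewrite !val_inducedZ linear_sum; apply: eq_bigr => u _.
by rewrite linearZ induced_mapE.
Qed.
HB.instance Definition _ := GRing.isLinear.Build A (induced Th M) (induced Th N) *:%R
  induced_map induced_map_linear.
End Map.

Definition induction : functor (Mod B) (Mod A).
Proof.
apply: (@Functor (Mod B) (Mod A) (induced Th) (fun M N f => induced_map f)).
- by move=> M; apply: linear_eq => x; apply: inducedP => t; rewrite induced_mapE.
- move=> M N P f g; apply: linear_eq => x; apply: inducedP => t.
  rewrite [LHS]induced_mapE [RHS]induced_mapE; congr (f _).
  exact/esym/induced_mapE.
Defined.

End InducedFunctor.

Section MoritaUnit.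
Variables (A B : pzRingType) (S T : finType).
Variables (Th : mxhom A B T) (th : mxhom B A S).
Variables w w' : S -> T -> B.
Hypothesis ww' : \sum_s \sum_t w' s t * w s t = 1.
Hypothesis wE : forall b s s' t t', Th (th b s s') t t' = w s t * b * w' s' t'.

(** Inserting [ww'] and using [wE] at [b = 1] writes [w s] as a combination of columns of the
    matrices [Th (th 1 s s')], and [Th 1] fixes these because [1 * th 1 s s' = th 1 s s']. *)
Lemma frame_fixed s t : \sum_u Th 1 t u * w s u = w s t.
Proof.
have e v : w s v = \sum_s' \sum_t' Th (th 1 s s') v t' * w s' t'.
  rewrite -[LHS]mulr1 -[X in _ * X = _]ww' mulr_sumr; apply: eq_bigr => s' _.
  rewrite mulr_sumr; apply: eq_bigr => t' _.
  by rewrite wE mulr1 mulrA.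
under eq_bigr do rewrite e mulr_sumr.
rewrite [RHS]e exchange_big; apply: eq_bigr => s' _ /=.
under eq_bigr do rewrite mulr_sumr.
rewrite exchange_big; apply: eq_bigr => t' _ /=.
rewrite -[in RHS](mul1r (th 1 s s')) mxhomM mulr_suml.
by apply: eq_bigr => u _; rewrite mulrA.
Qed.

Section Unit.
Variable N : lmodType B.

Lemma unit_proof1 (n : N) s : [ffun t => w s t *: n] \in mxhom_fixed Th N.
Proof.
apply/eqP/ffunP => t; rewrite !ffunE -[in RHS](frame_fixed s t) scaler_suml.
by apply: eq_bigr => u _; rewrite ffunE scalerA.
Qed.
Definition unit1 n s : induced Th N := Induced (unit_proof1 n s).

(** By [wE] the left side is [w * b] times the sum of all [w' * w], which is 1. *)
Lemma unit1_act b n s : \sum_s' th b s s' *: unit1 n s' = unit1 (b *: n) s.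
Proof.
apply: inducedP => t; rewrite induced_sumE [RHS]ffunE.
rewrite -[in RHS](scale1r n) -ww' !scalerA mulr_sumr scaler_suml; apply: eq_bigr => s' _.
rewrite val_inducedZ mulr_sumr scaler_suml; apply: eq_bigr => t' _.
by rewrite wE ffunE scalerA mulrA.
Qed.

Lemma unit_proof (n : N) : [ffun s => unit1 n s] \in mxhom_fixed th (induced Th N).
Proof.
apply/eqP/ffunP => s; rewrite !ffunE.
by under eq_bigr do rewrite ffunE; rewrite unit1_act scale1r.
Qed.
Definition morita_unit n : induced th (induced Th N) := Induced (unit_proof n).

Lemma morita_unitE n s t : morita_unit n s t = w s t *: n.
Proof. by rewrite [morita_unit n s]ffunE [LHS]ffunE. Qed.

Fact morita_unit_linear : linear morita_unit.
Proof.
move=> b x y; apply: inducedP => s; rewrite val_inducedP val_inducedZ.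
have -> : \sum_u th b s u *: morita_unit x u = unit1 (b *: x) s.
  by rewrite -unit1_act; apply: eq_bigr => u _; rewrite [morita_unit x u]ffunE.
apply: inducedP => t; rewrite morita_unitE ffunE /= ffunE morita_unitE.
by rewrite scalerDr.
Qed.
HB.instance Definition _ := GRing.isLinear.Build B N (induced th (induced Th N)) *:%R
  morita_unit morita_unit_linear.

Definition morita_counit (x : induced th (induced Th N)) : N :=
  \sum_s \sum_t w' s t *: x s t.

Lemma morita_unitK : cancel morita_unit morita_counit.
Proof.
move=> n; rewrite /morita_counit -[RHS]scale1r -ww' scaler_suml.
apply: eq_bigr => s _; rewrite scaler_suml; apply: eq_bigr => t _.
by rewrite morita_unitE scalerA.
Qed.

(** At [b = 1], [wE] turns [w s t * w' s' t'] into [Th (th 1 s s') t t'], so the composite is the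
    action of [th 1], under which [x] is fixed. *)
Lemma morita_counitK : cancel morita_counit morita_unit.
Proof.
move=> x; apply: inducedP => s; apply: inducedP => t.
rewrite morita_unitE /morita_counit scaler_sumr.
have /eqP/ffunP/(_ s) := valP x; rewrite ffunE => <-.
rewrite induced_sumE; apply: eq_bigr => s' _.
rewrite val_inducedZ scaler_sumr; apply: eq_bigr => t' _.
by rewrite wE mulr1 scalerA.
Qed.

Fact morita_counit_linear : linear morita_counit.
Proof.
move=> b x y; apply: (can_inj morita_unitK).
by rewrite morita_counitK linearP /= !morita_counitK.
Qed.
HB.instance Definition _ := GRing.isLinear.Build B (induced th (induced Th N)) N *:%R
  morita_counit morita_counit_linear.

End Unit.

Lemma morita_nat_iso :
  inhabited (nat_iso (functor_comp (induction th) (induction Th)) (functor_id (Mod B))).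
Proof.
constructor; apply: (@NatIso (Mod B) (Mod B) (functor_comp (induction th) (induction Th))
    (functor_id (Mod B))
    (fun N => @morita_counit N : {linear _ -> _})
    (fun N => @morita_unit N : {linear _ -> _})).
- by move=> N; apply: linear_eq => x; apply: morita_counitK.
- by move=> N; apply: linear_eq => x; apply: morita_unitK.
- move=> M N f; apply: linear_eq => x /=.
  rewrite /morita_counit linear_sum; apply: eq_bigr => s _.
  rewrite linear_sum; apply: eq_bigr => t _.
  by rewrite linearZ /= !induced_mapE.
Qed.

End MoritaUnit.

(** The hypotheses are symmetric in [A] and [B], so one unit construction, used twice, supplies both
    natural isomorphisms. The two partitions of unity play the part of the dual bases of a
    progenerator. *)
Lemma morita_equivalent (A B : pzRingType) (S T : finType)
    (Th : mxhom A B T) (th : mxhom B A S) (w w' : S -> T -> B) (u u' : T -> S -> A) :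
  \sum_s \sum_t w' s t * w s t = 1 ->
  (forall b s s' t t', Th (th b s s') t t' = w s t * b * w' s' t') ->
  \sum_t \sum_s u' t s * u t s = 1 ->
  (forall a t t' s s', th (Th a t t') s s' = u t s * a * u' t' s') ->
  equivalent (Mod A) (Mod B).
Proof.
move=> ww wE uu uE; exists (induction th), (induction Th); split.
  exact: (morita_nat_iso uu uE).
exact: (morita_nat_iso ww wE).
Qed.

(** * Algebras over a field and homomorphisms out of their presentations *)

(* MathComp's [algType] excludes the zero algebra, which occurs here. *)
HB.mixin Record PzRing_isAlgebra (k : comPzRingType) A of GRing.PzRing A := {
  inalg : k -> A;
  inalg1 : inalg 1 = 1;
  inalgD : {morph inalg : c d / c + d};
  inalgM : {morph inalg : c d / c * d};
  inalgC : forall c x, inalg c * x = x * inalg c }.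
#[short(type="pzAlgType")]
HB.structure Definition PzAlgebra (k : comPzRingType) :=
  {A of GRing.PzRing A & PzRing_isAlgebra k A}.

Notation "c %:I" := (inalg c) (at level 2, left associativity, format "c %:I").

Section AlgebraTheory.
Variables (k : comPzRingType) (A : pzAlgType k).
Implicit Types (c d : k) (x y : A).

Lemma inalg0 : 0%:I = 0 :> A.
Proof. by apply: (addrI (0%:I)); rewrite -inalgD !addr0. Qed.

Lemma inalgN c : (- c)%:I = - c%:I :> A.
Proof. by apply: (addrI (c%:I)); rewrite -inalgD !subrr inalg0. Qed.

Lemma inalg_sum (I : Type) (r : seq I) (P : pred I) (F : I -> k) :
  (\sum_(i <- r | P i) F i)%:I = \sum_(i <- r | P i) (F i)%:I :> A.
Proof. exact: (big_morph _ (@inalgD _ _) inalg0). Qed.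

Lemma inalgCA c x y : x * (c%:I * y) = c%:I * (x * y).
Proof. by rewrite mulrA -inalgC mulrA. Qed.

Lemma inalgMn n x : (n%:R)%:I * x = x *+ n.
Proof.
elim: n => [|n IHn]; first by rewrite inalg0 mul0r.
by rewrite !mulrS inalgD inalg1 mulrDl mul1r IHn.
Qed.

(** [lin_ext] takes values in a module over [k]; this alias turns the central map [inalg] into a
    scalar multiplication. *)
Definition scaled : Type := A.
HB.instance Definition _ := GRing.Zmodule.on scaled.
Definition scaled_scale c (x : scaled) : scaled := c%:I * x.
Fact scaled_scaleA c d x : scaled_scale c (scaled_scale d x) = scaled_scale (c * d) x.
Proof. by rewrite /scaled_scale inalgM mulrA. Qed.
Fact scaled_scale1 : left_id 1 scaled_scale.
Proof. by move=> x; rewrite /scaled_scale inalg1 mul1r. Qed.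
Fact scaled_scaleDr : right_distributive scaled_scale +%R.
Proof. by move=> c x y; rewrite /scaled_scale [LHS]mulrDr. Qed.
Fact scaled_scaleDl x : {morph scaled_scale^~ x : c d / c + d}.
Proof. by move=> c d; rewrite /scaled_scale inalgD mulrDl. Qed.
HB.instance Definition _ := GRing.Zmodule_isLmodule.Build k scaled
  scaled_scaleA scaled_scale1 scaled_scaleDr scaled_scaleDl.

End AlgebraTheory.

Lemma malg_sumE (k : closedFieldType) (K : choiceType) (x : {malg k[K]}) :
  x = \sum_(p <- msupp x) x@_p *: << p >>.
Proof.
rewrite {1}[x]monalgE; apply: eq_bigr => p _.
by apply/malgP => q; rewrite mcoeffZ !mcoeffU mulrnAr mulr1.
Qed.

Section PathAlgebraAlg.
Variables (k : closedFieldType) (Q : quiver).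

Definition path_inalg (c : k) : path_alg k Q := c *: (1 : path_alg k Q).

Lemma path_inalgE c x : path_inalg c * x = c *: x.
Proof. by rewrite [LHS](path_mulZl c 1 x) [path_mul _ _](mul1r x). Qed.

Fact path_inalg1 : path_inalg 1 = 1.
Proof. exact: scale1r. Qed.
Fact path_inalgD : {morph path_inalg : c d / c + d}.
Proof. by move=> c d; rewrite /path_inalg scalerDl. Qed.
Fact path_inalgM : {morph path_inalg : c d / c * d}.
Proof. by move=> c d; rewrite path_inalgE /path_inalg scalerA. Qed.
Fact path_inalgC c x : path_inalg c * x = x * path_inalg c.
Proof.
rewrite path_inalgE [RHS](_ : _ = path_mul x (c *: (1 : path_alg k Q))) //.
by rewrite linearZ; congr (_ *: _); exact/esym/(mulr1 x).
Qed.
HB.instance Definition _ := PzRing_isAlgebra.Build k (path_alg k Q)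
  path_inalg1 path_inalgD path_inalgM path_inalgC.

Lemma path_scaleE c (x : path_alg k Q) : c *: x = c%:I * x.
Proof. exact/esym/path_inalgE. Qed.

Lemma path_scaleAl c (x y : path_alg k Q) : c *: x * y = c *: (x * y).
Proof. by rewrite !path_scaleE mulrA. Qed.

Lemma path_scaleAr c (x y : path_alg k Q) : x * (c *: y) = c *: (x * y).
Proof. by rewrite !path_scaleE inalgCA. Qed.

(** Products run from right to left, so a path is taken apart at its last arrow, which is the left
    factor. *)
Lemma path_alg_ind (P : path_alg k Q -> Prop) :
  (forall c x y, P x -> P y -> P (c *: x + y)) -> P 0 ->
  (forall x y, P x -> P y -> P (x * y)) ->
  (forall i, P (vtx k i)) -> (forall a, P (arr k a)) -> forall x, P x.
Proof.
move=> PL P0 PM Pv Pa x.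
have Pp (p : qpath Q) : P << p >>.
  case: p => [[i s] ps]; elim/last_ind: s i ps => [|s a IHs] i ps.
    have -> : QPath ps = triv_path i by apply/val_inj.
    exact: Pv.
  have ps' : is_path (i, s).1 (i, s).2 by move: (ps); rewrite /= -cats1 is_path_cat => /andP[].
  have e : path_end (QPath ps') = (arrow_path a).1.
    by move: (ps); rewrite /= -cats1 is_path_cat /= => /and3P[_ /eqP ->].
  have [r rE rv] := path_compP e.
  have -> : << QPath ps >> = arr k a * << QPath ps' >>.
    rewrite [RHS]path_mulE /path_mul_basis rE; congr << _ >>; apply/val_inj.
    by rewrite rv /= cats1.
  by apply: PM; [exact: Pa | exact: IHs].
rewrite [x]malg_sumE; elim/big_rec: _ => [//|p y _ Py]; exact: PL.
Qed.

Section Eval.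
Variables (D : pzAlgType k) (E : Q -> D) (X : arrow Q -> D).
Hypothesis EE : forall i j, E i * E j = if i == j then E i else 0.
Hypothesis EX : forall a, E (qhead a) * X a = X a.
Hypothesis XE : forall a, X a * E (qtail a) = X a.

(** Starting the product at [E p.1] instead of 1 gives trivial paths their value and keeps the
    evaluation multiplicative when the [E i] do not add up to 1, as happens for corner
    idempotents. *)
Definition eval_path (p : qpath Q) : D := foldl (fun d a => X a * d) (E p.1) p.2.
Definition path_eval : path_alg k Q -> scaled D := lin_ext (M := scaled D) eval_path.
HB.instance Definition _ := GRing.Linear.on path_eval.

Lemma path_evalZ c x : path_eval (c *: x) = c%:I * path_eval x.
Proof. exact: linearZ. Qed.

Lemma path_evalU p : path_eval << p >> = eval_path p.
Proof. exact: lin_extU. Qed.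

Lemma path_eval_vtx i : path_eval (vtx k i) = E i.
Proof. exact: path_evalU. Qed.

Lemma path_eval_arr a : path_eval (arr k a) = X a.
Proof. by rewrite path_evalU /eval_path /= XE. Qed.

Let run := foldl (fun d a => X a * d).

Let runM d e s : run (d * e) s = run d s * e.
Proof. by elim: s d => //= a s IHs d; rewrite mulrA IHs. Qed.

Lemma eval_path_source (p : qpath Q) : eval_path p * E p.1 = eval_path p.
Proof. by rewrite /eval_path -runM EE eqxx. Qed.

Lemma eval_path_target (p : qpath Q) : E (path_end p) * eval_path p = eval_path p.
Proof.
case: p => [[i s] ps]; rewrite /eval_path /path_end /=.
elim/last_ind: s {ps} => [|s a IHs]; first by rewrite /= EE eqxx.
by rewrite -cats1 map_cat last_cat foldl_cat /= mulrA EX.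
Qed.

(** For paths that do not compose, the orthogonal idempotents at the source of [p] and the end of
    [q] meet and annihilate the product. *)
Lemma eval_pathM (p q : qpath Q) :
  path_eval (path_mul_basis k p q) = (eval_path p * eval_path q : D).
Proof.
rewrite /path_mul_basis; have [e|n] := eqVneq (path_end q) p.1.
  have [r -> rE] := path_compP e; rewrite path_evalU.
  have -> : eval_path r = run (eval_path q) p.2.
    by rewrite /eval_path -[qpath_val r]/(val r) rE /= foldl_cat.
  by rewrite -[in LHS](eval_path_target q) e runM.
rewrite (path_compN n) linear0 -[eval_path p]eval_path_source -[eval_path q]eval_path_target.
by rewrite -mulrA (mulrA (E _)) EE eq_sym (negbTE n) mul0r mulr0.
Qed.

Lemma path_evalM x y : path_eval (x * y) = (path_eval x * path_eval y : D).
Proof.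
have mE z : z = \sum_(p <- msupp z) z@_p *: (<< p >> : path_alg k Q).
  exact: malg_sumE.
suff H p y' : path_eval ((<< p >> : path_alg k Q) * y') = (eval_path p * path_eval y' : D).
  rewrite [x]mE mulr_suml !linear_sum [RHS]mulr_suml; apply: eq_bigr => p _ /=.
  by rewrite path_scaleAl [LHS]path_evalZ H [path_eval (_ *: _)]path_evalZ path_evalU [LHS]mulrA.
rewrite [y']mE mulr_sumr !linear_sum [RHS]mulr_sumr; apply: eq_bigr => q _ /=.
rewrite path_scaleAr [LHS]path_evalZ [path_eval (_ *: _)]path_evalZ path_evalU [RHS]inalgCA; congr (_ * _).
by rewrite [_ * _]path_mulE eval_pathM.
Qed.

End Eval.
End PathAlgebraAlg.

Section QuotientAlg.
Variables (k : comPzRingType) (R : pzAlgType k) (S : R -> Prop).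
Local Notation RS := (ring_quot S).

Lemma to_quotE x y : to_quot S (x * y) = to_quot S x * to_quot S y.
Proof. exact/esym/to_quotM. Qed.

Lemma to_quot0 : to_quot S 0 = 0.
Proof. by apply: (addrI (to_quot S 0)); rewrite -to_quotD !addr0. Qed.

Lemma to_quot_sum (I : Type) (r : seq I) (P : pred I) (F : I -> R) :
  to_quot S (\sum_(i <- r | P i) F i) = \sum_(i <- r | P i) to_quot S (F i).
Proof. exact: (big_morph _ (@to_quotD _ _) to_quot0). Qed.

Definition quot_inalg (c : k) : RS := to_quot S c%:I.

Fact quot_inalg1 : quot_inalg 1 = 1.
Proof. by rewrite /quot_inalg inalg1. Qed.
Fact quot_inalgD : {morph quot_inalg : c d / c + d}.
Proof. by move=> c d; rewrite /quot_inalg inalgD to_quotD. Qed.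
Fact quot_inalgM : {morph quot_inalg : c d / c * d}.
Proof. by move=> c d; rewrite /quot_inalg inalgM to_quotE. Qed.
Fact quot_inalgC c u : quot_inalg c * u = u * quot_inalg c.
Proof. by rewrite -(repr_quotK u) -!to_quotE inalgC. Qed.
HB.instance Definition _ := PzRing_isAlgebra.Build k RS
  quot_inalg1 quot_inalgD quot_inalgM quot_inalgC.

Lemma to_quot_inalg c : to_quot S c%:I = c%:I.
Proof. by []. Qed.

Section Factor.
Variables (D : pzRingType) (f : R -> D).
Hypothesis fD : forall x y, f (x + y) = f x + f y.
Hypothesis fM : forall x y, f (x * y) = f x * f y.
Hypothesis fS : forall x, S x -> f x = 0.

Definition quot_lift (u : RS) : D := f (repr u).

Lemma quot_liftE x : quot_lift (to_quot S x) = f x.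
Proof.
have f0 : f 0 = 0 by apply: (addrI (f 0)); rewrite -fD !addr0.
have fI y : two_sided_ideal S y -> f y = 0.
  elim=> {y} [y /fS //||y z _ fy _ fz|a y _ fy|y a _ fy] //.
  - by rewrite fD fy fz addr0.
  - by rewrite fM fy mulr0.
  - by rewrite fM fy mul0r.
rewrite /quot_lift -[in RHS](subrK (repr (to_quot S x)) x) fD.
by rewrite (fI (x - _)) ?add0r //; apply: to_quot_repr.
Qed.

Lemma quot_liftD u v : quot_lift (u + v) = quot_lift u + quot_lift v.
Proof. by rewrite -(repr_quotK u) -(repr_quotK v) -to_quotD !quot_liftE fD. Qed.

Lemma quot_liftM u v : quot_lift (u * v) = quot_lift u * quot_lift v.
Proof. by rewrite -(repr_quotK u) -(repr_quotK v) -to_quotE !quot_liftE fM. Qed.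

End Factor.
End QuotientAlg.

(** * Generators of skew group algebras and homomorphisms out of them *)

Section SkewAlg.
Variables (gT : finGroupType) (R : pzRingType) (act : ring_action gT R).
Local Notation RG := (skew_alg act).

Lemma skew_sum (x : RG) : x = \sum_g skew_group act g * skew_ring act (x g).
Proof.
apply/ffunP => h; rewrite sum_ffunE (bigD1 h) //= big1 => [|g ng].
  rewrite addr0 skew_algM (bigD1 1%g) //= big1 => [|g ng].
    by rewrite addr0 invg1 mulg1 ract_id skew_groupE skew_ringE !eqxx mul1r.
  by rewrite skew_ringE (negbTE ng) mulr0.
rewrite skew_algM (bigD1 1%g) //= big1 => [|g' ng'].
  rewrite addr0 invg1 mulg1 ract_id skew_groupE skew_ringE eqxx eq_sym (negbTE ng).
  by rewrite mul0r.
by rewrite skew_ringE (negbTE ng') mulr0.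
Qed.

Lemma skew_groupM g h : skew_group act (g * h)%g = skew_group act g * skew_group act h.
Proof.
apply/ffunP => u; rewrite skew_algM (bigD1 h) //= big1 => [|g' ng].
  rewrite addr0 !skew_groupE eqxx mulr1 -[u == _](inj_eq (mulIg h^-1%g)) mulgK.
  by case: eqP => _; rewrite ?ract1 ?ract0.
by rewrite !skew_groupE (negbTE ng) mulr0.
Qed.

Lemma skew_group1 : skew_group act 1%g = 1.
Proof. by []. Qed.

Lemma skew_ringD x y :
  skew_ring act (x + y) = skew_ring act x + skew_ring act y.
Proof.
by apply/ffunP => g; rewrite [RHS]ffunE !skew_ringE; case: eqP; rewrite ?addr0.
Qed.

Lemma skew_ring0 : skew_ring act 0 = 0.
Proof. by apply/ffunP => g; rewrite skew_ringE [RHS]ffunE; case: eqP. Qed.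

Lemma skew_ringM x y : skew_ring act (x * y) = skew_ring act x * skew_ring act y.
Proof.
apply/ffunP => u; rewrite skew_algM (bigD1 1%g) //= big1 => [|g ng].
  rewrite addr0 !skew_ringE eqxx invg1 mulg1 ract_id.
  by case: eqP; rewrite ?mul0r.
by rewrite !skew_ringE (negbTE ng) mulr0.
Qed.

Lemma skew_ring_group g x :
  skew_group act g * skew_ring act x = skew_ring act (act g x) * skew_group act g.
Proof.
apply/ffunP => u; rewrite !skew_algM (bigD1 1%g) //= big1 => [|h nh]; last first.
  by rewrite [skew_ring _ _ _]skew_ringE (negbTE nh) mulr0.
rewrite [RHS](bigD1 g) //= big1 => [|h nh]; last first.
  by rewrite skew_groupE (negbTE nh) mulr0.
rewrite !addr0 !skew_groupE !skew_ringE !eqxx invg1 mulg1 ract_id mulr1.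
rewrite -[u == g](inj_eq (mulIg g^-1%g)) mulgV; case: eqP => _; last by rewrite ract0 mul0r.
by rewrite mul1r -ract_comp mulVg ract_id.
Qed.

Lemma skew_ringC z (x : RG) : (forall y, z * y = y * z) -> (forall g, act g z = z) ->
  skew_ring act z * x = x * skew_ring act z.
Proof.
move=> zC zact; rewrite [x]skew_sum mulr_sumr mulr_suml; apply: eq_bigr => g _.
rewrite -mulrA -skew_ringM -zC skew_ringM !mulrA; congr (_ * _).
by rewrite skew_ring_group zact.
Qed.

Lemma skew_alg_ind (P : RG -> Prop) :
  (forall x y, P x -> P y -> P (x + y)) -> P 0 ->
  (forall x y, P x -> P y -> P (x * y)) ->
  (forall g, P (skew_group act g)) -> (forall x, P (skew_ring act x)) -> forall x, P x.
Proof.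
move=> PD P0 PM Pg Pr x; rewrite [x]skew_sum.
by elim/big_rec: _ => // g y _ Py; apply: PD => //; apply: PM.
Qed.

Section Lift.
Variables (D : pzRingType) (f : R -> D) (P : gT -> D).
Hypothesis fD : forall x y, f (x + y) = f x + f y.
Hypothesis fM : forall x y, f (x * y) = f x * f y.
Hypothesis PM : forall g h, P (g * h)%g = P g * P h.
Hypothesis Pf : forall g x, P g * f x = f (act g x) * P g.
Hypothesis P1 : P 1%g = f 1.

(** The condition [P1] compares [P 1] with [f 1] and not with the unit: in the application both are
    the same idempotent matrix. *)
Definition skew_lift (x : RG) : D := \sum_g P g * f (x g).

Lemma skew_liftD x y : skew_lift (x + y) = skew_lift x + skew_lift y.
Proof.
rewrite /skew_lift -big_split; apply: eq_bigr => g _.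
by rewrite ffunE fD mulrDr.
Qed.

Let f0 : f 0 = 0.
Proof. by apply: (addrI (f 0)); rewrite -fD !addr0. Qed.

Let f_sum (I : finType) (F : I -> R) : f (\sum_i F i) = \sum_i f (F i).
Proof. exact: (big_morph f fD f0). Qed.

Lemma skew_liftM x y : skew_lift (x * y) = skew_lift x * skew_lift y.
Proof.
rewrite /skew_lift mulr_suml; under [RHS]eq_bigr do rewrite mulr_sumr.
rewrite [RHS]exchange_big.
under [LHS]eq_bigr do rewrite skew_algM f_sum mulr_sumr.
rewrite [LHS]exchange_big; apply: eq_bigr => h _ /=.
rewrite (reindex_inj (mulIg h)) /=; apply: eq_bigr => g _.
rewrite mulgK fM PM !mulrA; congr (_ * _).
rewrite -!mulrA; congr (_ * _).
by rewrite Pf -ract_comp mulgV ract_id.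
Qed.

Lemma skew_lift_ring x : skew_lift (skew_ring act x) = f x.
Proof.
rewrite /skew_lift (bigD1 1%g) //= big1 => [|g ng].
  by rewrite skew_ringE eqxx addr0 P1 -fM mul1r.
by rewrite skew_ringE (negbTE ng) f0 mulr0.
Qed.

Lemma skew_lift_group g : skew_lift (skew_group act g) = P g.
Proof.
rewrite /skew_lift (bigD1 g) //= big1 => [|h nh].
  by rewrite skew_groupE eqxx addr0 -P1 -PM mulg1.
by rewrite skew_groupE (negbTE nh) f0 mulr0.
Qed.

End Lift.
End SkewAlg.

(** * Square matrices over an algebra, with rows and columns indexed by a finite type *)

Section MatrixAlgebra.
Variables (k : comPzRingType) (B : pzAlgType k) (T : finType).

Definition sqmx : Type := {ffun T -> {ffun T -> B}}.
HB.instance Definition _ := GRing.Zmodule.on sqmx.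

Definition to_sqmx (F : T -> T -> B) : sqmx := [ffun s => [ffun t => F s t]].
Lemma to_sqmxE F s t : to_sqmx F s t = F s t.
Proof. by rewrite /to_sqmx !ffunE. Qed.

Lemma sqmxP (M N : sqmx) : (forall s t, M s t = N s t) -> M = N.
Proof. by move=> e; apply/ffunP => s; apply/ffunP => t. Qed.

Definition sqmx_mul (M N : sqmx) : sqmx := to_sqmx (fun s t => \sum_u M s u * N u t).
Definition sqmx_one : sqmx := to_sqmx (fun s t => (s == t)%:R).

Lemma sqmxDE (M N : sqmx) s t : (M + N) s t = M s t + N s t.
Proof. by rewrite !ffunE. Qed.
Fact sqmx_mulA : associative sqmx_mul.
Proof.
move=> L M N; apply: sqmxP => s t; rewrite !to_sqmxE.
under eq_bigr do rewrite to_sqmxE mulr_sumr.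
under [RHS]eq_bigr do rewrite to_sqmxE mulr_suml.
rewrite exchange_big; apply: eq_bigr => u _; apply: eq_bigr => v _; exact: mulrA.
Qed.
Fact sqmx_mul1 : left_id sqmx_one sqmx_mul.
Proof.
move=> M; apply: sqmxP => s t; rewrite to_sqmxE (bigD1 s) //= big1 => [|u n].
  by rewrite to_sqmxE eqxx mul1r addr0.
by rewrite to_sqmxE eq_sym (negbTE n) mul0r.
Qed.
Fact sqmx_mulr1 : right_id sqmx_one sqmx_mul.
Proof.
move=> M; apply: sqmxP => s t; rewrite to_sqmxE (bigD1 t) //= big1 => [|u n].
  by rewrite to_sqmxE eqxx mulr1 addr0.
by rewrite to_sqmxE (negbTE n) mulr0.
Qed.
Fact sqmx_mulDl : left_distributive sqmx_mul +%R.
Proof.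
move=> L M N; apply: sqmxP => s t; rewrite sqmxDE !to_sqmxE -big_split.
by apply: eq_bigr => u _; rewrite sqmxDE mulrDl.
Qed.
Fact sqmx_mulDr : right_distributive sqmx_mul +%R.
Proof.
move=> L M N; apply: sqmxP => s t; rewrite sqmxDE !to_sqmxE -big_split.
by apply: eq_bigr => u _; rewrite sqmxDE mulrDr.
Qed.
HB.instance Definition _ := GRing.Zmodule_isPzRing.Build sqmx
  sqmx_mulA sqmx_mul1 sqmx_mulr1 sqmx_mulDl sqmx_mulDr.

Lemma sqmxME (M N : sqmx) s t : (M * N) s t = \sum_u M s u * N u t.
Proof. exact: to_sqmxE. Qed.

Definition sqmx_inalg (c : k) : sqmx := to_sqmx (fun s t => if s == t then c%:I else 0).

Lemma sqmx_inalgE c (M : sqmx) s t : (sqmx_inalg c * M) s t = c%:I * M s t.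
Proof.
rewrite sqmxME (bigD1 s) //= big1 => [|u n]; first by rewrite to_sqmxE eqxx addr0.
by rewrite to_sqmxE eq_sym (negbTE n) mul0r.
Qed.

Fact sqmx_inalg1 : sqmx_inalg 1 = 1.
Proof.
by apply: sqmxP => s t; rewrite !to_sqmxE inalg1; case: eqP.
Qed.
Fact sqmx_inalgD : {morph sqmx_inalg : c d / c + d}.
Proof.
move=> c d; apply: sqmxP => s t; rewrite sqmxDE !to_sqmxE inalgD.
by case: eqP; rewrite ?addr0.
Qed.
Fact sqmx_inalgM : {morph sqmx_inalg : c d / c * d}.
Proof.
move=> c d; apply: sqmxP => s t; rewrite sqmx_inalgE !to_sqmxE inalgM.
by case: eqP; rewrite ?mulr0.
Qed.
Fact sqmx_inalgC c (M : sqmx) : sqmx_inalg c * M = M * sqmx_inalg c.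
Proof.
apply: sqmxP => s t; rewrite sqmx_inalgE sqmxME (bigD1 t) //= big1 => [|u n].
  by rewrite to_sqmxE eqxx addr0 inalgC.
by rewrite to_sqmxE (negbTE n) mulr0.
Qed.
HB.instance Definition _ := PzRing_isAlgebra.Build k sqmx
  sqmx_inalg1 sqmx_inalgD sqmx_inalgM sqmx_inalgC.

Lemma sqmxZE c (M : sqmx) s t : (c%:I * M) s t = c%:I * M s t.
Proof. exact: sqmx_inalgE. Qed.

End MatrixAlgebra.

Section PreprojSkewAlg.
Variables (k : closedFieldType) (gT : finGroupType) (Q : quiver).
Variables (act : quiver_action gT Q) (lam : Q -> k) (lamG : orbit_invariant act lam).
Local Notation PG := (skew_alg (preproj_action lamG)).

Lemma preproj_act_inalg g c :
  preproj_action lamG g (c%:I : ring_quot (preproj_relators lam)) = c%:I.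
Proof.
rewrite -to_quot_inalg /= quot_actE; last exact: preproj_relators_act.
apply: congr1; rewrite [LHS]linearZ; congr (_ *: _); exact: path_alg_act1.
Qed.

Definition skew_inalg (c : k) : PG := skew_ring _ (c%:I : ring_quot (preproj_relators lam)).

Fact skew_inalg1 : skew_inalg 1 = 1.
Proof. by rewrite /skew_inalg inalg1. Qed.
Fact skew_inalgD : {morph skew_inalg : c d / c + d}.
Proof. by move=> c d; rewrite /skew_inalg inalgD skew_ringD. Qed.
Fact skew_inalgM : {morph skew_inalg : c d / c * d}.
Proof. by move=> c d; rewrite /skew_inalg inalgM skew_ringM. Qed.
Fact skew_inalgC c x : skew_inalg c * x = x * skew_inalg c.
Proof.
apply: skew_ringC => [y|g]; first exact: inalgC.
exact: preproj_act_inalg.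
Qed.
HB.instance Definition _ := PzRing_isAlgebra.Build k PG
  skew_inalg1 skew_inalgD skew_inalgM skew_inalgC.
End PreprojSkewAlg.

(** * Orthogonality relations for irreducible representations *)

Section Orthogonality.
Variables (k : closedFieldType) (gT : finGroupType) (H : {group gT}).
Hypothesis kH : ([pchar k]^'.-group H)%g.

Lemma card_group_neq0 : #|H|%:R != 0 :> k.
Proof. by rewrite natf_neq0_pchar. Qed.

Section TwoReps.
Variables (n m : nat) (rG : mx_representation k H n) (sG : mx_representation k H m).

Lemma average_intertwines (B : 'M_(n, m)) x : x \in H ->
  rG x *m (\sum_(g in H) rG g *m B *m sG g^-1%g)
  = (\sum_(g in H) rG g *m B *m sG g^-1%g) *m sG x.
Proof.
move=> xH; rewrite mulmx_sumr mulmx_suml [RHS](reindex_inj (mulgI x)) /=.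
apply: eq_big => [g|g gH]; first by rewrite groupMl.
by rewrite repr_mxM // -!mulmxA -repr_mxM ?groupV ?groupM // invMg mulgKV.
Qed.

(** Schur's lemma: the kernel and the row space of [B] are submodules, so the former is zero and the
    latter is everything. *)
Lemma irr_hom_rsim (B : 'M_(n, m)) : mx_irreducible rG -> mx_irreducible sG ->
  (forall x, x \in H -> rG x *m B = B *m sG x) -> B != 0 -> mx_rsim rG sG.
Proof.
move=> /mx_irrP[n0 rI] /mx_irrP[m0 sI] BH nzB.
have kB : kermx B = 0.
  apply/eqP; apply: contraNT nzB => nz.
  have /rI/(_ nz) : mxmodule rG (kermx B).
    apply/mxmoduleP => x xH; apply/sub_kermxP.
    by rewrite -mulmxA BH // mulmxA mulmx_ker mul0mx.
  rewrite -sub1mx => /sub_kermxP; by rewrite mul1mx => ->.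
have fB : row_free B by rewrite -kermx_eq0 kB.
have : row_full <<B>>%MS.
  apply: sI; last by rewrite -mxrank_eq0 genmxE mxrank_eq0.
  rewrite (eqmx_module _ (genmxE B)); apply/mxmoduleP => x xH.
  by rewrite -BH // submxMl.
rewrite /row_full genmxE => /eqP rB.
by apply: (MxReprSim (B := B)) => //; rewrite -rB; exact/esym/eqP.
Qed.

(** The sum is the entry [(a, d)] of the average of the elementary matrix [delta_mx b c], an
    intertwiner and hence zero. *)
Lemma orthogonality_neq a b c d : mx_irreducible rG -> mx_irreducible sG ->
  ~ mx_rsim rG sG -> \sum_(g in H) rG g a b * sG g^-1%g c d = 0.
Proof.
move=> rI sI ns; pose B := \sum_(g in H) rG g *m delta_mx b c *m sG g^-1%g.
have B0 : B = 0.
  apply/eqP; apply/negPn/negP => nz; apply: ns.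
  apply: irr_hom_rsim nz => // x; exact: average_intertwines.
have : B a d = 0 by rewrite B0 mxE.
rewrite summxE => BE; rewrite -[RHS]BE; apply: eq_bigr => g gH.
rewrite mxE (bigD1 c) //= mxE (bigD1 b) //= mxE !eqxx mulr1.
rewrite big1 ?addr0 => [|e ne]; last by rewrite mxE (negbTE ne) mulr0.
rewrite big1 ?addr0 // => e ne; rewrite mxE big1 ?mul0r // => f _.
by rewrite mxE (negbTE ne) andbF mulr0.
Qed.
End TwoReps.

Section OneRep.
Variables (n : nat) (rG : mx_representation k H n).
Hypothesis rI : mx_irreducible rG.

(** The average of [delta_mx b c] is a scalar matrix, and its trace gives [n] times the scalar. The
    factor [n] stays on the left because its invertibility in [k] is a consequence of this identity,
    drawn in [irr_dim_neq0]. *)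
Lemma orthogonality_aux a b c d :
  n%:R * \sum_(g in H) rG g a b * rG g^-1%g c d = ((a == d) && (b == c))%:R * #|H|%:R.
Proof.
pose B := \sum_(g in H) rG g *m delta_mx b c *m rG g^-1%g.
have : is_scalar_mx B.
  apply: (mx_abs_irr_cent_scalar (rG := rG)).
    exact: (@group_closure_closed_field k gT H n rG).
  by apply/centgmxP => x xH; rewrite average_intertwines.
case/is_scalar_mxP => z Bz.
have -> : \sum_(g in H) rG g a b * rG g^-1%g c d = (a == d)%:R * z.
  have := congr1 (fun M : 'M_n => M a d) Bz; rewrite /= summxE mxE mulr_natl => <-.
  apply: eq_bigr => g gH.
  rewrite mxE (bigD1 c) //= mxE (bigD1 b) //= mxE !eqxx mulr1.
  rewrite big1 ?addr0 => [|e ne]; last by rewrite mxE (negbTE ne) mulr0.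
  rewrite big1 ?addr0 // => e ne; rewrite mxE big1 ?mul0r // => f _.
  by rewrite mxE (negbTE ne) andbF mulr0.
have : \tr B = n%:R * z by rewrite Bz mxtrace_scalar mulr_natl.
rewrite raddf_sum /=.
have -> : \sum_(g in H) \tr (rG g *m delta_mx b c *m rG g^-1%g) = (b == c)%:R * #|H|%:R.
  rewrite (eq_bigr (fun=> (b == c)%:R)) => [|g gH].
    by rewrite sumr_const mulr_natr.
  rewrite mxtrace_mulC mulmxA -repr_mxM ?groupV // mulVg repr_mx1 mul1mx.
  rewrite /mxtrace (bigD1 b) //= mxE eqxx andTb big1 ?addr0 // => e ne.
  by rewrite mxE (negbTE ne).
by move=> e; rewrite mulrCA -e mulrA -mulnb natrM.
Qed.

(** With all four indices equal, the preceding identity writes the order of the group, invertible in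
    [k], as a multiple of [n]. *)
Lemma irr_dim_neq0 : n%:R != 0 :> k.
Proof.
have /mx_irrP[n0 _] := rI; pose a := Ordinal n0.
have := orthogonality_aux a a a a; rewrite eqxx mul1r => e.
by apply/eqP => n0'; move/eqP: e; rewrite n0' mul0r eq_sym (negbTE card_group_neq0).
Qed.

Lemma orthogonality_eq a b c d :
  \sum_(g in H) rG g a b * rG g^-1%g c d
  = ((a == d) && (b == c))%:R * (#|H|%:R / n%:R).
Proof.
apply: (mulfI irr_dim_neq0); rewrite orthogonality_aux mulrCA.
by rewrite [n%:R * _]mulrC divfK // irr_dim_neq0.
Qed.
End OneRep.

Lemma regular_trace x : x \in H ->
  \tr (regular_repr k H x) = (x == 1%g)%:R * #|H|%:R.
Proof.
move=> xH; rewrite /mxtrace (eq_bigr (fun=> (x == 1%g)%:R)) => [|i _].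
  by rewrite sumr_const card_ord mulr_natr.
rewrite /= /regular_mx mxE mxE eqxx /=; congr (_%:R); congr nat_of_bool.
have iH := enum_valP i; apply/eqP/eqP => [e|->].
  have := congr1 enum_val e; rewrite gring_indexK ?groupM // => /eqP.
  by rewrite -{1}[enum_val i]mulg1 (inj_eq (mulgI _)) => /eqP ->.
by rewrite mulg1 gring_valK.
Qed.

(** Trace of the regular representation, computed directly and from its decomposition, in which each
    irreducible occurs as often as its dimension. *)
Lemma sum_irr_characters (I : irr_reps k H) x : x \in H ->
  \sum_(s : irr_idx I) (irr_dim s)%:R * \tr (irr_rep s x) = (x == 1%g)%:R * #|H|%:R.
Proof.
move=> xH; have sG : irrType k H := DecSocleType (regular_repr k H).
rewrite -regular_trace // (mxtrace_regular_pchar sG) //; last first.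
  exact: group_closure_closed_field.
(* The two lists of irreducibles, the given one and the socle components of the regular
   representation, are matched by isomorphism class. *)
pose f (s : irr_idx I) : sG := irr_comp sG (irr_rep s).
have fsim s : mx_rsim (irr_rep s) (irr_repr (f s)).
  exact: rsim_irr_comp_pchar (irr_repP s).
rewrite [RHS](reindex f) /=.
  apply: eq_bigr => s _; rewrite (mxtrace_rsim (fsim s)) // mulr_natl.
  congr (_ *+ _); exact: mxrank_rsim (fsim s).
have fsurj W : exists s, f s == W.
  have [s Ws] := irr_rep_all I (socle_irr W); exists s; apply/eqP.
  rewrite -[RHS]irr_reprK_pchar //; apply/esym.
  exact: irr_comp_rsim_pchar.
exists (fun W => xchoose (fsurj W)) => [s _|W _]; last exact/eqP/(xchooseP (fsurj W)).
apply: (irr_rep_inj (i := I)); apply: mx_rsim_trans (fsim _) _.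
by rewrite (eqP (xchooseP (fsurj (f s)))); exact/mx_rsim_sym/fsim.
Qed.
End Orthogonality.

(** * Dual bases *)

Section DualBases.
Variable k : closedFieldType.

Section Functionals.
Variables (U : vectType k) (n : nat) (X : n.-tuple 'Hom(U, k^o)).
Hypothesis Xb : basis_of fullv X.

(** The basis of [U] to which the basis [X] of the dual space is dual: the coordinate functionals of
    [vbasis] are expanded in [X], and the coefficients are transposed. *)
Definition predual (l : 'I_n) : U :=
  \sum_j coord X l (linfun (coord (vbasis {:U}) j : U -> k^o)) *: tnth (vbasis {:U}) j.

Lemma predual_sum u : u = \sum_l tnth X l u *: predual l.
Proof.
rewrite {1}(coord_vbasis (memvf u)) /predual.
under [RHS]eq_bigr do rewrite scaler_sumr.
rewrite exchange_big; apply: eq_bigr => j _ /=.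
under eq_bigr do rewrite scalerA.
rewrite -scaler_suml; congr (_ *: _); last by rewrite (tnth_nth 0).
rewrite -[LHS](lfunE (coord (vbasis {:U}) j : {linear U -> k^o})).
rewrite {1}(coord_basis Xb (memvf (linfun (coord (vbasis {:U}) j : U -> k^o)))).
rewrite sum_lfunE; apply: eq_bigr => l _.
by rewrite scale_lfunE (tnth_nth 0) [LHS]mulrC.
Qed.

Lemma predualE m l : tnth X m (predual l) = (m == l)%:R.
Proof.
rewrite /predual linear_sum /=.
under eq_bigr do rewrite linearZ /=.
have -> : \sum_j coord X l (linfun (coord (vbasis {:U}) j : U -> k^o))
    *: tnth X m (tnth (vbasis {:U}) j) =
  coord X l (\sum_j tnth X m (tnth (vbasis {:U}) j)
    *: linfun (coord (vbasis {:U}) j : U -> k^o)).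
  rewrite linear_sum; apply: eq_bigr => j _; by rewrite linearZ [LHS]mulrC.
have -> : \sum_j tnth X m (tnth (vbasis {:U}) j) *: linfun (coord (vbasis {:U}) j : U -> k^o)
    = X`_m.
  apply/lfunP => u; rewrite sum_lfunE [in RHS](coord_vbasis (memvf u)) linear_sum.
  apply: eq_bigr => j _; rewrite scale_lfunE lfunE /= linearZ /= !(tnth_nth 0).
  exact: mulrC.
by rewrite coord_free ?(basis_free Xb).
Qed.

Lemma coord_functional phi m : coord X m phi = phi (predual m).
Proof.
have -> : phi = \sum_l phi (predual l) *: X`_l.
  apply/lfunP => u; rewrite sum_lfunE {1}[u]predual_sum linear_sum.
  apply: eq_bigr => l _; rewrite scale_lfunE linearZ /= !(tnth_nth 0).
  exact: mulrC.
rewrite coord_sum_free ?(basis_free Xb) // sum_lfunE (bigD1 m) //= big1 => [|l nl].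
  rewrite addr0 scale_lfunE -tnth_nth predualE eqxx; exact/esym/mulr1.
by rewrite scale_lfunE -tnth_nth predualE (negbTE nl); exact: mulr0.
Qed.

End Functionals.

Section Casimir.
Variables (U W : vectType k) (B : U -> W -> k) (P : finType) (e : P -> U) (e' : P -> W).
Hypothesis BDl : forall c u u' w, B (c *: u + u') w = c * B u w + B u' w.
Hypothesis BDr : forall c u w w', B u (c *: w + w') = c * B u w + B u w'.
Hypothesis eE : forall u, u = \sum_p B u (e' p) *: e p.
Hypothesis e'E : forall w, w = \sum_p B (e p) w *: e' p.

Let Bu0 u : B u 0 = 0.
Proof. by have := BDr (-1) u 0 0; rewrite scaler0 addr0 mulN1r addNr. Qed.
Let B0w w : B 0 w = 0.
Proof. by have := BDl (-1) 0 0 w; rewrite scaler0 addr0 mulN1r addNr. Qed.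
Let B_sumr (I : finType) u (c : I -> k) (w : I -> W) :
  B u (\sum_i c i *: w i) = \sum_i c i * B u (w i).
Proof. by elim/big_rec2: _ => [|i x y _ <-]; rewrite ?BDr. Qed.
Let B_suml (I : finType) w (c : I -> k) (u : I -> U) :
  B (\sum_i c i *: u i) w = \sum_i c i * B (u i) w.
Proof. by elim/big_rec2: _ => [|i x y _ <-]; rewrite ?BDl. Qed.

(** [dual_vec] is picked by [xget], so its value is found by existence and uniqueness: [e'E] forces
    the expansion, and [eE] shows that it works. The families [e] and [e'] reproduce all vectors but
    may contain zeros; below they are the images in one block of a basis of the whole space. *)
Lemma dual_vecE n (X : n.-tuple U) l : basis_of fullv X ->
  dual_vec B X l = \sum_p coord X l (e p) *: e' p.
Proof.
move=> Xb; set w0 := \sum_p _.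
have Ew w : (forall m, B (tnth X m) w = (m == l)%:R) -> w = w0.
  move=> Bw; rewrite [LHS]e'E; apply: eq_bigr => p _; congr (_ *: _).
  rewrite {1}(coord_basis Xb (memvf (e p))) B_suml (bigD1 l) //= big1 => [|m nm].
    by rewrite -tnth_nth Bw eqxx mulr1 addr0.
  by rewrite -tnth_nth Bw (negbTE nm) mulr0.
apply: Ew; apply: (@xgetPex _ 0 [set w | forall m, B (tnth X m) w = (m == l)%:R]%classic).
exists w0 => m; rewrite /w0 B_sumr.
have -> : \sum_p coord X l (e p) * B (tnth X m) (e' p) =
    coord X l (\sum_p B (tnth X m) (e' p) *: e p).
  by rewrite linear_sum; apply: eq_bigr => p _; rewrite linearZ mulrC.
by rewrite -eE (tnth_nth 0) coord_free ?(basis_free Xb).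
Qed.

(** The Casimir element does not depend on the basis: expanding the dual vectors and then collecting
    the coordinates of [e p] removes [X]. *)
Lemma casimir_sum n (X : n.-tuple U) (beta : W -> U -> k) : basis_of fullv X ->
  (forall u, linear (beta^~ u : W -> k^o)) -> (forall w, linear (beta w : U -> k^o)) ->
  \sum_l beta (dual_vec B X l) (tnth X l) = \sum_p beta (e' p) (e p).
Proof.
move=> Xb bl br.
have bl_sum u (c : P -> k) (w : P -> W) :
    beta (\sum_i c i *: w i) u = \sum_i c i * beta (w i) u.
  have b0 : beta 0 u = 0 by have := bl u (-1) 0 0; rewrite scaler0 addr0 scaleN1r addNr.
  by elim/big_rec2: _ => [//|i x y _ <-]; rewrite [LHS]bl.
have br_sum w (c : 'I_n -> k) (u : 'I_n -> U) :
    beta w (\sum_i c i *: u i) = \sum_i c i * beta w (u i).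
  have b0 : beta w 0 = 0 by have := br w (-1) 0 0; rewrite scaler0 addr0 scaleN1r addNr.
  by elim/big_rec2: _ => [//|i x y _ <-]; rewrite [LHS]br.
under eq_bigr do rewrite dual_vecE // bl_sum.
rewrite exchange_big; apply: eq_bigr => p _ /=.
rewrite {2}(coord_basis Xb (memvf (e p))) br_sum.
by apply: eq_bigr => l _; rewrite (tnth_nth 0).
Qed.

End Casimir.
End DualBases.

(** * The bimodule spanned by the arrows *)

Section ArrowBimodule.
Variables (k : closedFieldType) (gT : finGroupType) (Q : quiver).
Variable act : quiver_action gT Q.
Local Notation V := (skew_arrows k gT Q).
Local Notation P := (gT * arrow (dquiver Q))%type.
Implicit Types (v w : V) (p q : P) (g h : gT) (i j : Q).

Definition arrow_rev (b : arrow (dquiver Q)) : arrow (dquiver Q) :=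
  match b with inl a => inr a | inr a => inl a end.
Definition arrow_sign (b : arrow (dquiver Q)) : k :=
  match b with inl _ => 1 | inr _ => -1 end.

(* The pair [(g, b)] stands for the product [g b] in the skew group algebra. *)
Definition skew_basis p : V := [ffun g => if g == p.1 then dvec k p.2 else 0].
Definition skew_coef p v : k^o := v p.1 p.2.
(** In the skew group algebra the dual of [g b] is [b' g^-1], with [b'] the reversed arrow; moving
    [g^-1] to the front gives [g^-1 g(b')]. *)
Definition skew_dual p : P := (p.1^-1, double_aact act p.1 (arrow_rev p.2))%g.
Definition in_block i j p := (qtail p.2 == i) && (act p.1 (qhead p.2) == j).
(** This is the projection [v |-> e_j v e_i]; see [skew_eval_block]. *)
Definition block i j v : V := [ffun g => [ffun b => if in_block i j (g, b) then v g b else 0]].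

Lemma in_blockE i j g b : in_block i j (g, b) = (qtail b == i) && (act g (qhead b) == j).
Proof. by []. Qed.

Lemma skew_coefP v w : (forall p, skew_coef p v = skew_coef p w) -> v = w.
Proof. by move=> e; apply/ffunP => g; apply/ffunP => b; apply: (e (g, b)). Qed.

Fact skew_coef_is_linear p : linear (skew_coef p).
Proof. by move=> c v w; rewrite /skew_coef !ffunE. Qed.
HB.instance Definition _ p :=
  GRing.isLinear.Build k V k^o *:%R (skew_coef p) (skew_coef_is_linear p).

Lemma skew_coef_sum (I : finType) (c : I -> k) (u : I -> V) p :
  skew_coef p (\sum_i c i *: u i) = \sum_i c i * skew_coef p (u i).
Proof.
by rewrite linear_sum; apply: eq_bigr => i _; rewrite linearZ.
Qed.

Lemma skew_coef_basis p q : skew_coef q (skew_basis p) = (q == p)%:R.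
Proof.
rewrite /skew_coef ffunE; case: p q => [g b] [h c] /=.
by rewrite -[_ == (g, b)]/((h == g) && (c == b)); case: eqP => _; rewrite ffunE.
Qed.

Lemma skew_basis_sum v : v = \sum_p skew_coef p v *: skew_basis p.
Proof.
apply: skew_coefP => q; rewrite skew_coef_sum (bigD1 q) //= big1 => [|p np].
  by rewrite skew_coef_basis eqxx mulr1 addr0.
by rewrite skew_coef_basis eq_sym (negbTE np) mulr0.
Qed.

Lemma skew_coef_block i j v p :
  skew_coef p (block i j v) = if in_block i j p then skew_coef p v else 0.
Proof. by rewrite /skew_coef !ffunE -surjective_pairing. Qed.

Fact block_is_linear i j : linear (block i j).
Proof.
move=> c v w; apply: skew_coefP => p.
rewrite [RHS]skew_coef_is_linear !skew_coef_block [skew_coef p (c *: v + w)]skew_coef_is_linear.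
by case: ifP => _ //; rewrite scaler0 addr0.
Qed.
HB.instance Definition _ i j := GRing.isLinear.Build k V V *:%R (block i j) (block_is_linear i j).

Lemma block_basis i j p : block i j (skew_basis p) = if in_block i j p then skew_basis p else 0.
Proof.
apply: skew_coefP => q; rewrite skew_coef_block skew_coef_basis.
case: (eqVneq q p) => [->|nqp].
  case: ifP => _; first by rewrite skew_coef_basis eqxx.
  by rewrite /skew_coef !ffunE.
case: ifP => _; case: ifP => _; rewrite ?skew_coef_basis ?(negbTE nqp) //;
  by rewrite /skew_coef !ffunE.
Qed.

Lemma block_id i j v : block i j (block i j v) = block i j v.
Proof. by apply: skew_coefP => p; rewrite !skew_coef_block; case: (in_block i j p). Qed.

Lemma sarr_lmul_coef h v p : skew_coef p (sarr_lmul h v) = skew_coef (h^-1 * p.1, p.2)%g v.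
Proof. by rewrite /skew_coef ffunE. Qed.

Lemma sarr_rmul_coef h v p :
  skew_coef p (sarr_rmul act h v) = skew_coef (p.1 * h^-1, double_aact act h p.2)%g v.
Proof. by rewrite /skew_coef !ffunE invgK. Qed.

Lemma sarr_lmul_basis h p : sarr_lmul h (skew_basis p) = skew_basis (h * p.1, p.2)%g.
Proof.
apply: skew_coefP => q; rewrite sarr_lmul_coef !skew_coef_basis.
case: p q => [g b] [g' b'] /=; congr (_%:R); rewrite !xpair_eqE.
by rewrite -(inj_eq (mulgI h)) mulKVg.
Qed.

Lemma sarr_rmul_basis h p : sarr_rmul act h (skew_basis p)
  = skew_basis (p.1 * h, double_aact act h^-1 p.2)%g.
Proof.
apply: skew_coefP => q; rewrite sarr_rmul_coef !skew_coef_basis.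
case: p q => [g b] [g' b'] /=; congr (_%:R); rewrite !xpair_eqE.
rewrite -(inj_eq (mulIg h)) mulgKV; congr (_ && _).
apply/eqP/eqP => [<-|->]; by rewrite -double_aactM ?mulVg ?mulgV double_aact1.
Qed.

Lemma block_lmul i j h v : block i (act h j) (sarr_lmul h v) = sarr_lmul h (block i j v).
Proof.
apply: skew_coefP => p; rewrite sarr_lmul_coef !skew_coef_block sarr_lmul_coef.
congr (if _ then _ else _); rewrite /in_block /=; congr (_ && _).
by rewrite -[in RHS](inj_eq (@vact_inj _ _ act h)) -[in RHS]vactM mulKVg.
Qed.

Lemma block_rmul i j h v :
  block (act h^-1%g i) j (sarr_rmul act h v) = sarr_rmul act h (block i j v).
Proof.
apply: skew_coefP => -[g b]; rewrite sarr_rmul_coef !skew_coef_block sarr_rmul_coef.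
congr (if _ then _ else _); rewrite !in_blockE double_tail double_head -vactM mulgKV.
congr (_ && _).
by rewrite -[LHS](inj_eq (@vact_inj _ _ act h)) -(vactM _ h h^-1%g) mulgV vact1.
Qed.

Lemma sarr_lmulM h h' v : sarr_lmul (h * h')%g v = sarr_lmul h (sarr_lmul h' v).
Proof. by apply: skew_coefP => p; rewrite !sarr_lmul_coef /= invMg mulgA. Qed.
Lemma sarr_rmulM h h' v : sarr_rmul act (h * h')%g v = sarr_rmul act h' (sarr_rmul act h v).
Proof.
by apply: skew_coefP => p; rewrite !sarr_rmul_coef /= invMg mulgA double_aactM.
Qed.
Lemma sarr_lrmul h g v : sarr_lmul h (sarr_rmul act g v) = sarr_rmul act g (sarr_lmul h v).
Proof.
by apply: skew_coefP => p; rewrite !(sarr_rmul_coef, sarr_lmul_coef) /= mulgA.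
Qed.
Lemma sarr_lmul1 v : sarr_lmul 1%g v = v.
Proof.
by apply: skew_coefP => -[g b]; rewrite sarr_lmul_coef invg1 mul1g.
Qed.
Lemma sarr_rmul1 v : sarr_rmul act 1%g v = v.
Proof.
by apply: skew_coefP => -[g b]; rewrite sarr_rmul_coef invg1 mulg1 double_aact1.
Qed.

Lemma arrow_revK : involutive arrow_rev. Proof. by case. Qed.
Lemma double_aact_rev g b :
  double_aact act g (arrow_rev b) = arrow_rev (double_aact act g b).
Proof. by case: b. Qed.

Lemma skew_dualK : involutive skew_dual.
Proof.
case=> g b; rewrite /skew_dual /= invgK; congr (_, _).
by rewrite !double_aact_rev arrow_revK -double_aactM mulVg double_aact1.
Qed.

Lemma in_block_dual i j p : in_block j i (skew_dual p) = in_block i j p.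
Proof.
case: p => g b; rewrite !in_blockE double_tail double_head -vactM mulVg vact1.
by case: b => a /=; rewrite andbC.
Qed.

Lemma darr_pairE a b : darr_pair a b = \sum_c a c * b (arrow_rev c) :> k.
Proof. by rewrite /darr_pair big_split /= big_sumType. Qed.

Lemma sarr_pair_coef v w : sarr_pair act v w = \sum_p skew_coef p v * skew_coef (skew_dual p) w.
Proof.
rewrite -(pair_bigA _ (fun g b => skew_coef (g, b) v * skew_coef (skew_dual (g, b)) w)).
apply: eq_bigr => g _; rewrite darr_pairE.
rewrite (reindex_inj (@aact_inj _ _ (double_action act) g)) /=.
apply: eq_bigr => b _; rewrite darr_actE; congr (_ * _).
by rewrite /skew_coef /= double_aact_rev.
Qed.

Lemma skew_dual_inj : injective skew_dual.
Proof. exact: can_inj skew_dualK. Qed.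

Lemma sarr_pair_basisr v p : sarr_pair act v (skew_basis (skew_dual p)) = skew_coef p v.
Proof.
rewrite sarr_pair_coef (bigD1 p) //= big1 => [|q nq].
  by rewrite skew_coef_basis eqxx mulr1 addr0.
by rewrite skew_coef_basis (inj_eq skew_dual_inj) (negbTE nq) mulr0.
Qed.

Lemma sarr_pair_basisl p w : sarr_pair act (skew_basis p) w = skew_coef (skew_dual p) w.
Proof.
rewrite sarr_pair_coef (bigD1 p) //= big1 => [|q nq].
  by rewrite skew_coef_basis eqxx mul1r addr0.
by rewrite skew_coef_basis (negbTE nq) mul0r.
Qed.

(** With [sarr_pair_rmul], this says that group elements move cyclically across the pairing. *)
Lemma sarr_pair_lmul h v w :
  sarr_pair act v (sarr_lmul h w) = sarr_pair act (sarr_rmul act h v) w.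
Proof.
rewrite /sarr_pair [RHS](reindex_inj (mulIg h)) /=; apply: eq_bigr => g _.
by rewrite !ffunE invMg mulgK -darr_act_comp mulgK.
Qed.

Lemma sarr_pair_rmul h v w :
  sarr_pair act v (sarr_rmul act h w) = sarr_pair act (sarr_lmul h v) w.
Proof.
rewrite /sarr_pair [RHS](reindex_inj (mulgI h)) /=; apply: eq_bigr => g _.
rewrite !ffunE invMg mulKg -(darr_pair_act act h) -!darr_act_comp mulgV.
by rewrite darr_act_id.
Qed.

Lemma sarr_pairDl c u v w :
  sarr_pair act (c *: u + v) w = c * sarr_pair act u w + sarr_pair act v w.
Proof.
rewrite !sarr_pair_coef mulr_sumr -big_split; apply: eq_bigr => p _.
by rewrite linearP mulrDl /= mulrA.
Qed.

Lemma sarr_pairDr c u v w :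
  sarr_pair act u (c *: v + w) = c * sarr_pair act u v + sarr_pair act u w.
Proof.
rewrite !sarr_pair_coef mulr_sumr -big_split; apply: eq_bigr => p _.
by rewrite linearP mulrDr /= mulrCA.
Qed.

Section AtildeBlock.
Variable C : orbit_choices act.
Variables i j : Q.
Hypotheses (iR : i \in reps C) (jR : j \in reps C).

Let orb1 l : l \in qorbit act l.
Proof. by apply/imsetP; exists 1%g; rewrite ?vact1. Qed.

Let kappaV i0 l : i0 \in reps C -> l \in qorbit act i0 -> act (kappa C l)^-1%g l = i0.
Proof.
move=> i0R lO; apply: (@vact_inj _ _ act (kappa C l)).
by rewrite -vactM mulgV vact1 kappaP.
Qed.

Lemma sarr_mul_coef x y a p :
  skew_coef p (sarr_mul act x y a) =
  if p.1 == (x * y)%g then (a (double_aact act y p.2) : k) else 0.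
Proof.
rewrite /skew_coef sarr_mulE; case: ifP => _; last by rewrite ffunE.
by rewrite ffunE invgK.
Qed.

(** One half of the equality of the bimodule with [e_j V e_i]; [block_Atilde] is the other. Together
    they eliminate the chosen pairs and [kappa] from all later computations. *)
Lemma Atilde_block v : v \in Atilde k C i j -> block i j v = v.
Proof.
pose f : {linear V -> V} := block i j.
suff /subvP H : (Atilde k C i j <= lker (linfun (block i j) - \1)%VF)%VS.
  by move/H; rewrite memv_ker add_lfunE opp_lfunE lfunE id_lfunE subr_eq0 => /eqP.
apply/subv_sumP => p pP; apply/subv_sumP => h /stabP hS; apply/subv_sumP => g /stabP gS.
apply/subvP => _ /memv_imgP[a aA ->]; rewrite lfunE memv_ker.
rewrite add_lfunE opp_lfunE lfunE id_lfunE subr_eq0; apply/eqP/skew_coefP => q.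
rewrite skew_coef_block; case: ifPn => // nq; rewrite sarr_mul_coef; case: eqP => // qE.
apply/esym/eqP; apply: contraNT nq => /(AbarP aA)[].
have [p1 p2] := pairs_orb iR jR pP.
rewrite double_tail double_head => t1 t2; apply/andP; split.
  rewrite -(inj_eq (@vact_inj _ _ act (kappa C p.1 * g)%g)) t1.
  by rewrite vactM gS (kappaP iR p1).
by rewrite qE vactM t2 vactM (kappaV jR p2) hS.
Qed.

(** It suffices to treat the basis elements [g b] of the block. Some [t] moves the pair formed by
    the tail and the head of [b] to the representative [p] of its orbit. *)
Lemma block_Atilde v : block i j v \in Atilde k C i j.
Proof.
rewrite [v]skew_basis_sum linear_sum; apply: memv_suml => p _.
rewrite linearZ; apply: memvZ; rewrite /= block_basis; case: ifP => [|_]; last exact: mem0v.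
case: p => g b; rewrite in_blockE => /andP[/eqP bi /eqP bj].
have hj : qhead b \in qorbit act j.
  by apply/imsetP; exists g^-1%g; rewrite // -bj -vactM mulVg vact1.
have ii : qtail b \in qorbit act i by rewrite bi.
have [p [[pP [t pE]] _]] := pairsP iR jR ii hj.
have [p1 p2] := pairs_orb iR jR pP.
have e1 : act t (qtail b) = p.1 by rewrite pE.
have e2 : act t (qhead b) = p.2 by rewrite pE.
(* This is [g b = (g t^-1) t(b) t], with [kappa] inserted so that the outer factors lie in the
   stabilizers of [j] and [i]. *)
have -> : skew_basis (g, b) = sarr_mul act ((g * t^-1 * kappa C p.2) * (kappa C p.2)^-1)%g
    (kappa C p.1 * ((kappa C p.1)^-1 * t))%g (dvec k (double_aact act t b)).
  apply: skew_coefP => -[h c]; rewrite skew_coef_basis sarr_mul_coef /= mulKVg mulgK mulgKV.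
  rewrite xpair_eqE; case: eqP => //= _; rewrite ffunE.
  by rewrite (inj_eq (@aact_inj _ _ (double_action act) t)).
apply: sarr_mul_Atilde => //.
- apply/stabP; by rewrite !vactM (kappaP jR p2) -e2 -(vactM _ t^-1%g) mulVg vact1.
- apply/stabP; by rewrite vactM -{1}bi e1 (kappaV iR p1).
- by rewrite -e1 -e2 -double_tail -double_head; exact: dvec_Abar.
Qed.

End AtildeBlock.

End ArrowBimodule.

(** * The spaces of arrows of the quiver of orbits *)

Lemma vsvalZ (k : closedFieldType) (W : vectType k) (U : {vspace W}) c (u : subvs_of U) :
  vsval (c *: u) = c *: vsval u.
Proof. by rewrite linearZ. Qed.

Lemma skew_coefZ (k : closedFieldType) (gT : finGroupType) (Q : quiver) p c
  (v : skew_arrows k gT Q) : skew_coef p (c *: v) = c * skew_coef p v.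
Proof. by rewrite linearZ. Qed.

Section OrbitArrows.
Variables (k : closedFieldType) (gT : finGroupType) (Q : quiver).
Variables (act : quiver_action gT Q) (C : orbit_choices act).
Variable irr : forall i : {i : Q | i \in reps C}, irr_reps k (qstab act (val i)).
Hypothesis kG : ([pchar k]^'.-group [set: gT])%g.
Local Notation V := (skew_arrows k gT Q).
Local Notation P := (gT * arrow (dquiver Q))%type.
Local Notation IG := (IG irr).
Local Notation G x := (qstab act (IGv x)).
Implicit Types (x y : IG) (v w : V) (p q : P).

Lemma stab_pgroup x : ([pchar k]^'.-group (G x))%g.
Proof. exact: pgroupS (finset.subsetT _) kG. Qed.

Lemma IGv_reps x : IGv x \in reps C.
Proof. exact: (valP (tag x)). Qed.

Lemma IGrep_irr x : mx_irreducible (IGrep x).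
Proof. exact: irr_repP. Qed.

Lemma IGdim_gt0 x : (0 < IGdim x)%N.
Proof. by have /mx_irrP[] := IGrep_irr x. Qed.

Definition IGzero x : 'I_(IGdim x) := Ordinal (IGdim_gt0 x).

Lemma IGdim_neq0 x : (IGdim x)%:R != 0 :> k.
Proof. exact: irr_dim_neq0 (stab_pgroup x) _ _ (IGrep_irr x). Qed.

Lemma stab_neq0 x : #|G x|%:R != 0 :> k.
Proof. exact: card_group_neq0 (stab_pgroup x). Qed.

Definition toAt i j v : At k C i j := vsproj (Atilde k C i j) (block act i j v).

Fact toAt_is_linear i j : linear (toAt i j).
Proof. by move=> c v w; rewrite /toAt !linearP. Qed.
HB.instance Definition _ i j :=
  GRing.isLinear.Build k V (At k C i j) *:%R (toAt i j) (toAt_is_linear i j).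

Lemma val_toAt x y v : vsval (toAt (IGv x) (IGv y) v) = block act (IGv x) (IGv y) v.
Proof. by rewrite vsprojK // block_Atilde ?IGv_reps. Qed.

Lemma block_val x y (a : At k C (IGv x) (IGv y)) :
  block act (IGv x) (IGv y) (vsval a) = vsval a.
Proof. by apply: Atilde_block (IGv_reps x) (IGv_reps y) _ _; apply: subvsP. Qed.

Lemma toAtK x y (a : At k C (IGv x) (IGv y)) : toAt (IGv x) (IGv y) (vsval a) = a.
Proof. by apply: subvs_inj; rewrite val_toAt block_val. Qed.

Lemma block_lmul_stab x y h v : h \in G y ->
  block act (IGv x) (IGv y) (sarr_lmul h v) = sarr_lmul h (block act (IGv x) (IGv y) v).
Proof. by move=> /stabP hy; rewrite -block_lmul hy. Qed.

Lemma block_rmul_stab x y h v : h \in G x ->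
  block act (IGv x) (IGv y) (sarr_rmul act h v) = sarr_rmul act h (block act (IGv x) (IGv y) v).
Proof.
move=> hx; have /stabP hx' : (h^-1 \in G x)%g by rewrite groupV.
by rewrite -block_rmul hx'.
Qed.

Section HGval.
Variables x y : IG.

(** A homomorphism on one block is extended by zero to all of [V], so that every block is computed
    in the same basis [skew_basis]. *)
Definition HGval (f : HG x y) v : 'M[k]_(IGdim y, IGdim x) :=
  vsval f (toAt (IGv x) (IGv y) v).

Fact HGval_is_linear f : linear (HGval f).
Proof. by move=> c v w; rewrite /HGval !linearP. Qed.
HB.instance Definition _ f := GRing.isLinear.Build k V 'M[k]_(IGdim y, IGdim x) *:%R
  (HGval f) (HGval_is_linear f).

Lemma HGvalP c f g v : HGval (c *: f + g) v = c *: HGval f v + HGval g v.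
Proof. by rewrite /HGval linearP /= add_lfunE scale_lfunE. Qed.

Lemma HGval_sum (I : finType) (c : I -> k) (f : I -> HG x y) v :
  HGval (\sum_i c i *: f i) v = \sum_i c i *: HGval (f i) v.
Proof.
elim/big_rec2: _ => [|i u w _ <-]; last by rewrite HGvalP.
by rewrite /HGval linear0 zero_lfunE.
Qed.

Lemma HGval_suml (I : finType) f (c : I -> k) (u : I -> V) e a :
  HGval f (\sum_i c i *: u i) e a = \sum_i c i * HGval f (u i) e a.
Proof. by rewrite linear_sum summxE; apply: eq_bigr => i _; rewrite linearZ mxE. Qed.

Lemma HGval_lmul f h v : h \in G y ->
  HGval f (sarr_lmul h v) = IGrep y h *m HGval f v.
Proof.
move=> hS; have /HomGP[fl _] := subvsP f; rewrite -fl //; congr (vsval f _).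
by apply: subvs_inj; rewrite val_At_lmul // !val_toAt block_lmul_stab.
Qed.

Lemma HGval_rmul f h v : h \in G x ->
  HGval f (sarr_rmul act h v) = HGval f v *m IGrep x h.
Proof.
move=> hS; have /HomGP[_ fr] := subvsP f; rewrite -fr //; congr (vsval f _).
by apply: subvs_inj; rewrite val_At_rmul // !val_toAt block_rmul_stab.
Qed.

Lemma HGval_block f v : HGval f (block act (IGv x) (IGv y) v) = HGval f v.
Proof. by congr (vsval f _); rewrite /toAt block_id. Qed.

Lemma HGval_basis0 f p : ~~ in_block act (IGv x) (IGv y) p -> HGval f (skew_basis k p) = 0.
Proof. by move=> /negbTE np; rewrite -HGval_block block_basis np linear0. Qed.

Lemma HGval_inj f g : (forall p, HGval f (skew_basis k p) = HGval g (skew_basis k p)) -> f = g.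
Proof.
move=> fg; apply/val_inj/lfunP => a; rewrite -(toAtK a) -/(HGval f _) -/(HGval g _).
by rewrite [vsval a]skew_basis_sum !linear_sum; apply: eq_bigr => p _; rewrite !linearZ /= fg.
Qed.

Section Make.
Variable phi : {linear V -> 'M[k]_(IGdim y, IGdim x)}.
Hypothesis phil : forall h v, h \in G y -> phi (sarr_lmul h v) = IGrep y h *m phi v.
Hypothesis phir : forall h v, h \in G x -> phi (sarr_rmul act h v) = phi v *m IGrep x h.

Definition mkHG : HG x y :=
  vsproj (HomG C (IGrep x) (IGrep y)) (linfun (phi \o vsval)).

Lemma mkHGE v : HGval mkHG v = phi (block act (IGv x) (IGv y) v).
Proof.
rewrite /HGval vsprojK ?lfunE /= ?val_toAt //; apply/HomGP; split=> [h a hS|h a hS].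
  by rewrite !lfunE /= val_At_lmul // phil.
by rewrite !lfunE /= val_At_rmul // phir.
Qed.
End Make.

Lemma HGval_eps f p :
  HGval (HG_eps f) (skew_basis k p) = - ((#|G x| * #|G y|)%:R^-1 * arrow_sign k p.2)
    *: HGval f (skew_basis k p).
Proof.
rewrite /HGval val_HG_eps opp_lfunE comp_lfunE lfunE /=.
have -> : At_eps (toAt (IGv x) (IGv y) (skew_basis k p)) =
    ((#|G x| * #|G y|)%:R^-1 * arrow_sign k p.2) *: toAt (IGv x) (IGv y) (skew_basis k p).
  apply: subvs_inj; rewrite val_At_eps vsvalZ !val_toAt -scalerA /sarr_eps; congr (_ *: _).
  apply: skew_coefP => q; rewrite skew_coefZ.
  have -> (w : V) : skew_coef q [ffun g => darr_eps (w g)] = arrow_sign k q.2 * skew_coef q w.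
    rewrite /skew_coef !ffunE; case: q.2 => a; rewrite ?mul1r ?mulN1r //.
  rewrite skew_coef_block skew_coef_basis.
  by have [->//|_] := eqVneq q p; case: ifP; rewrite !mulr0 ?scaler0.
by rewrite linearZ scaleNr.
Qed.

(* With the matrix units [E_ab] of [proj_scale], this is [v |-> E_0c v E_a0]. *)
Definition proj_scale : k :=
  (IGdim x)%:R * (IGdim y)%:R / (#|G x|%:R * #|G y|%:R).

Definition corner (c : 'I_(IGdim y)) (a : 'I_(IGdim x)) v : V :=
  proj_scale *: \sum_(h in G y) \sum_(g in G x)
    (IGrep y h^-1%g c (IGzero y) * IGrep x g^-1%g (IGzero x) a)
    *: sarr_lmul h (sarr_rmul act g (block act (IGv x) (IGv y) v)).

Fact corner_is_linear c a : linear (corner c a).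
Proof.
move=> z v w; rewrite /corner scalerA [z * _]mulrC -[(proj_scale * z) *: _]scalerA -scalerDr; congr (_ *: _).
rewrite scaler_sumr -big_split; apply: eq_bigr => h _.
rewrite scaler_sumr -big_split; apply: eq_bigr => g _ /=.
by rewrite !linearP.
Qed.
HB.instance Definition _ c a :=
  GRing.isLinear.Build k V V *:%R (corner c a) (corner_is_linear c a).

Lemma corner_lmul c a h v : h \in G y ->
  corner c a (sarr_lmul h v) = \sum_e IGrep y h c e *: corner e a v.
Proof.
move=> hS; rewrite /corner.
under [RHS]eq_bigr do rewrite scalerA [_ * proj_scale]mulrC -[(proj_scale * _) *: _]scalerA.
rewrite -scaler_sumr; congr (_ *: _).
under [RHS]eq_bigr do rewrite scaler_sumr.
rewrite [RHS]exchange_big [LHS](reindex_inj (mulIg h^-1%g)).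
apply: eq_big => [u|u]; first by rewrite groupMr ?groupV.
rewrite groupMr ?groupV // => uS.
under [RHS]eq_bigr do rewrite scaler_sumr.
rewrite [RHS]exchange_big; apply: eq_bigr => g gS.
rewrite block_lmul_stab // -sarr_lrmul -sarr_lmulM mulgKV.
under [RHS]eq_bigr do rewrite scalerA mulrA.
rewrite -scaler_suml; congr (_ *: _); rewrite -mulr_suml; congr (_ * _).
rewrite invMg invgK repr_mxM ?groupV // mxE.
by apply: eq_bigr => e _.
Qed.

Lemma corner_rmul c a h v : h \in G x ->
  corner c a (sarr_rmul act h v) = \sum_e IGrep x h e a *: corner c e v.
Proof.
move=> hS; rewrite /corner.
under [RHS]eq_bigr do rewrite scalerA [_ * proj_scale]mulrC -[(proj_scale * _) *: _]scalerA.
rewrite -scaler_sumr; congr (_ *: _).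
under [RHS]eq_bigr do rewrite scaler_sumr.
rewrite [RHS]exchange_big; apply: eq_bigr => u uS.
under [RHS]eq_bigr do rewrite scaler_sumr.
rewrite [RHS]exchange_big [LHS](reindex_inj (mulgI h^-1%g)).
apply: eq_big => [g|g]; first by rewrite groupMl ?groupV.
rewrite groupMl ?groupV // => gS.
rewrite block_rmul_stab // -sarr_rmulM mulKVg.
under [RHS]eq_bigr do rewrite scalerA mulrCA.
rewrite -scaler_suml; congr (_ *: _); rewrite -mulr_sumr; congr (_ * _).
rewrite invMg invgK repr_mxM ?groupV // mxE.
by apply: eq_bigr => e _; rewrite mulrC.
Qed.

Lemma corner_block c a v : corner c a (block act (IGv x) (IGv y) v) = corner c a v.
Proof. by rewrite /corner block_id. Qed.

(** Equivariance pulls both group sums out of [f] as sums of products of matrix coefficients; Schur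
    orthogonality leaves a single term, which [proj_scale] normalises to 1. *)
Lemma HGval_corner f c a v c' a' :
  HGval f (corner c a v) c' a'
  = ((c' == IGzero y) && (a' == IGzero x))%:R * HGval f v c a.
Proof.
rewrite /corner linearZ linear_sum /= mxE summxE.
pose M := HGval f v.
have -> : \sum_(h in G y) (HGval f (\sum_(g in G x)
      (IGrep y h^-1%g c (IGzero y) * IGrep x g^-1%g (IGzero x) a)
      *: sarr_lmul h (sarr_rmul act g (block act (IGv x) (IGv y) v)))) c' a'
  = \sum_e \sum_b ((\sum_(h in G y) IGrep y h c' e * IGrep y h^-1%g c (IGzero y))
      * M e b * (\sum_(g in G x) IGrep x g b a' * IGrep x g^-1%g (IGzero x) a)).
  transitivity (\sum_(h in G y) \sum_(g in G x) \sum_e \sum_b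
     (IGrep y h c' e * IGrep y h^-1%g c (IGzero y) * M e b
      * (IGrep x g b a' * IGrep x g^-1%g (IGzero x) a))).
    apply: eq_bigr => h hS; rewrite linear_sum summxE; apply: eq_bigr => g gS.
    rewrite linearZ /= mxE HGval_lmul // HGval_rmul // HGval_block mulmxA mxE.
    rewrite mulr_sumr exchange_big; apply: eq_bigr => b _ /=.
    rewrite mxE mulr_suml mulr_sumr; apply: eq_bigr => e _.
    rewrite -/M; ring.
  under eq_bigr do (rewrite exchange_big; under eq_bigr do rewrite exchange_big).
  rewrite exchange_big; apply: eq_bigr => e _ /=.
  rewrite exchange_big; apply: eq_bigr => b _ /=.
  rewrite -mulrA mulr_suml; apply: eq_bigr => h _.
  by rewrite mulr_sumr mulr_sumr; apply: eq_bigr => g _; rewrite !mulrA.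
have oy e := orthogonality_eq (stab_pgroup y) (IGrep_irr y) c' e c (IGzero y).
have ox b := orthogonality_eq (stab_pgroup x) (IGrep_irr x) b a' (IGzero x) a.
under eq_bigr do under eq_bigr do rewrite oy ox.
rewrite (bigD1 c) //= [X in _ + X]big1 ?addr0 => [|e ne]; last first.
  by apply: big1 => b _; rewrite (negbTE ne) andbF !mul0r.
rewrite (bigD1 a) //= [X in _ + X]big1 ?addr0 => [|b nb]; last first.
  by rewrite (negbTE nb) mul0r mulr0.
rewrite !eqxx andbT andTb -mulnb natrM /proj_scale -/M.
have nz := (stab_neq0 x, stab_neq0 y, IGdim_neq0 x, IGdim_neq0 y).
by field; rewrite !nz.
Qed.

End HGval.
End OrbitArrows.

(** * Nondegeneracy of the pairing, and the arrows of the quiver of orbits as vectors of the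
    bimodule *)

Section OrbitArrowBasis.
Variables (k : closedFieldType) (gT : finGroupType) (Q : quiver).
Variables (act : quiver_action gT Q) (C : orbit_choices act).
Variable irr : forall i : {i : Q | i \in reps C}, irr_reps k (qstab act (val i)).
Hypothesis kG : ([pchar k]^'.-group [set: gT])%g.
Local Notation V := (skew_arrows k gT Q).
Local Notation P := (gT * arrow (dquiver Q))%type.
Local Notation IG := (IG irr).
Local Notation G x := (qstab act (IGv x)).
Local Notation sb := (skew_basis k).
Local Notation D := (skew_dual act).
Implicit Types (x y : IG) (v w : V) (p q : P).

Section Pair.
Variables x y : IG.

Lemma At_pair_dual (u : At k C (IGv x) (IGv y)) p :
  At_pair u (toAt C (IGv y) (IGv x) (sb (D p))) = skew_coef p (vsval u).
Proof.
rewrite /At_pair val_toAt block_basis in_block_dual; case: ifPn => [_|np].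
  exact: sarr_pair_basisr.
rewrite -block_val skew_coef_block (negbTE np) sarr_pair_coef big1 // => q _.
by rewrite linear0 mulr0.
Qed.

Lemma At_pair_basis (w : At k C (IGv y) (IGv x)) p :
  At_pair (toAt C (IGv x) (IGv y) (sb p)) w = skew_coef (D p) (vsval w).
Proof.
rewrite /At_pair val_toAt block_basis; case: ifPn => [_|np].
  exact: sarr_pair_basisl.
rewrite -block_val skew_coef_block in_block_dual (negbTE np) sarr_pair_coef big1 // => q _.
by rewrite linear0 mul0r.
Qed.

Lemma At_sum (u : At k C (IGv x) (IGv y)) :
  u = \sum_p skew_coef p (vsval u) *: toAt C (IGv x) (IGv y) (sb p).
Proof.
rewrite -{1}(toAtK u) {1}[vsval u]skew_basis_sum linear_sum.
by apply: eq_bigr => p _; rewrite linearZ.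
Qed.

End Pair.

(** [casimir_sum] replaces the arbitrary basis in [HG_pair] by the products [g b]; those outside the
    block contribute zero. *)
Lemma HG_pairE x y (f : HG x y) (g : HG y x) :
  HG_pair f g = \sum_p \tr (HGval g (sb (D p)) *m HGval f (sb p)).
Proof.
rewrite /HG_pair.
refine (@casimir_sum k (At k C (IGv x) (IGv y)) (At k C (IGv y) (IGv x))
  (@At_pair k gT Q act C (IGv x) (IGv y)) P (fun p => toAt C (IGv x) (IGv y) (sb p))
  (fun p => toAt C (IGv y) (IGv x) (sb (D p))) _ _ _ _ _ (vbasis fullv)
  (fun b a => \tr (vsval g b *m vsval f a)) _ _ _).
- by move=> c u u' w; rewrite /At_pair linearP sarr_pairDl.
- by move=> c u w w'; rewrite /At_pair linearP sarr_pairDr.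
- by move=> u; under eq_bigr do rewrite At_pair_dual; apply: At_sum.
- move=> w; under eq_bigr do rewrite At_pair_basis.
  rewrite {1}(At_sum w) (reindex_inj (@skew_dual_inj _ _ act)).
  by apply: eq_bigr => p _.
- exact: vbasisP.
- by move=> u c w w'; rewrite linearP mulmxDl -scalemxAl mxtraceD mxtraceZ.
- by move=> w c u u'; rewrite linearP mulmxDr -scalemxAr mxtraceD mxtraceZ.
Qed.

Section Average.
Variables (x y : IG) (q : P) (a : 'I_(IGdim x)) (b : 'I_(IGdim y)).

(** The average over both stabilizers of the map sending [w] to its coefficient at [D q] times the
    elementary matrix at [(a, b)]. As an element of [HG y x] it detects one entry of [f] at [q],
    which proves nondegeneracy. *)
Definition average w : 'M[k]_(IGdim x, IGdim y) :=
  \sum_(h in G x) \sum_(u in G y) skew_coef (D q) (sarr_lmul h (sarr_rmul act u w))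
    *: (IGrep x h^-1%g *m delta_mx a b *m IGrep y u^-1%g).

Fact average_is_linear : linear average.
Proof.
move=> c v w; rewrite /average scaler_sumr -big_split; apply: eq_bigr => h _.
rewrite scaler_sumr -big_split; apply: eq_bigr => u _ /=.
by rewrite scalerA -scalerDl !linearP.
Qed.
HB.instance Definition _ :=
  GRing.isLinear.Build k V 'M[k]_(IGdim x, IGdim y) *:%R average average_is_linear.

Lemma average_lmul h w : h \in G x -> average (sarr_lmul h w) = IGrep x h *m average w.
Proof.
move=> hS; rewrite /average mulmx_sumr [LHS](reindex_inj (mulIg h^-1%g)).
apply: eq_big => [u|u]; first by rewrite groupMr ?groupV.
rewrite groupMr ?groupV // => uS; rewrite mulmx_sumr; apply: eq_bigr => g gS.
rewrite -scalemxAr -sarr_lrmul -sarr_lmulM mulgKV; congr (_ *: _).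
by rewrite invMg invgK repr_mxM ?groupV // !mulmxA.
Qed.

Lemma average_rmul h w : h \in G y ->
  average (sarr_rmul act h w) = average w *m IGrep y h.
Proof.
move=> hS; rewrite /average mulmx_suml; apply: eq_bigr => u uS.
rewrite mulmx_suml [LHS](reindex_inj (mulgI h^-1%g)).
apply: eq_big => [g|g]; first by rewrite groupMl ?groupV.
rewrite groupMl ?groupV // => gS.
rewrite -scalemxAl -sarr_rmulM mulKVg; congr (_ *: _).
by rewrite invMg invgK repr_mxM ?groupV // !mulmxA.
Qed.

(** Invariance of the pairing transfers [h] and [u] to the argument of [f], where equivariance makes
    them cancel against their inverses under the trace. Hence all [|G x| * |G y|] terms agree. *)
Lemma HG_pair_average (f : HG x y) :
  HG_pair f (mkHG average) = (#|G x| * #|G y|)%:R * HGval f (sb q) b a.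
Proof.
rewrite HG_pairE.
have -> : \sum_p \tr (HGval (mkHG average) (sb (D p)) *m HGval f (sb p)) =
    \sum_p \tr (average (sb (D p)) *m HGval f (sb p)).
  apply: eq_bigr => p _; case: (boolP (in_block act (IGv x) (IGv y) p)) => [ip|np].
    rewrite mkHGE ?block_basis ?in_block_dual ?ip //.
      exact: average_lmul.
    exact: average_rmul.
  by rewrite (HGval_basis0 _ np) !mulmx0.
transitivity (\sum_(h in G x) \sum_(u in G y)
   \tr (IGrep x h^-1%g *m delta_mx a b *m IGrep y u^-1%g *m
     HGval f (\sum_p skew_coef p (sarr_lmul u (sarr_rmul act h (sb q))) *: sb p))).
  under eq_bigr do rewrite /average mulmx_suml raddf_sum.
  rewrite exchange_big; apply: eq_bigr => h hS.
  under eq_bigr do rewrite mulmx_suml raddf_sum.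
  rewrite exchange_big; apply: eq_bigr => u uS.
  rewrite linear_sum mulmx_sumr raddf_sum; apply: eq_bigr => p _ /=.
  rewrite linearZ -scalemxAl -scalemxAr; congr (\tr (_ *: _)).
  by rewrite -sarr_pair_basisl sarr_pair_lmul sarr_pair_rmul sarr_pair_basisr.
rewrite (eq_bigr (fun=> \sum_(u in G y) HGval f (sb q) b a)) => [|h hS].
  by rewrite !sumr_const -mulrnA mulnC mulr_natl.
apply: eq_bigr => u uS; rewrite -skew_basis_sum HGval_lmul // HGval_rmul //.
rewrite !mulmxA -[_ *m IGrep y u]mulmxA -repr_mxM ?groupV // mulVg repr_mx1 mulmx1.
rewrite mxtrace_mulC !mulmxA -repr_mxM ?groupV // mulgV repr_mx1 mul1mx.
rewrite mxtrace_mulC /mxtrace (bigD1 b) //= big1 ?addr0 => [|e ne]; rewrite mxE.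
  rewrite (bigD1 a) //= big1 ?addr0 => [|e ne]; first by rewrite mxE !eqxx mulr1.
  by rewrite mxE (negbTE ne) mulr0.
by rewrite big1 // => j _; rewrite mxE (negbTE ne) andbF mulr0.
Qed.

End Average.

Section Basis.
Variables x y : IG.

Lemma AG_of_HG_inj : injective (@AG_of_HG k gT Q act C irr x y).
Proof.
move=> f f' ff'; apply: HGval_inj => q; apply/matrixP => b a.
have := congr1 (fun phi : 'Hom(HG y x, k^o) => phi (mkHG (average q a b))) ff'.
rewrite /AG_of_HG !lfunE /= !HG_pair_average => /mulfI; apply.
by rewrite natrM; apply: (mulf_neq0 (stab_neq0 kG x) (stab_neq0 kG y)).
Qed.

Lemma AG_of_HGK (f : HG x y) : HG_of_AG (AG_of_HG f) = f.
Proof.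
apply: AG_of_HG_inj.
apply: (@xgetPex _ 0 [set f' | AG_of_HG f' = AG_of_HG f]%classic); by exists f.
Qed.

Definition HG_basis (l : 'I_(\dim {: AG x y})) : HG x y := predual (AG_basis x y) l.

Let AG_basisP : basis_of fullv (AG_basis x y).
Proof. exact: vbasisP. Qed.

(** By definition of [AG_pair], the equations for the dual vector prescribe the values of all
    [AG_basis] functionals at its representative in [HG x y], which [predual_sum] then
    determines. *)
Lemma AG_dual_vec l :
  HG_of_AG (dual_vec (@AG_pair k gT Q act C irr x y) (AG_basis x y) l) = HG_basis l.
Proof.
set w := dual_vec _ _ _.
have wE m : AG_pair (tnth (AG_basis x y) m) w = (m == l)%:R.
  apply: (@xgetPex _ 0 [set w | forall m, AG_pair (tnth (AG_basis x y) m) w = (m == l)%:R]%classic).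
  exists (AG_of_HG (HG_basis l)) => m'; rewrite /AG_pair AG_of_HGK; exact: predualE.
rewrite [LHS](predual_sum AG_basisP) (bigD1 l) //= [X in _ + X]big1 => [|m nm].
  by rewrite [X in X *: _]wE eqxx scale1r addr0.
by rewrite [X in X *: _]wE (negbTE nm) scale0r.
Qed.

Lemma coord_AG_of_HG (f : HG y x) m :
  coord (AG_basis x y) m (AG_of_HG f) = HG_pair f (HG_basis m).
Proof. by rewrite (coord_functional AG_basisP) /AG_of_HG lfunE. Qed.

Definition corner_mx p v : 'M[k]_(IGdim y, IGdim x) :=
  \matrix_(c, a) skew_coef p (corner c a v).
Lemma corner_mxE p v c a : corner_mx p v c a = skew_coef p (corner c a v).
Proof. exact: mxE. Qed.
Fact corner_mx_is_linear p : linear (corner_mx p).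
Proof.
move=> z v w; apply/matrixP => c a.
rewrite corner_mxE [RHS]mxE.
rewrite [X in _ = X + _]mxE.
rewrite corner_is_linear skew_coef_is_linear.
by congr (_ * _ + _); exact/esym/corner_mxE.
Qed.
HB.instance Definition _ p :=
  GRing.isLinear.Build k V 'M[k]_(IGdim y, IGdim x) *:%R (corner_mx p) (corner_mx_is_linear p).

(** The coefficient at [p] of [E_0c v E_a0], collected over [c] and [a], depends equivariantly on
    [v]. These homomorphisms carry vectors of the corner over to functionals on [HG x y]. *)
Definition HG_coef p : HG x y := mkHG (corner_mx p).

Lemma HGval_coef p v c a : HGval (HG_coef p) v c a = skew_coef p (corner c a v).
Proof.
rewrite mkHGE ?corner_mxE ?corner_block // => h w hS; apply/matrixP => e b.
  rewrite corner_mxE [RHS]mxE.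

  by rewrite corner_lmul // skew_coef_sum; apply: eq_bigr => i _; rewrite corner_mxE.
rewrite corner_mxE [RHS]mxE corner_rmul // skew_coef_sum.
by apply: eq_bigr => i _; rewrite corner_mxE mulrC.
Qed.

(** An arrow is a functional on [HG x y]; evaluated at the homomorphisms [HG_coef p], it gives the
    coordinates of the corresponding vector of [E_y(0, 0) V E_x(0, 0)]. *)
Definition arrow_vec (l : 'I_(\dim {: AG x y})) : V :=
  \sum_p (tnth (AG_basis x y) l (HG_coef p) : k) *: sb p.

(** Expand [HG_coef q] in [HG_basis]: its coordinates are the values of the [AG_basis] functionals,
    that is, the coefficients of the arrow vectors at [q]. *)
Lemma corner_arrow_vec c a v :
  corner c a v = \sum_l HGval (HG_basis l) v c a *: arrow_vec l.
Proof.
apply: skew_coefP => q; rewrite -HGval_coef skew_coef_sum.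
rewrite [HG_coef q](predual_sum AG_basisP) HGval_sum summxE; apply: eq_bigr => l _.
rewrite mxE mulrC; congr (_ * _); rewrite skew_coef_sum (bigD1 q) //= big1 => [|p np].
  by rewrite skew_coef_basis eqxx mulr1 addr0.
by rewrite skew_coef_basis eq_sym (negbTE np) mulr0.
Qed.

Lemma HGval_arrow_vec m l c a :
  HGval (HG_basis m) (arrow_vec l) c a
  = ((m == l) && ((c == IGzero y) && (a == IGzero x)))%:R.
Proof.
rewrite /arrow_vec HGval_suml.
set d := (_ && (a == _)).
(* By [HGval_corner], recombining the values of [f] at one matrix position returns [f] for position
   [(0, 0)] and zero for all others. *)
have fE (f : HG x y) : \sum_p HGval f (sb p) c a *: HG_coef p = d%:R *: f.
  apply: HGval_inj => r; apply/matrixP => c' a'; rewrite HGval_sum summxE.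
  rewrite -[in RHS](addr0 (_ *: f)) HGvalP !mxE.
  have -> : HGval (0 : HG x y) (sb r) c' a' = 0 by rewrite /HGval linear0 zero_lfunE mxE.
  rewrite addr0 -(HGval_corner kG).
  rewrite [RHS](_ : _ = HGval f (\sum_p skew_coef p (corner c' a' (sb r)) *: sb p) c a); last first.
    by rewrite -skew_basis_sum.
  rewrite HGval_suml; apply: eq_bigr => p _; rewrite mxE HGval_coef; exact: mulrC.
transitivity (tnth (AG_basis x y) l (d%:R *: HG_basis m)).
  rewrite -fE linear_sum; apply: eq_bigr => p _.
  by rewrite linearZ; exact: mulrC.
rewrite linearZ /= /HG_basis (predualE AG_basisP) eq_sym andbC -mulnb natrM.
by [].
Qed.

End Basis.

Lemma coord_AG_eps_dual x y l m :
  coord (AG_basis y x) m (AG_eps (dual_vec (@AG_pair k gT Q act C irr x y) (AG_basis x y) l))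
  = - (#|G x| * #|G y|)%:R^-1 * \sum_p arrow_sign k p.2 *
      \tr (HGval (HG_basis m) (sb (D p)) *m HGval (HG_basis l) (sb p)).
Proof.
rewrite /AG_eps AG_dual_vec coord_AG_of_HG HG_pairE mulr_sumr.
apply: eq_bigr => p _; rewrite HGval_eps -scalemxAr mxtraceZ.
by rewrite mulNr mulNr mulrA.
Qed.

End OrbitArrowBasis.

(** * Relators of the quiver of orbits as traces of Casimir matrices, for arrows in any algebra *)

Section ArrowMatrices.
Variables (k : closedFieldType) (gT : finGroupType) (Q : quiver).
Variables (act : quiver_action gT Q) (C : orbit_choices act).
Variable irr : forall i : {i : Q | i \in reps C}, irr_reps k (qstab act (val i)).
Hypothesis kG : ([pchar k]^'.-group [set: gT])%g.
Local Notation V := (skew_arrows k gT Q).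
Local Notation P := (gT * arrow (dquiver Q))%type.
Local Notation IG := (IG irr).
Local Notation G x := (qstab act (IGv x)).
Local Notation sb := (skew_basis k).
Local Notation D := (skew_dual act).
Variables (R : pzAlgType k) (al : forall x y : IG, 'I_(\dim {: AG x y}) -> R).
Implicit Types (x y : IG) (v w : V) (p q : P).

(* The matrix of the action of [v] on the sum of the tensor products of the
   representations with the vertex spaces, where the [al x y l] act as arrows. *)
Definition arrow_mx_def x y v (c : 'I_(IGdim y)) (a : 'I_(IGdim x)) : R :=
  \sum_l (HGval (HG_basis l) v c a)%:I * al l.

Definition arrow_mx := locked arrow_mx_def.
Lemma arrow_mx_unlock : arrow_mx = arrow_mx_def.
Proof. by rewrite /arrow_mx -lock. Qed.
Arguments arrow_mx {x y}.

Lemma arrow_mx_sum x y (I : finType) (c : I -> k) (u : I -> V) e (a : 'I_(IGdim x)) :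
  @arrow_mx x y (\sum_i c i *: u i) e a = \sum_i (c i)%:I * arrow_mx (u i) e a.
Proof.
rewrite arrow_mx_unlock /arrow_mx_def; under [RHS]eq_bigr do rewrite mulr_sumr.
rewrite [RHS]exchange_big; apply: eq_bigr => l _ /=.
rewrite HGval_suml inalg_sum mulr_suml; apply: eq_bigr => i _.
by rewrite inalgM mulrA.
Qed.

Lemma arrow_mx_lmul x y h v c (a : 'I_(IGdim x)) : h \in G y ->
  arrow_mx (sarr_lmul h v) c a = \sum_e (IGrep y h c e)%:I * arrow_mx v e a.
Proof.
move=> hS; rewrite arrow_mx_unlock /arrow_mx_def; under [RHS]eq_bigr do rewrite mulr_sumr.
rewrite [RHS]exchange_big; apply: eq_bigr => l _ /=.
rewrite HGval_lmul // mxE inalg_sum mulr_suml; apply: eq_bigr => e _.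
by rewrite inalgM mulrA.
Qed.

Lemma arrow_mx_rmul x y h v (c : 'I_(IGdim y)) (a : 'I_(IGdim x)) : h \in G x ->
  arrow_mx (sarr_rmul act h v) c a = \sum_e arrow_mx v c e * (IGrep x h e a)%:I.
Proof.
move=> hS; rewrite arrow_mx_unlock /arrow_mx_def; under [RHS]eq_bigr do rewrite mulr_suml.
rewrite [RHS]exchange_big; apply: eq_bigr => l _ /=.
rewrite HGval_rmul // mxE inalg_sum mulr_suml; apply: eq_bigr => e _.
by rewrite inalgM -!mulrA -[al l * _]inalgC.
Qed.

Lemma arrow_mx_block x y v (c : 'I_(IGdim y)) (a : 'I_(IGdim x)) :
  arrow_mx (block act (IGv x) (IGv y) v) c a = arrow_mx v c a.
Proof. by rewrite arrow_mx_unlock /arrow_mx_def; apply: eq_bigr => l _; rewrite HGval_block. Qed.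

Lemma arrow_mx0 x y (c : 'I_(IGdim y)) (a : 'I_(IGdim x)) : arrow_mx 0 c a = 0.
Proof.
by rewrite arrow_mx_unlock /arrow_mx_def big1 // => l _; rewrite [HGval _ _]linear0 mxE inalg0 mul0r.
Qed.

(** The Casimir element of the bimodule, twisted by the sign of the arrows and acting between the
    representations at [x] and [x']. The case of distinct [x] and [x'] is included because the
    relations in matrices over B involve those entries as well. *)
Definition casimir_mx x x' (e : 'I_(IGdim x')) (a : 'I_(IGdim x)) : R :=
  \sum_y (- #|G y|%:R^-1)%:I * \sum_p (arrow_sign k p.2)%:I *
    \sum_c @arrow_mx y x' (sb (D p)) e c * @arrow_mx x y (sb p) c a.

(** It serves both directions, with [al] the arrows of B or the arrow vectors in A. The coordinates
    of [AG_eps] on dual vectors are traces by [coord_AG_eps_dual], and such a trace is a sum over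
    entries of both factors, absorbed by the two arrow matrices. *)
Lemma relator_sum x :
  \sum_y \sum_l (\sum_m (coord (AG_basis y x) m
      (AG_eps (dual_vec (@AG_pair k gT Q act C irr x y) (AG_basis x y) l)))%:I * al m) * al l
  = (#|G x|%:R^-1)%:I * \sum_a @casimir_mx x x a a.
Proof.
rewrite /casimir_mx mulr_sumr.
under [RHS]eq_bigr do rewrite mulr_sumr.
rewrite [RHS]exchange_big; apply: eq_bigr => y _ /=.
under [RHS]eq_bigr do rewrite mulrA -inalgM mulrN -invfM -natrM mulr_sumr.
rewrite [RHS]exchange_big /=.
pose c p l m := (- (#|G x| * #|G y|)%:R^-1 : k) * (arrow_sign k p.2 *
   \tr (HGval (@HG_basis k gT Q act C irr y x m) (sb (D p)) *m HGval (@HG_basis k gT Q act C irr x y l) (sb p))).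
transitivity (\sum_l \sum_m \sum_p (c p l m)%:I * (al m * al l)).
  apply: eq_bigr => l _; rewrite mulr_suml; apply: eq_bigr => m _.
  by rewrite (coord_AG_eps_dual kG) mulr_sumr inalg_sum mulr_suml mulr_suml;
    apply: eq_bigr => p _; rewrite -mulrA.
under [LHS]eq_bigr do rewrite exchange_big.
rewrite [LHS]exchange_big; apply: eq_bigr => p _ /=.
rewrite -mulr_sumr -mulr_sumr.
transitivity ((- (#|G x| * #|G y|)%:R^-1)%:I * ((arrow_sign k p.2)%:I *
  \sum_l \sum_m (\tr (HGval (@HG_basis k gT Q act C irr y x m) (sb (D p)) *m HGval (@HG_basis k gT Q act C irr x y l) (sb p)))%:I * (al m * al l))).
  rewrite !mulr_sumr; apply: eq_bigr => l _; rewrite !mulr_sumr; apply: eq_bigr => m _.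
  by rewrite /c !inalgM -!mulrA.
congr (_ * (_ * _)).
(* The trace is written out, so that each coefficient joins its own arrow. *)
transitivity (\sum_a \sum_c \sum_l \sum_m
   ((HGval (@HG_basis k gT Q act C irr y x m) (sb (D p)) a c)%:I * al m) * ((HGval (@HG_basis k gT Q act C irr x y l) (sb p) c a)%:I * al l)).
  under [RHS]eq_bigr do rewrite exchange_big.
  rewrite [RHS]exchange_big; apply: eq_bigr => l _ /=.
  under [RHS]eq_bigr do rewrite exchange_big.
  rewrite [RHS]exchange_big; apply: eq_bigr => m _ /=.
  rewrite /mxtrace inalg_sum mulr_suml; apply: eq_bigr => a _.
  rewrite mxE inalg_sum mulr_suml; apply: eq_bigr => e _.
  by rewrite inalgM -!mulrA; congr (_ * _); rewrite inalgCA.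
apply: eq_bigr => a _; apply: eq_bigr => e _.
rewrite exchange_big arrow_mx_unlock /arrow_mx_def mulr_suml; apply: eq_bigr => m _ /=.
by rewrite mulr_sumr.
Qed.

End ArrowMatrices.

(** * Matrix units and frames in the skew group algebra *)

Section SkewModel.
Variables (k : closedFieldType) (gT : finGroupType) (Q : quiver).
Variables (act : quiver_action gT Q) (C : orbit_choices act).
Variable irr : forall i : {i : Q | i \in reps C}, irr_reps k (qstab act (val i)).
Hypothesis kG : ([pchar k]^'.-group [set: gT])%g.
Local Notation V := (skew_arrows k gT Q).
Local Notation P := (gT * arrow (dquiver Q))%type.
Local Notation IG := (IG irr).
Local Notation G x := (qstab act (IGv x)).
Local Notation sb := (skew_basis k).
Local Notation D := (skew_dual act).
Implicit Types (x y : IG) (v w : V) (p q : P).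

Lemma reps_inj i j g : i \in reps C -> j \in reps C -> act g i = j -> i = j.
Proof.
move=> iR jR gi; have [i0 [_ iU]] := repsP C j.
have orb1 : j \in qorbit act j by apply/imsetP; exists 1%g; rewrite ?vact1.
have orb2 : j \in qorbit act i by apply/imsetP; exists g.
by rewrite -(iU i (conj iR orb2)) -(iU j (conj jR orb1)).
Qed.

Lemma IGv_orbit x y g : act g (IGv x) = IGv y -> IGv x = IGv y.
Proof. by apply: reps_inj; apply: IGv_reps. Qed.

Lemma card_stab_transport i j g0 : act g0 i = j -> #|[set g | act g i == j]| = #|qstab act i|.
Proof.
move=> gi; rewrite -(card_lcoset (qstab act i) g0); apply: eq_card => g.
rewrite inE mem_lcoset; apply/eqP/stabP => [gj|].
  by rewrite vactM gj -gi -vactM mulVg vact1.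
by rewrite vactM => e; rewrite -gi -[in RHS]e -vactM mulgV vact1.
Qed.

(* The orbit-stabilizer theorem, as a change of summation. *)
Lemma sum_reps (R : pzAlgType k) (F : Q -> R) :
  \sum_(i in reps C) (#|qstab act i|%:R^-1)%:I * (\sum_g F (act g i)) = \sum_i F i.
Proof.
transitivity (\sum_(i in reps C) \sum_j ((j \in qorbit act i)%:R)%:I * F j).
  apply: eq_bigr => i iR; rewrite (partition_big (fun g => act g i) predT) //= mulr_sumr.
  apply: eq_bigr => j _; case: (boolP (j \in qorbit act i)) => [/imsetP[g0 _ gj]|nj].
    rewrite (eq_bigr (fun=> F j)) => [|g /eqP -> //].
    rewrite sumr_const -inalgMn mulrA; congr (_ * _).
    have -> : #|[pred g | act g i == j]| = #|qstab act i|.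
      by rewrite -(card_stab_transport (esym gj)); apply: eq_card => g; rewrite !inE.
    rewrite -inalgM mulVf //.
    exact: (@card_group_neq0 k gT (qstab act i) (pgroupS (finset.subsetT _) kG)).
  rewrite big1 ?mulr0 ?inalg0 ?mul0r // => g /eqP gj; case/negP: nj.
  by apply/imsetP; exists g.
rewrite exchange_big; apply: eq_bigr => j _ /=.
have [i0 [[i0R ji0] i0U]] := repsP C j.
rewrite (bigD1 i0) //= ji0 inalg1 mul1r big1 ?addr0 // => i /andP[iR ni].
case: (boolP (j \in _)) => [ji|_]; last by rewrite inalg0 mul0r.
by case/eqP: ni; apply/esym/i0U.
Qed.

Lemma sum_IG (R : nmodType) (F : IG -> R) :
  \sum_x F x = \sum_(i : {i : Q | i \in reps C}) \sum_(s : irr_idx (irr i))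
    F (Tagged (fun i => irr_idx (irr i)) s).
Proof.
rewrite sig_big_dep /=; apply: eq_bigr => -[i s] _.
by [].
Qed.

Lemma IGv_eq x y : IGv x = IGv y ->
  exists i (s t : irr_idx (irr i)), x = Tagged (fun i => irr_idx (irr i)) s /\
    y = Tagged (fun i => irr_idx (irr i)) t.
Proof.
case: x y => [i s] [j t] /val_inj /= ij; case: _ / ij in t *.
by exists i, s, t.
Qed.

Local Notation J := {x : IG & 'I_(IGdim x)}.

Local Notation mkJ a := (Tagged (fun x : IG => 'I_(IGdim x)) a).

Lemma sum_J (R : nmodType) (F : J -> R) : \sum_j F j = \sum_x \sum_(a < IGdim x) F (mkJ a).
Proof. by rewrite sig_big_dep /=; apply: eq_bigr => -[x a] _. Qed.

(** Matrix coefficients extended by zero to pairs of indices over distinct [x] and to elements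
    outside the stabilizer, so that sums can range over all of the group. *)
Definition block_rep (j j' : J) (g : gT) : k :=
  if (tag j == tag j') && (g \in G (tag j))
  then IGrep (tag j) g (tagged j) (tagged_as j j') else 0.

Lemma block_rep_eq x (a b : 'I_(IGdim x)) g : g \in G x ->
  block_rep (Tagged _ a) (Tagged _ b) g = IGrep x g a b.
Proof. by move=> gS; rewrite /block_rep eqxx gS tagged_asE. Qed.

Lemma block_rep_out x (a b : 'I_(IGdim x)) g : g \notin G x ->
  block_rep (Tagged _ a) (Tagged _ b) g = 0.
Proof. by move=> /negbTE gS; rewrite /block_rep gS andbF. Qed.

Lemma block_rep_neq j j' g : tag j != tag j' -> block_rep j j' g = 0.
Proof. by move=> /negbTE n; rewrite /block_rep n. Qed.

Variables (A : pzAlgType k) (gA : gT -> A) (eA : Q -> A) (xA : arrow (dquiver Q) -> A).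
Hypothesis gA1 : gA 1%g = 1.
Hypothesis gAM : forall g h, gA (g * h)%g = gA g * gA h.
Hypothesis eAM : forall i j, eA i * eA j = if i == j then eA i else 0.
Hypothesis eA1 : \sum_i eA i = 1.
Hypothesis geA : forall g i, gA g * eA i = eA (act g i) * gA g.
Hypothesis exA : forall b : arrow (dquiver Q), eA (qhead b) * xA b = xA b.
Hypothesis xeA : forall b : arrow (dquiver Q), xA b * eA (qtail b) = xA b.
Hypothesis gxA : forall g b, gA g * xA b = xA (double_aact act g b) * gA g.
Variable lam : Q -> k.
Hypothesis relA : forall i,
  \sum_(b : arrow (dquiver Q) | qtail b == i) (arrow_sign k b)%:I * (xA (arrow_rev b) * xA b) = (- lam i)%:I * eA i.

(* Locked, lest the matching of sums unfolds it. *)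
Definition skew_eval_def v : A := \sum_p (skew_coef p v)%:I * (gA p.1 * xA p.2).

Definition skew_eval := locked skew_eval_def.
Lemma skew_eval_unlock : skew_eval = skew_eval_def.
Proof. by rewrite /skew_eval -lock. Qed.

Lemma skew_eval_sum (I : finType) (S : pred I) (c : I -> k) (u : I -> V) :
  skew_eval (\sum_(i | S i) c i *: u i) = \sum_(i | S i) (c i)%:I * skew_eval (u i).
Proof.
rewrite skew_eval_unlock /skew_eval_def; under [RHS]eq_bigr do rewrite mulr_sumr.
rewrite [RHS]exchange_big; apply: eq_bigr => p _ /=.
rewrite linear_sum inalg_sum mulr_suml; apply: eq_bigr => i _.
by rewrite linearZ inalgM -[LHS]mulrA.
Qed.

Lemma skew_eval_basis p : skew_eval (sb p) = gA p.1 * xA p.2.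
Proof.
rewrite skew_eval_unlock /skew_eval_def (bigD1 p) //= big1 => [|q nq].
  by rewrite skew_coef_basis eqxx inalg1 mul1r addr0.
by rewrite skew_coef_basis (negbTE nq) inalg0 mul0r.
Qed.

Lemma skew_eval_lin (f : {linear V -> V}) (h : A -> A) :
  (forall p, skew_eval (f (sb p)) = h (skew_eval (sb p))) ->
  (forall (c : P -> k) (u : P -> A),
     h (\sum_p (c p)%:I * u p) = \sum_p (c p)%:I * h (u p)) ->
  forall v, skew_eval (f v) = h (skew_eval v).
Proof.
move=> fh hL v; rewrite [v]skew_basis_sum skew_eval_sum hL linear_sum.
rewrite (eq_bigr (fun p => skew_coef p v *: f (sb p))) => [|p _]; last by rewrite linearZ.
by rewrite skew_eval_sum; apply: eq_bigr => p _; rewrite fh.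
Qed.

Lemma skew_eval_lmul h v : skew_eval (sarr_lmul h v) = gA h * skew_eval v.
Proof.
apply: (skew_eval_lin (f := sarr_lmul h) (h := fun a => gA h * a)) => [p|c u].
  by rewrite /= sarr_lmul_basis !skew_eval_basis /= gAM mulrA.
by rewrite mulr_sumr; apply: eq_bigr => p _; rewrite inalgCA.
Qed.

Lemma skew_eval_rmul h v : skew_eval (sarr_rmul act h v) = skew_eval v * gA h.
Proof.
apply: (skew_eval_lin (f := sarr_rmul act h) (h := fun a => a * gA h)) => [p|c u].
  rewrite /= sarr_rmul_basis !skew_eval_basis /= gAM -!mulrA; congr (_ * _).
  by rewrite gxA -double_aactM mulgV double_aact1.
by rewrite mulr_suml; apply: eq_bigr => p _; rewrite mulrA.
Qed.

Lemma skew_eval0 : skew_eval 0 = 0.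
Proof. by rewrite skew_eval_unlock /skew_eval_def big1 // => p _; rewrite linear0 inalg0 mul0r. Qed.

Lemma skew_eval_block i j v : skew_eval (block act i j v) = eA j * skew_eval v * eA i.
Proof.
apply: (skew_eval_lin (f := block act i j) (h := fun a => eA j * a * eA i)) => [p|c u].
  rewrite /= block_basis; case: p => g b; rewrite in_blockE.
  have gxE : gA g * xA b = eA (act g (qhead b)) * (gA g * xA b) * eA (qtail b).
    by rewrite -!mulrA xeA mulrA -geA -mulrA exA.
  rewrite [in RHS]skew_eval_basis -[(g, b).1]/g -[(g, b).2]/b gxE.
  have [ti|nt] := eqVneq (qtail b) i; last first.
    by rewrite skew_eval0 -!mulrA eAM (negbTE nt) !mulr0.
  have [hj|nh] := eqVneq (act g (qhead b)) j; last first.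
    by rewrite skew_eval0 !mulrA eAM eq_sym (negbTE nh) !mul0r.
  rewrite skew_eval_basis -[(g, b).1]/g -[(g, b).2]/b gxE ti hj.
  have ee l : eA l * eA l = eA l by rewrite eAM eqxx.
  have eeA l a : eA l * (eA l * a) = eA l * a by rewrite mulrA ee.
  by rewrite -!mulrA !ee !eeA.
rewrite mulr_sumr mulr_suml; apply: eq_bigr => p _.
by rewrite inalgCA -!mulrA.
Qed.

Definition mx_unit_def x (a b : 'I_(IGdim x)) : A :=
  ((IGdim x)%:R / #|G x|%:R)%:I *
    ((\sum_(g in G x) (IGrep x g^-1%g b a)%:I * gA g) * eA (IGv x)).

Definition mx_unit := locked mx_unit_def.
Lemma mx_unit_unlock : mx_unit = mx_unit_def.
Proof. by rewrite /mx_unit -lock. Qed.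
Arguments mx_unit {x}.

Lemma mx_unit_e x (a b : 'I_(IGdim x)) : mx_unit a b * eA (IGv x) = mx_unit a b.
Proof. by rewrite mx_unit_unlock /mx_unit_def -!mulrA eAM eqxx. Qed.

Lemma e_mx_unit x (a b : 'I_(IGdim x)) : eA (IGv x) * mx_unit a b = mx_unit a b.
Proof.
rewrite mx_unit_unlock /mx_unit_def inalgCA; congr (_ * _); rewrite mulrA mulr_sumr !mulr_suml.
apply: eq_bigr => g /stabP gS.
by rewrite inalgCA -!mulrA; congr (_ * _); rewrite geA gS mulrA eAM eqxx.
Qed.

Lemma mx_unit_gl x h (a b : 'I_(IGdim x)) : h \in G x ->
  gA h * mx_unit a b = \sum_c (IGrep x h c a)%:I * mx_unit c b.
Proof.
move=> hS; rewrite mx_unit_unlock /mx_unit_def; under [RHS]eq_bigr do rewrite inalgCA.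
rewrite inalgCA -mulr_sumr; congr (_ * _).
under [RHS]eq_bigr do rewrite mulrA.
rewrite -mulr_suml mulrA; congr (_ * _).
under [RHS]eq_bigr do rewrite mulr_sumr.
rewrite exchange_big mulr_sumr [RHS](reindex_inj (mulgI h)).
apply: eq_big => [g|g gS]; first by rewrite groupMl.
under [RHS]eq_bigr do rewrite mulrA -inalgM.
rewrite -mulr_suml -inalg_sum inalgCA -gAM; congr (_%:I * _).
rewrite invMg repr_mxM ?groupV ?groupM //.
under [RHS]eq_bigr do rewrite mulrC.
(* The sum is recognised as an entry of a matrix product, where the factors at [h^-1] and [h]
   cancel. *)
have <- := mxE mulmx_key (fun i j => \sum_c (IGrep x g^-1 *m IGrep x h^-1)%g i c * IGrep x h c j) b a.
rewrite -[\matrix[_]_(_, _) _]/(_ *m _) -mulmxA -repr_mxM ?groupV // mulVg repr_mx1.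
by rewrite mulmx1.
Qed.

Lemma mx_unit_gr x h (a b : 'I_(IGdim x)) : h \in G x ->
  mx_unit a b * gA h = \sum_c (IGrep x h b c)%:I * mx_unit a c.
Proof.
move=> hS; have /stabP hx : (h^-1 \in G x)%g by rewrite groupV.
have eg : eA (IGv x) * gA h = gA h * eA (IGv x) by rewrite geA; move/stabP: hS => ->.
rewrite mx_unit_unlock /mx_unit_def; under [RHS]eq_bigr do rewrite inalgCA.
rewrite -!mulrA eg -mulr_sumr; congr (_ * _).
under [RHS]eq_bigr do rewrite mulrA.
rewrite -mulr_suml mulrA; congr (_ * _).
under [RHS]eq_bigr do rewrite mulr_sumr.
rewrite exchange_big mulr_suml [RHS](reindex_inj (mulIg h)).
apply: eq_big => [g|g gS]; first by rewrite groupMr.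
under [RHS]eq_bigr do rewrite mulrA -inalgM.
rewrite -mulr_suml -inalg_sum -mulrA -gAM; congr (_%:I * _).
rewrite invMg repr_mxM ?groupV ?groupM //.
have <- := mxE mulmx_key (fun i j => \sum_c IGrep x h i c * (IGrep x h^-1 *m IGrep x g^-1)%g c j) b a.
rewrite -[\matrix[_]_(_, _) _]/(_ *m _) mulmxA -repr_mxM ?groupV // mulgV repr_mx1.
by rewrite mul1mx.
Qed.

(** Only the left factor is expanded; its group elements act on the right factor through the
    representation at [y]. What remains are Schur sums, evaluated separately for equal and distinct
    [x], [y]. *)
Lemma mx_unitM_sum x y (a b : 'I_(IGdim x)) (c d : 'I_(IGdim y)) : IGv x = IGv y ->
  mx_unit a b * mx_unit c d = \sum_e ((IGdim x)%:R / #|G x|%:R *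
    \sum_(g in G x) IGrep y g e c * IGrep x g^-1%g b a)%:I * mx_unit e d.
Proof.
move=> xy; have eE : eA (IGv x) * mx_unit c d = mx_unit c d by rewrite xy e_mx_unit.
rewrite {1}mx_unit_unlock /mx_unit_def -!mulrA eE.
under [RHS]eq_bigr do rewrite inalgM -mulrA inalg_sum mulr_suml.
rewrite -mulr_sumr; congr (_ * _).
rewrite [RHS]exchange_big mulr_suml; apply: eq_bigr => g gS.
have gS' : g \in G y by rewrite -xy.
rewrite -mulrA mx_unit_gl // mulr_sumr; apply: eq_bigr => e _.
by rewrite inalgM -!mulrA inalgCA.
Qed.

Lemma mx_unitM_eq x (a b c d : 'I_(IGdim x)) :
  mx_unit a b * mx_unit c d = ((b == c)%:R)%:I * mx_unit a d.
Proof.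
rewrite mx_unitM_sum // (bigD1 a) //= [X in _ + X]big1 => [|e ne];
  rewrite (orthogonality_eq (stab_pgroup kG x) (IGrep_irr x)).
  rewrite addr0 eqxx andTb eq_sym; congr (_%:I * _).
  have nz := (stab_neq0 kG x, IGdim_neq0 kG x).
  by field; rewrite !nz.
by rewrite (negbTE ne) mul0r mulr0 inalg0 mul0r.
Qed.

Lemma mx_unitM_neq x y (a b : 'I_(IGdim x)) (c d : 'I_(IGdim y)) : x != y ->
  mx_unit a b * mx_unit c d = 0.
Proof.
move=> nxy; have [xy|nv] := eqVneq (IGv x) (IGv y); last first.
  by rewrite -(mx_unit_e a b) -(e_mx_unit c d) -mulrA (mulrA (eA _)) eAM (negbTE nv) mul0r mulr0.
rewrite mx_unitM_sum // big1 // => e _.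
have [i [s [t [xE yE]]]] := IGv_eq xy; subst x y.
have st : ~ mx_rsim (irr_rep t) (irr_rep s).
  by move=> /irr_rep_inj ts; case/eqP: nxy; rewrite ts.
rewrite (_ : \sum_(g in _) _ = 0) ?mulr0 ?inalg0 ?mul0r //.
exact: (orthogonality_neq _ _ _ _ (irr_repP t) (irr_repP s) st).
Qed.

Lemma mx_unit_sandwich (j j' : J) h :
  mx_unit (IGzero (tag j)) (tagged j) * gA h * mx_unit (tagged j') (IGzero (tag j'))
  = (block_rep j j' h)%:I * mx_unit (IGzero (tag j')) (IGzero (tag j')).
Proof.
case: j j' => [x a] [y b] /=.
have [hyx|nv] := eqVneq (act h (IGv y)) (IGv x); last first.
  have -> : mx_unit (IGzero x) a * gA h * mx_unit b (IGzero y) = 0.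
    rewrite -(mx_unit_e (IGzero x) a) -(e_mx_unit b (IGzero y)).
    move: (mx_unit _ a) (mx_unit b _) => E1 E2.
    rewrite -!mulrA (mulrA (gA h)) geA -mulrA (mulrA (eA (IGv x))) eAM.
    by rewrite eq_sym (negbTE nv) mul0r mulr0.
  rewrite /block_rep; case: eqP => [/= e|_]; last by rewrite inalg0 mul0r.
  case: ifP => [/stabP /= hS|_]; last by rewrite inalg0 mul0r.
  by case/eqP: nv; rewrite -e hS.
(* Both vertices are orbit representatives, so [h] can only carry one to the other if they coincide,
   and then it stabilizes them. *)
have xy := esym (IGv_orbit hyx).
have hS : h \in G x by apply/stabP; rewrite -[in RHS]hyx xy.
rewrite mx_unit_gr // mulr_suml; have [e|nxy] := eqVneq x y.
  subst y; rewrite (bigD1 b) //= [X in _ + X]big1 => [|c nc].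
    by rewrite addr0 -mulrA mx_unitM_eq eqxx inalg1 mul1r block_rep_eq.
  by rewrite -mulrA mx_unitM_eq (negbTE nc) inalg0 mul0r mulr0.
rewrite block_rep_neq // inalg0 mul0r big1 // => c _.
by rewrite -mulrA mx_unitM_neq // mulr0.
Qed.

(** Summing the diagonal units produces characters weighted by dimensions, and [sum_irr_characters]
    leaves only the term of the unit element. *)
Lemma sum_mx_unit_diag :
  \sum_y (#|G y|%:R^-1)%:I * (\sum_c @mx_unit y c c)
  = \sum_(i in reps C) (#|qstab act i|%:R^-1)%:I * eA i.
Proof.
rewrite sum_IG [RHS]big_sub; apply: eq_bigr => i _.
pose H := qstab act (val i); pose tg := Tagged (fun i => irr_idx (irr i)).
transitivity ((#|H|%:R^-1)%:I * \sum_(s : irr_idx (irr i)) \sum_c @mx_unit (tg i s) c c).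
  by rewrite mulr_sumr.
congr (_ * _).
transitivity (\sum_(g in H) ((#|H|%:R^-1 *
    \sum_(s : irr_idx (irr i)) (irr_dim s)%:R * \tr (irr_rep s g^-1%g))%:I * gA g) * eA (val i)).
  transitivity (\sum_(s : irr_idx (irr i)) (\sum_(g in H)
      (#|H|%:R^-1 * ((irr_dim s)%:R * \tr (irr_rep s g^-1%g)))%:I * gA g) * eA (val i)).
    apply: eq_bigr => s _; rewrite mx_unit_unlock /mx_unit_def -mulr_sumr -mulr_suml mulrA; congr (_ * _).
    rewrite exchange_big mulr_sumr; apply: eq_bigr => g _.
    rewrite -mulr_suml mulrA; congr (_ * _).
    rewrite -inalg_sum -inalgM; congr (_%:I).
    by rewrite /mxtrace mulrCA mulrA.
  under [LHS]eq_bigr do rewrite mulr_suml.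
  rewrite [LHS]exchange_big; apply: eq_bigr => g _.
  by rewrite mulr_sumr inalg_sum !mulr_suml.
rewrite (eq_bigr (fun g => if g == 1%g then eA (val i) else 0)) => [|g gS].
  rewrite -big_mkcondr (big_pred1 1%g) // => g; apply: andb_idl => /eqP ->.
  exact: group1.
have kH : ([pchar k]^'.-group H)%g := pgroupS (finset.subsetT H) kG.
rewrite (sum_irr_characters kH) ?groupV // eq_invg1; case: eqP => [->|_].
  by rewrite mul1r mulVf ?card_group_neq0 // inalg1 gA1 !mul1r.
by rewrite mul0r mulr0 inalg0 !mul0r.
Qed.

Lemma skew_evalD v w : skew_eval (v + w) = skew_eval v + skew_eval w.
Proof.
rewrite skew_eval_unlock /skew_eval_def -big_split; apply: eq_bigr => p _.
by rewrite linearD inalgD mulrDl.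
Qed.

Lemma skew_evalZ c v : skew_eval (c *: v) = c%:I * skew_eval v.
Proof.
by rewrite skew_eval_unlock /skew_eval_def mulr_sumr; apply: eq_bigr => p _; rewrite linearZ inalgM -mulrA.
Qed.

Lemma skew_eval_corner x y c a v :
  skew_eval (@corner k gT Q act C irr x y c a v)
  = mx_unit (IGzero y) c * skew_eval v * mx_unit a (IGzero x).
Proof.
rewrite /corner skew_evalZ (big_morph _ skew_evalD skew_eval0) mx_unit_unlock /mx_unit_def.
pose s := (\sum_(h in G y) (IGrep y h^-1%g c (IGzero y))%:I * gA h) * eA (IGv y).
pose t := (\sum_(g in G x) (IGrep x g^-1%g (IGzero x) a)%:I * gA g) * eA (IGv x).
transitivity ((proj_scale x y)%:I * (s * skew_eval v * t)); last first.
  rewrite -/s -/t inalgCA !mulrA -inalgM -!mulrA; congr (_%:I * _).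
  rewrite /proj_scale; have nz := (stab_neq0 kG x, stab_neq0 kG y).
  by field; rewrite !nz.
congr (_ * _); rewrite /s /t !mulr_suml; apply: eq_bigr => h hS.
rewrite skew_eval_sum [RHS]mulr_sumr; apply: eq_bigr => g gS.
rewrite sarr_lrmul skew_eval_rmul skew_eval_lmul skew_eval_block.
have eg : eA (IGv x) * gA g = gA g * eA (IGv x) by rewrite geA; move/stabP: gS => ->.
by rewrite -!mulrA eg inalgM -!mulrA; congr (_ * _); rewrite !inalgCA.
Qed.

Local Notation skew_arrow := (fun x y (l : 'I_(\dim {: AG x y})) => skew_eval (arrow_vec l)).

(** In A the arrow matrices are sandwiches between matrix units, so that consecutive factors can be
    multiplied directly. *)
Lemma arrow_mx_skew x y v (c : 'I_(IGdim y)) (a : 'I_(IGdim x)) :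
  arrow_mx skew_arrow v c a = mx_unit (IGzero y) c * skew_eval v * mx_unit a (IGzero x).
Proof. by rewrite arrow_mx_unlock -skew_eval_corner corner_arrow_vec skew_eval_sum. Qed.

(** Conjugation moves [e_i] along the orbit of [i], meeting each vertex once per element of a
    stabilizer coset; the weights cancel this multiplicity. *)
Lemma conj_sum_reps :
  \sum_g gA g^-1%g * (\sum_(i in reps C) (#|qstab act i|%:R^-1)%:I * eA i) * gA g = 1.
Proof.
rewrite -eA1 -sum_reps.
under eq_bigr do rewrite mulr_sumr mulr_suml.
rewrite exchange_big; apply: eq_bigr => i iR; rewrite mulr_sumr.
rewrite [LHS](reindex_inj invg_inj); apply: eq_bigr => g _.
by rewrite invgK inalgCA -mulrA geA -mulrA -gAM mulgV gA1 mulr1.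
Qed.

(** The inner matrix units multiply to the diagonal ones, whose weighted sum is [K]. For a fixed
    arrow [b], the sum over [g] then conjugates [K] into 1, which leaves the signed sum of [b' b],
    given by [relA]. *)
Lemma casimir_skew x x' (e : 'I_(IGdim x')) (a : 'I_(IGdim x)) :
  casimir_mx skew_arrow e a = mx_unit (IGzero x') e *
    (\sum_i (lam i)%:I * eA i) * mx_unit a (IGzero x).
Proof.
pose K := \sum_(i in reps C) (#|qstab act i|%:R^-1)%:I * eA i.
transitivity (mx_unit (IGzero x') e * (- \sum_p (arrow_sign k p.2)%:I *
    (skew_eval (sb (D p)) * K * skew_eval (sb p))) * mx_unit a (IGzero x)).
  rewrite /casimir_mx /K -sum_mx_unit_diag.
  transitivity (- (\sum_p \sum_y mx_unit (IGzero x') e * ((arrow_sign k p.2)%:I *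
    (skew_eval (sb (D p)) * ((#|G y|%:R^-1)%:I * (\sum_c @mx_unit y c c)) * skew_eval (sb p)))
     * mx_unit a (IGzero x))).
    rewrite exchange_big -sumrN; apply: eq_bigr => y _.
    rewrite inalgN mulNr; congr (- _); rewrite mulr_sumr; apply: eq_bigr => p _.
    under eq_bigr do rewrite !arrow_mx_skew.
    move: (skew_eval (sb (D p))) (skew_eval (sb p)) => s s'.
    have -> E d g K0 E' : E * (d%:I * (s * (g%:I * K0) * s')) * E'
        = g%:I * (d%:I * (E * s * K0 * s' * E')) :> A.
      by rewrite -!mulrA (inalgCA g s) (inalgCA d E) (inalgCA g E) (inalgCA g d%:I).
    congr (_ * (_ * _)).
    rewrite mulr_sumr !mulr_suml; apply: eq_bigr => c _.
    by rewrite -!mulrA (mulrA (mx_unit c _)) mx_unitM_eq eqxx inalg1 mul1r.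
  rewrite mulrN mulNr; congr (- _); rewrite mulr_sumr mulr_suml; apply: eq_bigr => p _.
  by rewrite -mulr_suml -mulr_sumr -mulr_sumr -mulr_suml -mulr_sumr.
congr (_ * _ * _).
rewrite -(pair_bigA _ (fun g b => (arrow_sign k b)%:I *
    (skew_eval (sb (D (g, b))) * K * skew_eval (sb (g, b))))).
rewrite exchange_big -sumrN.
transitivity (\sum_(b : arrow (dquiver Q)) - ((arrow_sign k b)%:I * (xA (arrow_rev b) * xA b))).
  (* Since the dual of [g b] is [b' g^-1], the summand is [b' (g^-1 K g) b]. *)
  apply: eq_bigr => b _; congr (- _); rewrite -mulr_sumr; congr (_ * _).
  rewrite -[xA b in RHS]mul1r -conj_sum_reps mulr_suml mulr_sumr; apply: eq_bigr => g _.
  rewrite !skew_eval_basis -[D _]/(_, _) -[(g, b).1]/g -[(g, b).2]/b.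
  rewrite -[(_, _).1]/(g^-1)%g -[(_, _).2]/(double_aact act g (arrow_rev b)).
  by rewrite gxA -double_aactM mulVg double_aact1 !mulrA.
rewrite (partition_big (fun b : arrow (dquiver Q) => qtail b) predT) //=.
apply: eq_bigr => i _; rewrite sumrN relA inalgN mulNr.
by rewrite opprK.
Qed.

(** Each diagonal Casimir entry equals [lam] times the unit at [(0, 0)]; there are [IGdim x] of
    them, whence the numerator of eta. *)
Lemma skew_relator x :
  \sum_y \sum_l (\sum_m (coord (AG_basis y x) m
      (AG_eps (dual_vec (@AG_pair k gT Q act C irr x y) (AG_basis x y) l)))%:I
        * skew_eval (arrow_vec m)) * skew_eval (arrow_vec l)
  = ((IGdim x)%:R / #|G x|%:R * lam (IGv x))%:I * mx_unit (IGzero x) (IGzero x).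
Proof.
rewrite (relator_sum kG skew_arrow).
rewrite (eq_bigr (fun=> (lam (IGv x))%:I * mx_unit (IGzero x) (IGzero x))) => [|a _].
  rewrite sumr_const card_ord -inalgMn !mulrA -!inalgM; congr (_%:I * _); ring.
rewrite casimir_skew mulr_sumr mulr_suml (bigD1 (IGv x)) //= big1 => [|i ni].
  by rewrite inalgCA -mulrA -mulrA e_mx_unit mx_unitM_eq eqxx inalg1 mul1r addr0.
by rewrite inalgCA -!mulrA -[mx_unit a _]e_mx_unit (mulrA (eA i)) eAM (negbTE ni) mul0r !mulr0.
Qed.

Definition frame_out (t : J * gT) : A :=
  mx_unit (IGzero (tag t.1)) (tagged t.1) * gA t.2^-1%g.
Definition frame_in (t : J * gT) : A :=
  (#|G (tag t.1)|%:R^-1)%:I * (gA t.2 * mx_unit (tagged t.1) (IGzero (tag t.1))).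

Lemma sum_frame : \sum_t frame_in t * frame_out t = 1.
Proof.
rewrite -conj_sum_reps -sum_mx_unit_diag.
rewrite -(pair_bigA _ (fun j g => frame_in (j, g) * frame_out (j, g))) exchange_big.
rewrite [RHS](reindex_inj invg_inj); apply: eq_bigr => g _.
rewrite invgK mulr_sumr mulr_suml.
rewrite sum_J.
apply: eq_bigr => x _; rewrite inalgCA -mulrA mulr_sumr mulr_suml mulr_sumr.
apply: eq_bigr => a _; rewrite /frame_in /frame_out /= -!mulrA.
by rewrite (mulrA (mx_unit _ _)) mx_unitM_eq eqxx inalg1 mul1r.
Qed.

Lemma frame_group g t t' :
  frame_out t * gA g * frame_in t' =
  (#|G (tag t'.1)|%:R^-1 * block_rep t.1 t'.1 (t.2^-1 * g * t'.2)%g)%:I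
    * mx_unit (IGzero (tag t'.1)) (IGzero (tag t'.1)).
Proof.
rewrite /frame_out /frame_in inalgCA inalgM -[RHS]mulrA; congr (_ * _).
by rewrite -mx_unit_sandwich -!mulrA !gAM -!mulrA.
Qed.

Lemma frame_vertex i t t' :
  frame_out t * eA i * frame_in t' =
  if act t'.2 (IGv (tag t'.1)) == i then frame_out t * gA 1%g * frame_in t' else 0.
Proof.
have eE : frame_in t' = eA (act t'.2 (IGv (tag t'.1))) * frame_in t'.
  by rewrite /frame_in inalgCA; congr (_ * _); rewrite mulrA -geA -mulrA e_mx_unit.
rewrite eE gA1 mulr1 -!mulrA (mulrA (eA i)) eAM eq_sym.
by case: eqP => [->|]; rewrite ?mul0r ?mulr0.
Qed.

Lemma frame_arrow v t t' :
  frame_out t * skew_eval v * frame_in t' =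
  (#|G (tag t'.1)|%:R^-1)%:I * arrow_mx skew_arrow
     (sarr_lmul t.2^-1%g (sarr_rmul act t'.2 v)) (tagged t.1) (tagged t'.1).
Proof.
rewrite arrow_mx_skew sarr_lrmul skew_eval_rmul skew_eval_lmul /frame_out /frame_in inalgCA.
by rewrite !mulrA.
Qed.

(** By [HGval_arrow_vec] an arrow vector is its own compression by the units at [(0, 0)]. *)
Lemma skew_arrow_target x y (l : 'I_(\dim {: AG x y})) :
  mx_unit (IGzero y) (IGzero y) * skew_eval (arrow_vec l) = skew_eval (arrow_vec l)
  /\ skew_eval (arrow_vec l) * mx_unit (IGzero x) (IGzero x) = skew_eval (arrow_vec l).
Proof.
have -> : skew_eval (arrow_vec l) =
    mx_unit (IGzero y) (IGzero y) * skew_eval (arrow_vec l) * mx_unit (IGzero x) (IGzero x).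
  rewrite -arrow_mx_skew arrow_mx_unlock /arrow_mx_def (bigD1 l) //= big1 => [|m nm].
    by rewrite HGval_arrow_vec // !eqxx inalg1 mul1r addr0.
  by rewrite HGval_arrow_vec // (negbTE nm) inalg0 mul0r.
by rewrite !mulrA mx_unitM_eq -!mulrA mx_unitM_eq !eqxx inalg1 !mul1r.
Qed.

End SkewModel.

(** * Matrices over the path algebra of the quiver of orbits *)

Section MatrixModel.
Variables (k : closedFieldType) (gT : finGroupType) (Q : quiver).
Variables (act : quiver_action gT Q) (C : orbit_choices act).
Variable irr : forall i : {i : Q | i \in reps C}, irr_reps k (qstab act (val i)).
Hypothesis kG : ([pchar k]^'.-group [set: gT])%g.
Local Notation V := (skew_arrows k gT Q).
Local Notation P := (gT * arrow (dquiver Q))%type.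
Local Notation IG := (IG irr).
Local Notation G x := (qstab act (IGv x)).
Local Notation sb := (skew_basis k).
Local Notation D := (skew_dual act).
Local Notation J := {x : IG & 'I_(IGdim x)}.
Local Notation mkJ a := (Tagged (fun x : IG => 'I_(IGdim x)) a).
Implicit Types (x y : IG) (v w : V) (p q : P) (t u : J * gT).

Variables (B : pzAlgType k) (vB : IG -> B).
Variable aB : forall x y : IG, 'I_(\dim {: AG x y}) -> B.
Hypothesis vBM : forall x y, vB x * vB y = if x == y then vB x else 0.
Hypothesis vB1 : \sum_x vB x = 1.
Hypothesis vaB : forall x y (l : 'I_(\dim {: AG x y})), vB y * aB l = aB l.
Hypothesis avB : forall x y (l : 'I_(\dim {: AG x y})), aB l * vB x = aB l.
Variable lam : Q -> k.
Hypothesis lamG : orbit_invariant act lam.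
Hypothesis relB : forall x,
  \sum_y \sum_l (\sum_m (coord (AG_basis y x) m
      (AG_eps (dual_vec (@AG_pair k gT Q act C irr x y) (AG_basis x y) l)))%:I * aB m) * aB l
  = ((IGdim x)%:R / #|G x|%:R * lam (IGv x))%:I * vB x.

Local Notation amx := (arrow_mx aB).

Lemma arrow_mx_target x y v c (a : 'I_(IGdim x)) : vB y * amx v c a = @arrow_mx _ _ _ _ _ _ _ aB x y v c a.
Proof.
rewrite arrow_mx_unlock /arrow_mx_def mulr_sumr; apply: eq_bigr => l _.
by rewrite inalgCA vaB.
Qed.

Lemma arrow_mx_source x y v (c : 'I_(IGdim y)) (a : 'I_(IGdim x)) : amx v c a * vB x = amx v c a.
Proof.
rewrite arrow_mx_unlock /arrow_mx_def mulr_suml; apply: eq_bigr => l _.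
by rewrite -mulrA avB.
Qed.

Lemma block_rep_lmul x (a : 'I_(IGdim x)) (j : J) h g : h \in G x ->
  block_rep (mkJ a) j (h * g)%g = \sum_b IGrep x h a b * block_rep (mkJ b) j g.
Proof.
move=> hS; case: j => y c; have [e|nxy] := eqVneq x y; last first.
  by rewrite block_rep_neq // big1 // => b _; rewrite block_rep_neq ?mulr0.
subst y; case: (boolP (g \in G x)) => [gS|gN]; last first.
  rewrite block_rep_out ?groupMl // big1 // => b _.
  by rewrite block_rep_out ?mulr0.
rewrite block_rep_eq ?groupM // repr_mxM // mxE.
by apply: eq_bigr => b _; rewrite block_rep_eq.
Qed.

Lemma average_const x (b : B) (S : pred gT) (f : gT -> gT) : injective f ->
  (forall g, S (f g) = (g \in G x)) -> \sum_(g | S g) (#|G x|%:R^-1)%:I * b = b.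
Proof.
move=> fI fS; rewrite (reindex_inj fI) (eq_bigl _ _ fS) sumr_const -inalgMn mulrA -inalgM.
by rewrite mulfV ?stab_neq0 // inalg1 mul1r.
Qed.

(* Averaging over the stabilizer replaces the choice of coset representatives. *)
Lemma conv_left (j : J) (s : gT) (F : J -> gT -> B) :
  (forall x (a : 'I_(IGdim x)) h g, h \in G x ->
     F (mkJ a) (h * g)%g = \sum_b (IGrep x h a b)%:I * F (mkJ b) g) ->
  \sum_(t : J * gT) (#|G (tag t.1)|%:R^-1 * block_rep j t.1 (s * t.2)%g)%:I * F t.1 t.2^-1%g
  = F j s.
Proof.
move=> FL; rewrite -(pair_bigA _ (fun j' g =>
  (#|G (tag j')|%:R^-1 * block_rep j j' (s * g)%g)%:I * F j' g^-1%g)) exchange_big /=.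
case: j => x a; transitivity (\sum_(g | (s * g)%g \in G x) (#|G x|%:R^-1)%:I * F (mkJ a) s).
  rewrite [RHS]big_mkcond; apply: eq_bigr => g _; rewrite sum_J (bigD1 x) //= [X in _ + X]big1.
    rewrite addr0; case: ifP => [gS|/negbT gN].
      rewrite -[in RHS](mulgK g s) FL // mulr_sumr; apply: eq_bigr => b _.
      by rewrite inalgM block_rep_eq // mulrA.
    by rewrite big1 // => b _; rewrite block_rep_out // mulr0 inalg0 mul0r.
  move=> y nyx; rewrite big1 // => b _.
  by rewrite block_rep_neq 1?eq_sym // mulr0 inalg0 mul0r.
apply: (average_const _ (f := mulg s^-1%g)); first exact: mulgI.
by move=> g; rewrite mulKVg.
Qed.

(** Mirror image of [conv_left]: within a coset of the stabilizer, all terms agree after summation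
    over the representation index. *)
Lemma conv_right (j : J) (s : gT) (F : J -> gT -> B) :
  (forall x (b : 'I_(IGdim x)) h g, h \in G x ->
     F (mkJ b) (g * h)%g = \sum_a (IGrep x h a b)%:I * F (mkJ a) g) ->
  \sum_(t : J * gT) (#|G (tag t.1)|%:R^-1 * block_rep t.1 j (t.2^-1 * s)%g)%:I * F t.1 t.2
  = F j s.
Proof.
move=> FR; rewrite -(pair_bigA _ (fun j' g =>
  (#|G (tag j')|%:R^-1 * block_rep j' j (g^-1 * s)%g)%:I * F j' g)) exchange_big /=.
case: j => x b; transitivity (\sum_(g | (g^-1 * s)%g \in G x) (#|G x|%:R^-1)%:I * F (mkJ b) s).
  rewrite [RHS]big_mkcond; apply: eq_bigr => g _; rewrite sum_J (bigD1 x) //= [X in _ + X]big1.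
    rewrite addr0; case: ifP => [gS|/negbT gN].
      rewrite -[in RHS](mulKVg g s) FR // mulr_sumr; apply: eq_bigr => a _.
      by rewrite inalgM block_rep_eq // mulrA.
    by rewrite big1 // => a _; rewrite block_rep_out // mulr0 inalg0 mul0r.
  move=> y nyx; rewrite big1 // => a _.
  by rewrite block_rep_neq // mulr0 inalg0 mul0r.
apply: (average_const _ (f := fun g => (s * g^-1)%g)).
  by move=> g h /mulgI /invg_inj.
by move=> g; rewrite invMg invgK mulgKV.
Qed.

(** The entries of this matrix and of the next ones are dictated by [frame_group], [frame_arrow] and
    [frame_vertex], with [E_x(0, 0)] replaced by the vertex [vB x]. *)
Definition group_mx g t u : B :=
  (#|G (tag u.1)|%:R^-1 * block_rep t.1 u.1 (t.2^-1 * g * u.2)%g)%:I * vB (tag u.1).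
Definition vector_mx v t u : B :=
  (#|G (tag u.1)|%:R^-1)%:I * amx (sarr_lmul t.2^-1%g (sarr_rmul act u.2 v)) (tagged t.1) (tagged u.1).
(** The vertex of [Q] at which the frame element [g E_x(a, 0)] ends. *)
Definition place t : Q := act t.2 (IGv (tag t.1)).
Definition vertex_mx i t u : B := if place u == i then group_mx 1%g t u else 0.

Lemma group_mxM g h t u : \sum_r group_mx g t r * group_mx h r u = group_mx (g * h)%g t u.
Proof.
pose F (j : J) s := (#|G (tag u.1)|%:R^-1 * block_rep j u.1 (s * h * u.2)%g)%:I * vB (tag u.1).
transitivity (F t.1 (t.2^-1 * g)%g); last by rewrite /F /group_mx !mulgA.
rewrite -(@conv_left t.1 (t.2^-1 * g)%g F) => [|x a h' g' hS].
  apply: eq_bigr => r _; rewrite /group_mx -mulrA; congr (_ * _).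
  rewrite /F inalgCA vBM; case: eqP => [->//|/eqP n].
  by rewrite block_rep_neq // !mulr0 inalg0 mul0r.
rewrite /F -!mulgA block_rep_lmul // mulr_sumr inalg_sum mulr_suml.
by apply: eq_bigr => b _; rewrite mulrCA inalgM -mulrA.
Qed.

Lemma group_vector_mxM g v t u :
  \sum_r group_mx g t r * vector_mx v r u = vector_mx (sarr_lmul g v) t u.
Proof.
pose F (j : J) s := (#|G (tag u.1)|%:R^-1)%:I *
  amx (sarr_lmul s (sarr_rmul act u.2 v)) (tagged j) (tagged u.1).
transitivity (F t.1 (t.2^-1 * g)%g).
  rewrite -(@conv_left t.1 (t.2^-1 * g)%g F) => [|x a h g' hS].
    apply: eq_bigr => r _; rewrite /group_mx -mulrA; congr (_ * _).
    by rewrite /F /vector_mx inalgCA arrow_mx_target.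
  rewrite /F sarr_lmulM arrow_mx_lmul // mulr_sumr.
  by apply: eq_bigr => b _; rewrite inalgCA.
by rewrite /F /vector_mx sarr_lmulM -sarr_lrmul.
Qed.

Lemma vector_group_mxM g v t u :
  \sum_r vector_mx v t r * group_mx g r u = vector_mx (sarr_rmul act g v) t u.
Proof.
pose F (j : J) s := (#|G (tag u.1)|%:R^-1)%:I *
  amx (sarr_lmul t.2^-1%g (sarr_rmul act s v)) (tagged t.1) (tagged j).
transitivity (F u.1 (g * u.2)%g).
  rewrite -(@conv_right u.1 (g * u.2)%g F) => [|x a h g' hS].
    apply: eq_bigr => r _; rewrite /group_mx /vector_mx /F mulgA.
    have [e|n] := eqVneq (tag r.1) (tag u.1); last first.
      by rewrite block_rep_neq // !mulr0 inalg0 !mul0r mulr0.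
    rewrite !inalgM -!mulrA; congr (_ * _).
    rewrite -e inalgCA [RHS]inalgCA; congr (_ * _).
    by rewrite inalgCA arrow_mx_source.
  rewrite /F sarr_rmulM sarr_lrmul arrow_mx_rmul // mulr_sumr.
  by apply: eq_bigr => b _; rewrite -inalgC [RHS]inalgCA sarr_lrmul.
by rewrite /F /vector_mx sarr_rmulM.
Qed.

Lemma block_rep_place t u g : act g (place u) != place t ->
  block_rep t.1 u.1 (t.2^-1 * g * u.2)%g = 0.
Proof.
move=> np; rewrite /block_rep; case: eqP => //= e; case: ifP => // /stabP S.
case/eqP: np; rewrite /place -e -[in RHS]S -!vactM.
by rewrite !mulgA mulgV mul1g.
Qed.

Lemma group_mx_place g t u : act g (place u) != place t -> group_mx g t u = 0.
Proof. by move=> np; rewrite /group_mx block_rep_place // mulr0 inalg0 mul0r. Qed.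

Lemma vertex_mxE i t u :
  vertex_mx i t u = if place t == i then group_mx 1%g t u else 0.
Proof.
rewrite /vertex_mx; have [e|n] := eqVneq (place u) (place t); first by rewrite e.
by rewrite group_mx_place ?vact1 // !if_same.
Qed.

Lemma vertex_mxMl i (M : J * gT -> B) N t :
  (\sum_r group_mx 1%g t r * M r = N) ->
  \sum_r vertex_mx i t r * M r = if place t == i then N else 0.
Proof.
move=> <-; case: ifP => e.
  by apply: eq_bigr => r _; rewrite vertex_mxE e.
by rewrite big1 // => r _; rewrite vertex_mxE e mul0r.
Qed.

Lemma vertex_mxMr i (M : J * gT -> B) N u :
  (\sum_r M r * group_mx 1%g r u = N) ->
  \sum_r M r * vertex_mx i r u = if place u == i then N else 0.
Proof.
move=> <-; rewrite /vertex_mx; case: ifP => e //.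
by rewrite big1 // => r _; rewrite mulr0.
Qed.

Lemma vertex_mxM i j t u :
  \sum_r vertex_mx i t r * vertex_mx j r u = if i == j then vertex_mx i t u else 0.
Proof.
rewrite (@vertex_mxMr j _ (vertex_mx i t u)); last first.
  by rewrite (vertex_mxMl _ (group_mxM 1 1 t u)) mulg1 vertex_mxE.
rewrite /vertex_mx; have [<-|n] := eqVneq i j; first by case: (place u == i).
by have [->|//] := eqVneq (place u) j; rewrite eq_sym (negbTE n).
Qed.

Lemma sum_vertex_mx t u : \sum_i vertex_mx i t u = group_mx 1%g t u.
Proof.
rewrite (bigD1 (place u)) //= big1 => [|i n]; first by rewrite /vertex_mx eqxx addr0.
by rewrite /vertex_mx eq_sym (negbTE n).
Qed.

Lemma group_vertex_mx g i t u :
  \sum_r group_mx g t r * vertex_mx i r u = if place u == i then group_mx g t u else 0.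
Proof. by apply: vertex_mxMr; rewrite group_mxM mulg1. Qed.

Lemma vertex_group_mx g i t u :
  \sum_r vertex_mx (act g i) t r * group_mx g r u = if place u == i then group_mx g t u else 0.
Proof.
rewrite (vertex_mxMl _ (group_mxM 1 g t u)) mul1g.
have [e|n] := eqVneq (act g (place u)) (place t); last by rewrite group_mx_place // !if_same.
by rewrite -e (inj_eq (@vact_inj _ _ act g)).
Qed.

Definition arrow_matrix (b : arrow (dquiver Q)) := vector_mx (sb (1%g, b)).

Lemma arrow_mx_place p t u : (qtail p.2 != place u) || (act p.1 (qhead p.2) != place t) ->
  vector_mx (sb p) t u = 0.
Proof.
case: p => g b np; rewrite /vector_mx sarr_rmul_basis sarr_lmul_basis -arrow_mx_block block_basis.
rewrite ifN ?arrow_mx0 ?mulr0 //; apply: contraL np.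
rewrite in_blockE double_tail double_head => /andP[/eqP e1 /eqP].
rewrite /= mulgA vactM -(vactM act u.2 u.2^-1%g) mulgV vact1 => e2.
rewrite /place -e1 -e2 -!vactM !mulgA !mulgV mul1g vact1.
by rewrite negb_or !negbK !eqxx.
Qed.

Lemma arrow_matrix_tail (b : arrow (dquiver Q)) t u :
  \sum_r arrow_matrix b t r * vertex_mx (qtail b) r u = arrow_matrix b t u.
Proof.
rewrite (@vertex_mxMr _ _ (arrow_matrix b t u)); last first.
  by rewrite /arrow_matrix vector_group_mxM sarr_rmul1.
by case: eqP => // /eqP n; rewrite /arrow_matrix arrow_mx_place //= eq_sym n.
Qed.

Lemma arrow_matrix_head (b : arrow (dquiver Q)) t u :
  \sum_r vertex_mx (qhead b) t r * arrow_matrix b r u = arrow_matrix b t u.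
Proof.
rewrite (@vertex_mxMl _ _ (arrow_matrix b t u)); last first.
  by rewrite /arrow_matrix group_vector_mxM sarr_lmul1.
case: eqP => // /eqP n; apply/esym/arrow_mx_place; apply/orP; right.
by rewrite vact1 eq_sym.
Qed.

Lemma group_arrow_matrix g (b : arrow (dquiver Q)) t u :
  \sum_r group_mx g t r * arrow_matrix b r u
  = \sum_r arrow_matrix (double_aact act g b) t r * group_mx g r u.
Proof.
rewrite group_vector_mxM vector_group_mxM sarr_lmul_basis sarr_rmul_basis /= mulg1 mul1g.
by rewrite -double_aactM mulVg double_aact1.
Qed.

(** The Casimir matrix intertwines the two representations: a factor [h] on the left of the dual
    vectors can be carried to the right of the vectors. *)
Lemma casimir_lmul x x' h (e : 'I_(IGdim x')) (a : 'I_(IGdim x)) : h \in G x -> h \in G x' ->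
  \sum_f (IGrep x' h e f)%:I * casimir_mx aB f a
  = \sum_f casimir_mx aB e f * (IGrep x h f a)%:I.
Proof.
move=> hx hx'.
transitivity (\sum_y (- #|G y|%:R^-1)%:I * \sum_p (arrow_sign k p.2)%:I *
    \sum_(c < IGdim y) amx (sarr_lmul h (sb (D p))) e c * amx (sb p) c a).
  rewrite /casimir_mx; under [LHS]eq_bigr do rewrite mulr_sumr.
  rewrite [LHS]exchange_big; apply: eq_bigr => y _ /=.
  under [LHS]eq_bigr do rewrite inalgCA; rewrite -[LHS]mulr_sumr; congr (_ * _).
  under [LHS]eq_bigr do rewrite mulr_sumr.
  rewrite [LHS]exchange_big; apply: eq_bigr => p _ /=.
  under [LHS]eq_bigr do rewrite inalgCA; rewrite -[LHS]mulr_sumr; congr (_ * _).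
  under [LHS]eq_bigr do rewrite mulr_sumr.
  rewrite [LHS]exchange_big; apply: eq_bigr => c _ /=.
  by rewrite arrow_mx_lmul // mulr_suml; apply: eq_bigr => f _; rewrite mulrA.
transitivity (\sum_y (- #|G y|%:R^-1)%:I * \sum_p (arrow_sign k p.2)%:I *
    \sum_(c < IGdim y) amx (sb (D p)) e c * amx (sarr_rmul act h (sb p)) c a).
  apply: eq_bigr => y _; congr (_ * _).
  (* The substitution [p |-> p h]; on dual vectors it is left multiplication by [h^-1]. *)
  pose f p : P := (p.1 * h, double_aact act h^-1 p.2)%g.
  have fI : injective f.
    move=> [g b] [g' b'] [/mulIg -> /(@aact_inj _ _ (double_action act)) ->]; exact: erefl.
  rewrite (reindex_inj fI); apply: eq_bigr => -[g b] _.
  have -> : sarr_lmul h (sb (D (f (g, b)))) = sb (D (g, b)).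
    rewrite sarr_lmul_basis /skew_dual /=; congr (sb (_, _)).
      by rewrite invMg mulKVg.
    by rewrite !double_aact_rev -!double_aactM mulgK.
  have -> : sb (f (g, b)) = sarr_rmul act h (sb (g, b)) by rewrite sarr_rmul_basis.
  by congr (_%:I * _); case: b.
rewrite /casimir_mx; under [RHS]eq_bigr do rewrite mulr_suml.
rewrite [RHS]exchange_big; apply: eq_bigr => y _ /=.
under [RHS]eq_bigr do rewrite -mulrA; rewrite -[RHS]mulr_sumr; congr (_ * _).
under [RHS]eq_bigr do rewrite mulr_suml.
rewrite [RHS]exchange_big; apply: eq_bigr => p _ /=.
under [RHS]eq_bigr do rewrite -mulrA; rewrite -[RHS]mulr_sumr; congr (_ * _).
under [RHS]eq_bigr do rewrite mulr_suml.
rewrite [RHS]exchange_big; apply: eq_bigr => c _ /=.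
by rewrite arrow_mx_rmul // mulr_sumr; apply: eq_bigr => f _; rewrite mulrA.
Qed.

(** Commutation with each [h] makes the matrix equal to its own average, in a form to which Schur
    orthogonality applies. *)
Lemma casimir_average x x' (e : 'I_(IGdim x')) (a : 'I_(IGdim x)) : IGv x = IGv x' ->
  (#|G x|%:R)%:I * casimir_mx aB e a
  = \sum_f \sum_f' (\sum_(h in G x) IGrep x' h e f * IGrep x h^-1%g f' a)%:I * casimir_mx aB f f'.
Proof.
move=> xx'; transitivity (\sum_(h in G x) \sum_f' (\sum_f (IGrep x' h e f)%:I * casimir_mx aB f f')
    * (IGrep x h^-1%g f' a)%:I).
  rewrite inalgMn -sumr_const; apply: eq_bigr => h hS.
  have hS' : h \in G x' by rewrite -xx'.
  under eq_bigr do rewrite casimir_lmul // mulr_suml.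
  rewrite exchange_big /= (bigD1 a) //= [X in _ + X]big1 => [|f nf].
    under eq_bigr do rewrite -mulrA -inalgM.
    rewrite -mulr_sumr -inalg_sum (_ : \sum_j _ = 1) ?inalg1 ?mulr1 ?addr0 //.
    transitivity ((IGrep x h *m IGrep x h^-1%g) a a); first by rewrite mxE.
    by rewrite -repr_mxM ?groupV // mulgV repr_mx1 mxE eqxx.
  under eq_bigr do rewrite -mulrA -inalgM.
  rewrite -mulr_sumr -inalg_sum (_ : \sum_j _ = 0) ?inalg0 ?mulr0 //.
  transitivity ((IGrep x h *m IGrep x h^-1%g) f a); first by rewrite mxE.
  by rewrite -repr_mxM ?groupV // mulgV repr_mx1 mxE (negbTE nf).
under eq_bigr do under eq_bigr do rewrite mulr_suml.
under eq_bigr do rewrite exchange_big.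
rewrite exchange_big; apply: eq_bigr => f _ /=.
rewrite exchange_big; apply: eq_bigr => f' _ /=.
rewrite inalg_sum mulr_suml; apply: eq_bigr => h _.
by rewrite inalgM -!mulrA; congr (_ * _); rewrite inalgC.
Qed.

Lemma inalgI (c : k) (b b' : B) : c != 0 -> c%:I * b = c%:I * b' -> b = b'.
Proof.
move=> c0 e; rewrite -[b]mul1r -[b']mul1r -inalg1 -(mulVf c0) inalgM -!mulrA.
by rewrite e.
Qed.

Lemma casimir_neq x x' (e : 'I_(IGdim x')) (a : 'I_(IGdim x)) : IGv x = IGv x' -> x != x' ->
  casimir_mx aB e a = 0.
Proof.
move=> xx' nxx'; apply: (inalgI (stab_neq0 kG x)); rewrite casimir_average // mulr0.
have [i [s [s' [xE xE']]]] := IGv_eq xx'; subst x x'.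
have ss : ~ mx_rsim (irr_rep s') (irr_rep s).
  by move=> /irr_rep_inj e'; case/eqP: nxx'; rewrite e'.
apply: big1 => f _; apply: big1 => f' _.
rewrite (_ : \sum_(h in _) _ = 0) ?inalg0 ?mul0r //.
exact: (orthogonality_neq _ _ _ _ (irr_repP s') (irr_repP s) ss).
Qed.

(** The average is scalar, hence determined by the trace, and [relator_sum] identifies the trace
    with the relation at [x]. A single relation thus yields all the entries. *)
Lemma casimir_eq x (e a : 'I_(IGdim x)) :
  casimir_mx aB e a = ((e == a)%:R)%:I * ((lam (IGv x))%:I * vB x).
Proof.
apply: (inalgI (stab_neq0 kG x)); rewrite casimir_average //.
transitivity (((e == a)%:R * (#|G x|%:R / (IGdim x)%:R))%:I * \sum_f @casimir_mx _ _ _ _ _ _ _ aB x x f f).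
  rewrite mulr_sumr; apply: eq_bigr => f _; rewrite (bigD1 f) //= [X in _ + X]big1 => [|f' nf].
    by rewrite (orthogonality_eq (stab_pgroup kG x) (IGrep_irr x)) eqxx andbT addr0.
  rewrite (orthogonality_eq (stab_pgroup kG x) (IGrep_irr x)) [f == f']eq_sym (negbTE nf).
  by rewrite andbF mul0r inalg0 mul0r.
have e1 : \sum_f @casimir_mx _ _ _ _ _ _ _ aB x x f f = ((IGdim x)%:R * lam (IGv x))%:I * vB x.
  apply: (inalgI (invr_neq0 (stab_neq0 kG x))).
  rewrite -(relator_sum kG aB) relB mulrA -inalgM; congr (_%:I * _).
  by rewrite mulrCA mulrA.
rewrite e1 !mulrA -!inalgM; congr (_%:I * _).
by field; rewrite IGdim_neq0.
Qed.

Lemma head_rev (b : arrow (dquiver Q)) : qhead (arrow_rev b) = qtail b.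
Proof. by case: b. Qed.

(** Both sides vanish unless [t] and [u] are placed at [i]. Otherwise the left side is a row of the
    representation times a column of the Casimir matrix, known from [casimir_eq] and
    [casimir_neq]. *)
Lemma relation_mx i t u :
  \sum_(b : arrow (dquiver Q) | qtail b == i) (arrow_sign k b)%:I *
    (\sum_r arrow_matrix (arrow_rev b) t r * arrow_matrix b r u)
  = (- lam i)%:I * vertex_mx i t u.
Proof.
rewrite /vertex_mx; have [pi|npi] := eqVneq (place u) i; last first.
  rewrite mulr0 big1 // => b /eqP bi; rewrite big1 ?mulr0 // => r _.
  by rewrite [X in _ * X]arrow_mx_place ?mulr0 // bi eq_sym npi.
have [tu|ntu] := eqVneq (place u) (place t); last first.
  rewrite group_mx_place ?vact1 // mulr0 big1 // => b /eqP bi; rewrite big1 ?mulr0 // => r _.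
  rewrite [X in X * _]arrow_mx_place ?mul0r //; apply/orP; right; rewrite vact1.
  by rewrite head_rev bi -pi.
(* The condition on the tail may be dropped: arrows starting elsewhere have zero entries in column
   [u]. *)
transitivity (\sum_(b : arrow (dquiver Q)) (arrow_sign k b)%:I *
    (\sum_r arrow_matrix (arrow_rev b) t r * arrow_matrix b r u)).
  rewrite [RHS](bigID (fun b : arrow (dquiver Q) => qtail b == i)) /= [X in _ = _ + X]big1 ?addr0 //.
  move=> b nb; rewrite big1 ?mulr0 // => r _.
  by rewrite [X in _ * X]arrow_mx_place ?mulr0 // pi nb.
have lamu : lam i = lam (IGv (tag u.1)).
  apply/esym/lamG; apply/imsetP; exists u.2 => //; exact/esym/pi.
move: lamu; rewrite -{i}pi => lamu.
case: t u lamu tu => [[x' a'] g1] [[x a] g2] /= lamu tu.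
rewrite /place /= in tu lamu; rewrite /group_mx /= lamu mulg1.
have sE : act (g1^-1 * g2)%g (IGv x) = IGv x' by rewrite vactM tu -vactM mulVg vact1.
have xx' : IGv x = IGv x' := IGv_orbit sE.
have sx' : (g1^-1 * g2)%g \in G x' by apply/stabP; rewrite -{1}xx'.
transitivity ((- #|G x|%:R^-1)%:I * \sum_e (IGrep x' (g1^-1 * g2)%g a' e)%:I * casimir_mx aB e a).
  pose F (b : arrow (dquiver Q)) g := \sum_y \sum_c (#|G y|%:R^-1)%:I *
    (@arrow_mx _ _ _ _ _ _ _ aB y x' (sarr_lmul g1^-1%g (sarr_rmul act g (sb (1%g, arrow_rev b)))) a' c *
     @arrow_mx _ _ _ _ _ _ _ aB x y (sarr_lmul g^-1%g (sarr_rmul act g2 (sb (1%g, b)))) c a).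
  transitivity ((#|G x|%:R^-1)%:I * \sum_(p : P) (arrow_sign k p.2)%:I * F p.2 p.1).
    rewrite -(pair_bigA _ (fun g b => (arrow_sign k b)%:I * F b g)) exchange_big mulr_sumr.
    apply: eq_bigr => b _; rewrite -mulr_sumr inalgCA; congr (_ * _).
    rewrite -(pair_bigA _ (fun j g => arrow_matrix (arrow_rev b) (mkJ a', g1) (j, g) *
      arrow_matrix b (j, g) (mkJ a, g2))) exchange_big mulr_sumr; apply: eq_bigr => g _.
    rewrite sum_J mulr_sumr; apply: eq_bigr => y _; rewrite mulr_sumr; apply: eq_bigr => c _.
    set X1 := arrow_mx _ _ _ _; set X2 := arrow_mx _ _ _ _.
    transitivity ((#|G y|%:R^-1)%:I * X1 * ((#|G x|%:R^-1)%:I * X2)); first by [].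
    by rewrite -mulrA (inalgCA _ X1) inalgCA.
  rewrite inalgN mulNr -mulrN; congr (_ * _).
  (* The group component of the intermediate index is traded for that of a basis product: with
     [g2 g^-1] in its place, the right factor becomes [g b] and the left one [g1^-1 g2] times its
     dual. *)
  pose f p : P := (g2 * p.1^-1, double_aact act g2 p.2)%g.
  have fI : injective f.
    move=> [g b] [g' b'] [/mulgI/invg_inj -> /(@aact_inj _ _ (double_action act)) ->]; exact: erefl.
  rewrite (reindex_inj fI).
  transitivity (\sum_p (arrow_sign k p.2)%:I * \sum_y \sum_c (#|G y|%:R^-1)%:I *
    (@arrow_mx _ _ _ _ _ _ _ aB y x' (sarr_lmul (g1^-1 * g2)%g (sb (D p))) a' c *
     @arrow_mx _ _ _ _ _ _ _ aB x y (sb p) c a)).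
    apply: eq_bigr => -[g b] _; rewrite /F [(f _).1]/= [(f _).2]/=.
    have -> : arrow_sign k (double_aact act g2 b) = arrow_sign k b by case: b.
    congr (_ * _); apply: eq_bigr => y _; apply: eq_bigr => c _.
    rewrite !sarr_rmul_basis !sarr_lmul_basis /= !mul1g -double_aact_rev -!double_aactM.
    by rewrite ?invMg !invgK !mulgA !mulgKV !mulVg !double_aact1.
  rewrite -sumrN; under [RHS]eq_bigr do rewrite /casimir_mx mulr_sumr -sumrN.
  rewrite [RHS]exchange_big; under [LHS]eq_bigr do rewrite mulr_sumr.
  rewrite [LHS]exchange_big; apply: eq_bigr => y _.
  under [RHS]eq_bigr do rewrite inalgCA inalgN mulNr opprK !mulr_sumr.
  rewrite [RHS]exchange_big; apply: eq_bigr => p _.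
  rewrite mulr_sumr; under [RHS]eq_bigr do rewrite !mulr_sumr.
  rewrite [RHS]exchange_big; apply: eq_bigr => c _.
  rewrite arrow_mx_lmul // mulr_suml !mulr_sumr; apply: eq_bigr => e _.
  by rewrite -!mulrA [LHS]inalgCA; congr (_ * _); exact: inalgCA.
case: (eqVneq x x') => [exx|nxx'].
  subst x'; rewrite (bigD1 a) //= [X in _ + X]big1 ?addr0 => [|e ne].
    by rewrite casimir_eq eqxx inalg1 mul1r block_rep_eq // !mulrA -!inalgM; congr (_%:I * _); ring.
  by rewrite casimir_eq (negbTE ne) inalg0 mul0r mulr0.
rewrite block_rep_neq 1?eq_sym // mulr0 inalg0 mul0r mulr0 big1 ?mulr0 // => e _.
by rewrite casimir_neq // mulr0.
Qed.

(** In A, [frame_out t * E_x(0, 0)] is a matrix coefficient times [E_x(0, 0)], and likewise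
    [E_x(0, 0) * frame_in t]. These are the same elements with [vB x] for [E_x(0, 0)]. *)
Definition coframe_out t : B :=
  (block_rep t.1 (mkJ (IGzero (tag t.1))) t.2^-1%g)%:I * vB (tag t.1).
Definition coframe_in t : B :=
  (#|G (tag t.1)|%:R^-1 * block_rep (mkJ (IGzero (tag t.1))) t.1 t.2)%:I * vB (tag t.1).

Lemma coframe_outE x t :
  coframe_out t * vB x = (block_rep t.1 (mkJ (IGzero x)) t.2^-1%g)%:I * vB x.
Proof.
rewrite /coframe_out -mulrA vBM; case: eqP => [->//|/eqP n].
by rewrite mulr0 block_rep_neq // inalg0 mul0r.
Qed.

Lemma coframe_inE x t :
  vB x * coframe_in t = (#|G (tag t.1)|%:R^-1 * block_rep (mkJ (IGzero x)) t.1 t.2)%:I * vB x.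
Proof.
rewrite /coframe_in inalgCA vBM; case: eqP => [e|/eqP n]; first by rewrite -e.
by rewrite mulr0 block_rep_neq // mulr0 inalg0 mul0r.
Qed.

(** After restriction to one vertex, the sum is a convolution of matrix coefficients, equal by
    [conv_left] to the coefficient of the unit element at [(0, 0)]. *)
Lemma sum_coframe : \sum_t coframe_in t * coframe_out t = 1.
Proof.
rewrite -vB1.
transitivity (\sum_x \sum_t vB x * coframe_in t * (coframe_out t * vB x)).
  rewrite exchange_big; apply: eq_bigr => t _.
  rewrite (bigD1 (tag t.1)) //= [X in _ = _ + X]big1 ?addr0 => [|x nx].
    have -> : vB (tag t.1) * coframe_in t = coframe_in t.
      by rewrite /coframe_in inalgCA vBM eqxx.
    by rewrite /coframe_out -mulrA vBM eqxx.
  by rewrite /coframe_in [vB x * _]inalgCA vBM (negbTE nx) mulr0 mul0r.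
apply: eq_bigr => x _.
pose F (j : J) g := (block_rep j (mkJ (IGzero x)) g)%:I * vB x.
transitivity (F (mkJ (IGzero x)) 1%g); last first.
  by rewrite /F block_rep_eq ?group1 // repr_mx1 mxE eqxx inalg1 mul1r.
rewrite -(@conv_left (mkJ (IGzero x)) 1%g F) => [|y a h g hS].
  apply: eq_bigr => t _; rewrite coframe_inE coframe_outE mul1g -mulrA; congr (_ * _).
  by rewrite inalgCA vBM eqxx.
rewrite /F block_rep_lmul // inalg_sum mulr_suml; apply: eq_bigr => b _.
by rewrite inalgM mulrA.
Qed.

(** Convolution on each side reduces the double sum to the entry [(0, 0)] of the arrow matrix of
    [arrow_vec l], which by [HGval_arrow_vec] is the arrow itself. *)
Lemma arrow_coframe x y (l : 'I_(\dim {: AG x y})) :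
  \sum_t \sum_u vB y * coframe_in t * vector_mx (arrow_vec l) t u * (coframe_out u * vB x)
  = aB l.
Proof.
pose F (j : J) g := amx (sarr_rmul act g (arrow_vec l)) (IGzero y) (tagged j).
transitivity (F (mkJ (IGzero x)) 1%g); last first.
  rewrite /F sarr_rmul1 arrow_mx_unlock /arrow_mx_def (bigD1 l) //= big1 => [|m nm].
    by rewrite HGval_arrow_vec // !eqxx inalg1 mul1r addr0.
  by rewrite HGval_arrow_vec // (negbTE nm) inalg0 mul0r.
rewrite exchange_big -(@conv_right (mkJ (IGzero x)) 1%g F) => [|z b h g hS]; last first.
  rewrite /F sarr_rmulM arrow_mx_rmul //.
  by apply: eq_bigr => e _; rewrite inalgC.
apply: eq_bigr => u _; rewrite -mulr_suml coframe_outE mulg1.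
pose F' (j : J) g := (#|G (tag u.1)|%:R^-1)%:I *
  amx (sarr_lmul g (sarr_rmul act u.2 (arrow_vec l))) (tagged j) (tagged u.1).
have -> : \sum_t vB y * coframe_in t * vector_mx (arrow_vec l) t u = F' (mkJ (IGzero y)) 1%g.
  rewrite -(@conv_left (mkJ (IGzero y)) 1%g F') => [|z b h g hS].
    apply: eq_bigr => t _; rewrite coframe_inE mul1g.
    have [e|n] := eqVneq y (tag t.1); last by rewrite block_rep_neq // mulr0 inalg0 !mul0r.
    rewrite -mulrA; congr (_ * _); rewrite /vector_mx inalgCA /F'; congr (_ * _).
    by rewrite {1}e arrow_mx_target.
  rewrite /F' sarr_lmulM arrow_mx_lmul // mulr_sumr.
  by apply: eq_bigr => e _; rewrite inalgCA.
have [e|n] := eqVneq (tag u.1) x; last by rewrite block_rep_neq // mulr0 inalg0 !mul0r mulr0.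
rewrite /F' /F sarr_lmul1 inalgM -!mulrA; congr (_ * _).
rewrite inalgCA; congr (_ * _).
by rewrite -{2}e arrow_mx_source.
Qed.

(** The left side is the image in matrices of [E_x(0, 0)]; Schur orthogonality factors it as a
    column times a row. *)
Lemma vertex_coframe x t u :
  ((IGdim x)%:R / #|G x|%:R)%:I * (\sum_(g in G x) (IGrep x g^-1%g (IGzero x) (IGzero x))%:I *
    (\sum_r group_mx g t r * vertex_mx (IGv x) r u))
  = coframe_out t * vB x * coframe_in u.
Proof.
under eq_bigr do rewrite group_vertex_mx.
rewrite coframe_outE -mulrA coframe_inE mulrA -inalgM.
case: t u => [[x1 a1] g1] [[x2 a2] g2].
have [e12|n12] := eqVneq x1 x2; last first.
  rewrite big1 ?mulr0 => [|g _]; last first.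
    by rewrite /group_mx /= block_rep_neq // mulr0 inalg0 mul0r if_same mulr0.
  have [e|n] := eqVneq x1 x.
    have -> : @block_rep _ _ _ _ _ irr (mkJ (IGzero x)) (mkJ a2) g2 = 0.
      by apply: block_rep_neq; rewrite -e.
    by rewrite !mulr0 inalg0 mul0r.
  have -> : @block_rep _ _ _ _ _ irr (mkJ a1) (mkJ (IGzero x)) g1^-1%g = 0 by exact: block_rep_neq.
  by rewrite mul0r inalg0 mul0r.
subst x2; rewrite /place /=.
have [hx|nx] := eqVneq (act g2 (IGv x1)) (IGv x); last first.
  rewrite big1 ?mulr0 => [|g _]; last by rewrite mulr0.
  have [e|n] := eqVneq x1 x; last by rewrite block_rep_neq // mul0r inalg0 mul0r.
  subst x; have -> : @block_rep _ _ _ _ _ irr (mkJ (IGzero x1)) (mkJ a2) g2 = 0.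
    by apply: block_rep_out; apply: contra nx => /stabP ->.
  by rewrite !mulr0 inalg0 mul0r.
have x1x : IGv x1 = IGv x := IGv_orbit hx.
have g2S : g2 \in G x1 by apply/stabP; rewrite hx.
have g2Sx : g2 \in G x by rewrite -x1x.
rewrite /group_mx /=; case: (boolP (g1 \in G x1)) => [g1S|g1N]; last first.
  rewrite big1 ?mulr0 => [|g gS]; last first.
    rewrite block_rep_out ?mulr0 ?inalg0 ?mul0r ?mulr0 //.
    have gS1 : g \in G x1 by rewrite x1x.
    by rewrite -mulgA groupMr ?groupM // groupV.
  have [e|n] := eqVneq x1 x; last by rewrite block_rep_neq // mul0r inalg0 mul0r.
  subst x; have -> : @block_rep _ _ _ _ _ irr (mkJ a1) (mkJ (IGzero x1)) g1^-1%g = 0.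
    by apply: block_rep_out; rewrite groupV.
  by rewrite mul0r inalg0 mul0r.
(* The outer elements [g1^-1] and [g2] are split off, leaving a Schur sum in [g]. *)
have E : \sum_(g in G x) IGrep x g^-1%g (IGzero x) (IGzero x) * IGrep x1 (g1^-1 * g * g2)%g a1 a2
    = \sum_e \sum_f IGrep x1 g1^-1%g a1 e * IGrep x1 g2 f a2 *
      \sum_(g in G x) IGrep x1 g e f * IGrep x g^-1%g (IGzero x) (IGzero x).
  under [RHS]eq_bigr do under eq_bigr do rewrite mulr_sumr.
  under [RHS]eq_bigr do rewrite exchange_big.
  rewrite [RHS]exchange_big; apply: eq_bigr => g gS.
  have gS1 : g \in G x1 by rewrite x1x.
  rewrite !repr_mxM ?groupM ?groupV // mxE mulr_sumr exchange_big; apply: eq_bigr => f _ /=.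
  rewrite mxE mulr_suml mulr_sumr; apply: eq_bigr => e _; ring.
transitivity (((IGdim x)%:R / #|G x|%:R * (#|G x1|%:R^-1 * \sum_(g in G x)
    IGrep x g^-1%g (IGzero x) (IGzero x) * IGrep x1 (g1^-1 * g * g2)%g a1 a2))%:I * vB x1).
  rewrite [in RHS]inalgM -[RHS]mulrA; congr (_ * _).
  rewrite [in RHS]mulr_sumr inalg_sum [RHS]mulr_suml.
  apply: eq_bigr => g gS; have gS1 : g \in G x1 by rewrite x1x.
  by rewrite block_rep_eq ?groupM ?groupV // mulrA -inalgM; congr (_%:I * _); ring.
rewrite E; have [e|n] := eqVneq x1 x; last first.
  rewrite block_rep_neq // mul0r inalg0 mul0r.
  have [i [s [s' [xE xE']]]] := IGv_eq x1x; subst x x1.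
  have ss : ~ mx_rsim (irr_rep s) (irr_rep s').
    by move=> /irr_rep_inj e'; case/eqP: n; rewrite e'.
  rewrite [X in _ * (_ * X)]big1 ?mulr0 ?inalg0 ?mul0r // => e _; apply: big1 => f _.
  rewrite (_ : \sum_(g in _) _ = 0) ?mulr0 //.
  exact: (orthogonality_neq _ _ _ _ (irr_repP s) (irr_repP s') ss).
subst x; congr (_%:I * _).
rewrite !block_rep_eq ?groupV //.
have o e f := orthogonality_eq (stab_pgroup kG x1) (IGrep_irr x1) e f (IGzero x1) (IGzero x1).
under eq_bigr do under eq_bigr do rewrite o.
rewrite (bigD1 (IGzero x1)) //= [X in _ + X]big1 ?addr0 => [|e ne]; last first.
  by apply: big1 => f _; rewrite (negbTE ne) mul0r mulr0.
rewrite (bigD1 (IGzero x1)) //= [X in _ + X]big1 ?addr0 => [|f nf]; last first.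
  by rewrite (negbTE nf) ?andbF ?mul0r ?mulr0.
have nz := stab_neq0 kG x1; have dz := IGdim_neq0 kG x1; rewrite mul1r.
by field; apply/andP; split; first [exact: dz | exact: nz].
Qed.

End MatrixModel.

(** * The equivalence *)

Section EquivalentModels.
Variables (k : closedFieldType) (gT : finGroupType) (Q : quiver).
Variables (act : quiver_action gT Q) (C : orbit_choices act).
Variable irr : forall i : {i : Q | i \in reps C}, irr_reps k (qstab act (val i)).
Hypothesis kG : ([pchar k]^'.-group [set: gT])%g.
Local Notation V := (skew_arrows k gT Q).
Local Notation P := (gT * arrow (dquiver Q))%type.
Local Notation IG := (IG irr).
Local Notation G x := (qstab act (IGv x)).
Local Notation sb := (skew_basis k).
Local Notation J := {x : IG & 'I_(IGdim x)}.
Local Notation mkJ a := (Tagged (fun x : IG => 'I_(IGdim x)) a).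
Local Notation T := (J * gT)%type.
Implicit Types (x y : IG) (v w : V) (p q : P) (t u : J * gT).

Variables (A : pzAlgType k) (gA : gT -> A) (eA : Q -> A) (xA : arrow (dquiver Q) -> A).
Hypothesis gA1 : gA 1%g = 1.
Hypothesis gAM : forall g h, gA (g * h)%g = gA g * gA h.
Hypothesis eAM : forall i j, eA i * eA j = if i == j then eA i else 0.
Hypothesis eA1 : \sum_i eA i = 1.
Hypothesis geA : forall g i, gA g * eA i = eA (act g i) * gA g.
Hypothesis exA : forall b : arrow (dquiver Q), eA (qhead b) * xA b = xA b.
Hypothesis xeA : forall b : arrow (dquiver Q), xA b * eA (qtail b) = xA b.
Hypothesis gxA : forall g b, gA g * xA b = xA (double_aact act g b) * gA g.
Hypothesis A_ind : forall S : A -> Prop,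
  (forall a b, S a -> S b -> S (a + b)) -> (forall a b, S a -> S b -> S (a * b)) ->
  (forall c a, S a -> S (c%:I * a)) -> S 0 ->
  (forall g, S (gA g)) -> (forall i, S (eA i)) -> (forall b, S (xA b)) -> forall a, S a.

Variables (B : pzAlgType k) (vB : IG -> B).
Variable aB : forall x y : IG, 'I_(\dim {: AG x y}) -> B.
Hypothesis vBM : forall x y, vB x * vB y = if x == y then vB x else 0.
Hypothesis vB1 : \sum_x vB x = 1.
Hypothesis vaB : forall x y (l : 'I_(\dim {: AG x y})), vB y * aB l = aB l.
Hypothesis avB : forall x y (l : 'I_(\dim {: AG x y})), aB l * vB x = aB l.
Hypothesis B_ind : forall S : B -> Prop,
  (forall a b, S a -> S b -> S (a + b)) -> (forall a b, S a -> S b -> S (a * b)) ->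
  (forall c a, S a -> S (c%:I * a)) -> S 0 ->
  (forall x, S (vB x)) -> (forall x y (l : 'I_(\dim {: AG x y})), S (aB l)) ->
  forall b, S b.

Variable Th : A -> T -> T -> B.
Hypothesis ThD : forall a b t u, Th (a + b) t u = Th a t u + Th b t u.
Hypothesis ThM : forall a b t u, Th (a * b) t u = \sum_r Th a t r * Th b r u.
Hypothesis ThZ : forall c a t u, Th (c%:I * a) t u = c%:I * Th a t u.
Hypothesis Th_group : forall g t u, Th (gA g) t u = group_mx vB g t u.
Hypothesis Th_vertex : forall i t u, Th (eA i) t u = vertex_mx vB i t u.
Hypothesis Th_arrow : forall b t u, Th (xA b) t u = arrow_matrix aB b t u.

Variable th : B -> A.
Hypothesis thD : forall a b, th (a + b) = th a + th b.
Hypothesis thM : forall a b, th (a * b) = th a * th b.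
Hypothesis thZ : forall c a, th (c%:I * a) = c%:I * th a.
Hypothesis th_vertex : forall x, th (vB x) = mx_unit gA eA (IGzero x) (IGzero x).
Hypothesis th_arrow : forall x y (l : 'I_(\dim {: AG x y})),
  th (aB l) = skew_eval gA xA (arrow_vec l).

Let th0 : th 0 = 0.
Proof. by apply: (addrI (th 0)); rewrite -thD !addr0. Qed.

Let th_sum (I : finType) (F : I -> B) : th (\sum_i F i) = \sum_i th (F i).
Proof. exact: (big_morph th thD th0). Qed.

Let Th0 t u : Th 0 t u = 0.
Proof. by apply: (addrI (Th 0 t u)); rewrite -ThD !addr0. Qed.

Let Th_sum (I : finType) (S : pred I) (F : I -> A) t u :
  Th (\sum_(i | S i) F i) t u = \sum_(i | S i) Th (F i) t u.
Proof. exact: (big_morph (fun a => Th a t u) (fun a b => ThD a b t u) (Th0 t u)). Qed.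

Lemma th_arrow_mx x y v (c : 'I_(IGdim y)) (a : 'I_(IGdim x)) :
  th (arrow_mx aB v c a)
  = arrow_mx (fun x y (l : 'I_(\dim {: AG x y})) => skew_eval gA xA (arrow_vec l)) v c a.
Proof.
rewrite !arrow_mx_unlock /arrow_mx_def th_sum; apply: eq_bigr => l _.
by rewrite thZ th_arrow.
Qed.

Lemma th_group_mx g t u :
  th (group_mx vB g t u) = frame_out gA eA t * gA g * frame_in gA eA u.
Proof. by rewrite (frame_group kG gAM eAM geA) /group_mx thZ th_vertex. Qed.

(** The frame is a partition of unity, so both sides are compatible with products and it suffices to
    compare them on generators, where the entries of [Th] were chosen to agree. *)
Lemma th_Th a t u : th (Th a t u) = frame_out gA eA t * a * frame_in gA eA u.
Proof.
elim/A_ind: a t u => [a b IHa IHb|a b IHa IHb|c a IHa||g|i|b] t u.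
- by rewrite ThD thD IHa IHb mulrDr mulrDl.
- rewrite ThM th_sum; under eq_bigr do rewrite thM IHa IHb.
  transitivity (frame_out gA eA t * a * (\sum_(r : T) frame_in gA eA r * frame_out gA eA r)
    * b * frame_in gA eA u).
    rewrite mulr_sumr !mulr_suml; apply: eq_bigr => r _; by rewrite !mulrA.
  by rewrite (sum_frame irr kG gA1 gAM eAM eA1 geA) mulr1 !mulrA.
- by rewrite ThZ thZ IHa inalgCA mulrA.
- by rewrite Th0 th0 mulr0 mul0r.
- by rewrite Th_group th_group_mx.
- rewrite (frame_vertex gA1 eAM geA) Th_vertex /vertex_mx /place.
  by case: ifP => // _; rewrite th_group_mx.
- have -> : xA b = skew_eval gA xA (sb (1%g, b)) by rewrite skew_eval_basis gA1 mul1r.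
  rewrite (frame_arrow kG gAM eAM geA exA xeA gxA) skew_eval_basis gA1 mul1r Th_arrow.
  by rewrite /arrow_matrix /vector_mx thZ th_arrow_mx.
Qed.

Lemma Th_skew_eval v t u : Th (skew_eval gA xA v) t u = vector_mx aB v t u.
Proof.
rewrite skew_eval_unlock /skew_eval_def Th_sum.
transitivity (\sum_p (skew_coef p v)%:I * vector_mx aB (sb p) t u).
  apply: eq_bigr => -[g b] _; rewrite ThZ ThM; congr (_ * _) => /=.
  under eq_bigr do rewrite Th_group Th_arrow.
  by rewrite (group_vector_mxM kG vaB) sarr_lmul_basis mulg1.
rewrite [in RHS](skew_basis_sum v) /vector_mx !linear_sum /=.
under [in RHS]eq_bigr do rewrite !linearZ.
by rewrite arrow_mx_sum mulr_sumr; apply: eq_bigr => p _; rewrite inalgCA.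
Qed.

Lemma Th_mx_unit x t u :
  Th (mx_unit gA eA (IGzero x) (IGzero x)) t u
  = coframe_out vB t * vB x * coframe_in vB u.
Proof.
rewrite -(vertex_coframe kG vBM) (mx_unit_unlock irr gA eA) /mx_unit_def ThZ; congr (_ * _).
rewrite mulr_suml Th_sum; apply: eq_bigr => g _.
rewrite -mulrA ThZ ThM; congr (_ * _); apply: eq_bigr => r _.
by rewrite Th_group Th_vertex.
Qed.

Lemma Th_th b t u : Th (th b) t u = coframe_out vB t * b * coframe_in vB u.
Proof.
elim/B_ind: b t u => [a b IHa IHb|a b IHa IHb|c a IHa||x|x y l] t u.
- by rewrite thD ThD IHa IHb mulrDr mulrDl.
- rewrite thM ThM; under eq_bigr do rewrite IHa IHb.
  transitivity (coframe_out vB t * a * (\sum_(r : T) coframe_in vB r * coframe_out vB r)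
    * b * coframe_in vB u).
    rewrite mulr_sumr !mulr_suml; apply: eq_bigr => r _; by rewrite !mulrA.
  by rewrite (sum_coframe kG vBM vB1) mulr1 !mulrA.
- by rewrite thZ ThZ IHa inalgCA mulrA.
- by rewrite th0 Th0 mulr0 mul0r.
- by rewrite th_vertex Th_mx_unit.
rewrite th_arrow.
(* The arrow is flanked by the units at its ends, whose images supply the coframes needed for
   [arrow_coframe]. *)
have [e1 e2] := skew_arrow_target kG gAM eAM geA exA xeA gxA l.
rewrite -e1 -e2 !ThM.
transitivity (coframe_out vB t * (\sum_(r : T) \sum_(s : T) vB y * coframe_in vB r *
    vector_mx aB (arrow_vec l) r s * (coframe_out vB s * vB x)) * coframe_in vB u); last first.
  by rewrite (arrow_coframe kG vBM vaB avB).
rewrite mulr_sumr mulr_suml; apply: eq_bigr => r _.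
rewrite ThM mulr_sumr mulr_sumr mulr_suml; apply: eq_bigr => s _.
by rewrite !Th_mx_unit Th_skew_eval !mulrA.
Qed.

Lemma models_equivalent : equivalent (Mod A) (Mod B).
Proof.
(* The homomorphism [th] is regarded as having values in matrices of size one, indexed by [unit]. *)
have th'D a b (s s' : unit) : th (a + b) = th a + th b by [].
have th'M a b (s s' : unit) : th (a * b) = \sum_(r : unit) th a * th b.
  by rewrite big_const cardT enumT unlock /= addr0.
apply: (@morita_equivalent _ _ unit T (MxHom ThD ThM)
  (@MxHom _ _ _ (fun b _ _ => th b) th'D th'M)
  (fun _ t => coframe_out vB t) (fun _ u => coframe_in vB u)
  (fun t _ => frame_out gA eA t) (fun u _ => frame_in gA eA u)).
- rewrite (eq_bigr (fun=> 1)) => [|_ _]; last exact: (sum_coframe kG vBM vB1).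
  by rewrite big_const cardT enumT unlock /= addr0.
- by move=> b [] [] t t'; exact: Th_th.
- under eq_bigr do rewrite big_const cardT enumT unlock /= addr0.
  exact: (sum_frame irr kG gA1 gAM eAM eA1 geA).
- by move=> a t t' [] []; exact: th_Th.
Qed.

End EquivalentModels.

Lemma intertwine_mul (R D : pzRingType) (f : R -> D) (p : D) (x y x' y' : R) :
  (forall x y, f (x * y) = f x * f y) ->
  p * f x = f x' * p -> p * f y = f y' * p -> p * f (x * y) = f (x' * y') * p.
Proof. by move=> fM ex ey; rewrite !fM -mulrA -ey mulrA ex mulrA. Qed.

Lemma intertwine_scale (k : comPzRingType) (R D : pzAlgType k) (f : R -> D) (p : D)
    (x x' : R) c :
  (forall c x, f (c%:I * x) = c%:I * f x) ->
  p * f x = f x' * p -> p * f (c%:I * x) = f (c%:I * x') * p.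
Proof. by move=> fZ ex; rewrite !fZ inalgCA ex mulrA. Qed.

(** * Homomorphisms out of quotients of path algebras *)

Section PathQuotient.
Variables (k : closedFieldType) (Q : quiver) (S : path_alg k Q -> Prop).
Local Notation R := (ring_quot S).

Lemma path_quot_ind (F : R -> Prop) :
  (forall a b, F a -> F b -> F (a + b)) -> (forall a b, F a -> F b -> F (a * b)) ->
  (forall c a, F a -> F (c%:I * a)) -> F 0 ->
  (forall i, F (to_quot S (vtx k i))) -> (forall a, F (to_quot S (arr k a))) -> forall a, F a.
Proof.
move=> FD FM FZ F0 Fv Fa a; rewrite -(repr_quotK a).
elim/path_alg_ind: (repr a) => [c x y Fx Fy||x y Fx Fy|i|b] //.
- by rewrite to_quotD path_scaleE to_quotE; apply: FD => //; apply: FZ.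
- by rewrite to_quot0.
by rewrite to_quotE; apply: FM.
Qed.

Lemma path_quot_vtxM i j :
  to_quot S (vtx k i) * to_quot S (vtx k j) = if i == j then to_quot S (vtx k i) else 0.
Proof.
rewrite -to_quotE [_ * _]path_mulE /path_mul_basis; have [<-|n] := eqVneq i j.
  have [|r -> rE] := @path_compP Q (triv_path i) (triv_path i); first by [].
  by apply: (congr1 (fun p => to_quot S (<< p >> : path_alg k Q))); apply/val_inj.
by rewrite path_compN ?to_quot0 // eq_sym.
Qed.

Lemma path_quot_vtx1 : \sum_i to_quot S (vtx k i) = 1.
Proof. by rewrite -to_quot_sum. Qed.

Lemma path_quot_head a :
  to_quot S (vtx k (qhead a)) * to_quot S (arr k a) = to_quot S (arr k a).
Proof.
rewrite -to_quotE [_ * _]path_mulE /path_mul_basis.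
have [|r -> rE] := @path_compP Q (triv_path (qhead a)) (arrow_path a); first by [].
by apply: (congr1 (fun p => to_quot S (<< p >> : path_alg k Q))); apply/val_inj; rewrite rE.
Qed.

Lemma path_quot_tail a :
  to_quot S (arr k a) * to_quot S (vtx k (qtail a)) = to_quot S (arr k a).
Proof.
rewrite -to_quotE [_ * _]path_mulE /path_mul_basis.
have [|r -> rE] := @path_compP Q (arrow_path a) (triv_path (qtail a)); first by [].
by apply: (congr1 (fun p => to_quot S (<< p >> : path_alg k Q))); apply/val_inj; rewrite rE.
Qed.

Section Lift.
Variables (D : pzAlgType k) (E : Q -> D) (X : arrow Q -> D).
Hypothesis EE : forall i j, E i * E j = if i == j then E i else 0.
Hypothesis EX : forall a, E (qhead a) * X a = X a.
Hypothesis XE : forall a, X a * E (qtail a) = X a.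

Lemma path_evalD x y : (path_eval E X (x + y) : D) = path_eval E X x + path_eval E X y.
Proof. exact: linearD. Qed.

Hypothesis S0 : forall x, S x -> (path_eval E X x : D) = 0.

Definition path_quot_lift : R -> D := quot_lift (path_eval E X : _ -> D).

Lemma path_quot_liftE x : path_quot_lift (to_quot S x) = path_eval E X x.
Proof. by apply: quot_liftE => //; [exact: path_evalD | exact: path_evalM]. Qed.

Lemma path_quot_liftD x y : path_quot_lift (x + y) = path_quot_lift x + path_quot_lift y.
Proof. by apply: quot_liftD => //; [exact: path_evalD | exact: path_evalM]. Qed.

Lemma path_quot_liftM x y : path_quot_lift (x * y) = path_quot_lift x * path_quot_lift y.
Proof. by apply: quot_liftM => //; [exact: path_evalD | exact: path_evalM]. Qed.

Lemma path_quot_liftZ c x : path_quot_lift (c%:I * x) = c%:I * path_quot_lift x.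
Proof.
rewrite -(repr_quotK x) -to_quot_inalg -to_quotE -path_scaleE !path_quot_liftE.
exact: path_evalZ.
Qed.

Lemma path_quot_lift_vtx i : path_quot_lift (to_quot S (vtx k i)) = E i.
Proof. by rewrite path_quot_liftE path_eval_vtx. Qed.

Lemma path_quot_lift_arr a : path_quot_lift (to_quot S (arr k a)) = X a.
Proof. by rewrite path_quot_liftE path_eval_arr. Qed.

End Lift.
End PathQuotient.

(** * Presentation of the skew group algebra of the preprojective algebra *)

Section PreprojSkew.
Variables (k : closedFieldType) (gT : finGroupType) (Q : quiver).
Variables (act : quiver_action gT Q) (lam : Q -> k) (lamG : orbit_invariant act lam).
Local Notation S := (preproj_relators lam).
Local Notation PA := (preproj_action lamG).
Local Notation A := (skew_alg PA).

Definition pskew_group g : A := skew_group PA g.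
Definition pskew_vtx i : A := skew_ring PA (to_quot S (@vtx k (dquiver Q) i)).
Definition pskew_arr (b : arrow (dquiver Q)) : A := skew_ring PA (to_quot S (arr k b)).

Lemma preproj_actE g x : PA g (to_quot S x) = to_quot S (path_alg_act (double_action act) g x).
Proof. exact: (quot_actE (@preproj_relators_act k gT Q act lam lamG)). Qed.

Lemma preproj_act_vtx g i :
  PA g (to_quot S (@vtx k (dquiver Q) i)) = to_quot S (@vtx k (dquiver Q) (act g i)).
Proof.
apply: etrans (preproj_actE g _) _; congr (to_quot _ _).
exact: (path_alg_act_vtx k (double_action act) g i).
Qed.

Lemma preproj_act_arr g (b : arrow (dquiver Q)) :
  PA g (to_quot S (arr k b)) = to_quot S (arr k (double_aact act g b : arrow (dquiver Q))).
Proof.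
apply: etrans (preproj_actE g _) _; congr (to_quot _ _).
exact: (path_alg_act_arr k (double_action act) g b).
Qed.

Lemma pskew_ind (F : A -> Prop) :
  (forall a b, F a -> F b -> F (a + b)) -> (forall a b, F a -> F b -> F (a * b)) ->
  (forall c a, F a -> F (c%:I * a)) -> F 0 ->
  (forall g, F (pskew_group g)) -> (forall i, F (pskew_vtx i)) ->
  (forall b, F (pskew_arr b)) -> forall a, F a.
Proof.
move=> FD FM FZ F0 Fg Fv Fa; apply: skew_alg_ind => // x.
elim/path_quot_ind: x => [x y Fx Fy|x y Fx Fy|c x Fx||i|b] //.
- by rewrite skew_ringD; apply: FD.
- by rewrite skew_ringM; apply: FM.
- by rewrite skew_ringM; apply: FZ.
- by rewrite skew_ring0.
- exact: Fv.
- exact: Fa.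
Qed.

Lemma pskew_group_vtx g i :
  pskew_group g * pskew_vtx i = pskew_vtx (act g i) * pskew_group g.
Proof.
by rewrite /pskew_group /pskew_vtx skew_ring_group preproj_act_vtx.
Qed.

Lemma pskew_group_arr g b :
  pskew_group g * pskew_arr b = pskew_arr (double_aact act g b) * pskew_group g.
Proof.
by rewrite /pskew_group /pskew_arr skew_ring_group preproj_act_arr.
Qed.

Lemma pskew_vtxM i j : pskew_vtx i * pskew_vtx j = if i == j then pskew_vtx i else 0.
Proof.
rewrite /pskew_vtx -skew_ringM path_quot_vtxM.
by case: eqP => // _; rewrite skew_ring0.
Qed.

Lemma pskew_vtx1 : \sum_i pskew_vtx i = 1.
Proof.
transitivity (skew_ring PA 1); last by [].
rewrite -(@path_quot_vtx1 k (dquiver Q) S).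
exact/esym/(big_morph (skew_ring PA) (@skew_ringD _ _ PA) (@skew_ring0 _ _ PA)).
Qed.

Lemma pskew_head (b : arrow (dquiver Q)) : pskew_vtx (qhead b) * pskew_arr b = pskew_arr b.
Proof. by rewrite /pskew_vtx /pskew_arr -skew_ringM path_quot_head. Qed.

Lemma pskew_tail (b : arrow (dquiver Q)) : pskew_arr b * pskew_vtx (qtail b) = pskew_arr b.
Proof. by rewrite /pskew_vtx /pskew_arr -skew_ringM path_quot_tail. Qed.

Lemma double_sum (D : zmodType) (f : arrow (dquiver Q) -> D) i :
  \sum_(b : arrow (dquiver Q) | qtail b == i) f b
  = \sum_(a : arrow Q | qtail a == i) f (inl a) + \sum_(a : arrow Q | qhead a == i) f (inr a).
Proof. by rewrite big_sumType. Qed.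

(** An arrow starting at [i] in the double quiver is an arrow of [Q] with tail [i] or the reverse of
    one with head [i]; the sign separates the two sums of the relator, up to an overall sign. *)
Lemma double_relator (D : pzAlgType k) (X : arrow (dquiver Q) -> D) (e : D) i :
  \sum_(b : arrow (dquiver Q) | qtail b == i) (arrow_sign k b)%:I * (X (arrow_rev b) * X b)
    = (- lam i)%:I * e
  <-> \sum_(a : arrow Q | qhead a == i) X (inl a) * X (inr a)
    - \sum_(a : arrow Q | qtail a == i) X (inr a) * X (inl a) - (lam i)%:I * e = 0.
Proof.
rewrite double_sum /=; under eq_bigr do rewrite inalg1 mul1r.
under [X in _ + X]eq_bigr do rewrite inalgN inalg1 mulN1r.
rewrite sumrN inalgN mulNr; set u := \sum_(a | _) _; set v := \sum_(a | _) _.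
split=> [uv|/subr0_eq <-]; last by rewrite opprB.
by rewrite -[X in _ - X]opprK -uv opprB subrr.
Qed.

Lemma relator_morph (D : pzAlgType k) (F : path_alg k (dquiver Q) -> D) i :
  (forall x y, F (x + y) = F x + F y) -> (forall x y, F (x * y) = F x * F y) ->
  (forall c x, F (c *: x) = c%:I * F x) ->
  F (preproj_relator lam i)
  = \sum_(a : arrow Q | qhead a == i)
      F (@arr k (dquiver Q) (inl a)) * F (@arr k (dquiver Q) (inr a))
  - \sum_(a : arrow Q | qtail a == i)
      F (@arr k (dquiver Q) (inr a)) * F (@arr k (dquiver Q) (inl a))
  - (lam i)%:I * F (@vtx k (dquiver Q) i).
Proof.
move=> FD FM FZ.
have F0 : F 0 = 0 by apply: (addrI (F 0)); rewrite -FD !addr0.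
have FN x : F (- x) = - F x by apply: (addrI (F x)); rewrite -FD !subrr.
rewrite /preproj_relator FD FN FD FN FZ.
congr (_ - _ - _).
  apply: etrans (big_morph F FD F0 _ _ _) _; apply: eq_bigr => a _; exact: FM.
apply: etrans (big_morph F FD F0 _ _ _) _; apply: eq_bigr => a _; exact: FM.

Qed.

Lemma pskew_relation i :
  \sum_(b : arrow (dquiver Q) | qtail b == i)
    (arrow_sign k b)%:I * (pskew_arr (arrow_rev b) * pskew_arr b)
  = (- lam i)%:I * pskew_vtx i.
Proof.
apply/double_relator; rewrite -(relator_morph (F := fun x => skew_ring PA (to_quot S x))).
- rewrite -[RHS]skew_ring0 -[in RHS](@to_quot0 k _ S); congr (skew_ring _ _).
  by apply/to_quotP; rewrite subr0; apply: ideal_gen; exists i.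
- by move=> x y; rewrite to_quotD skew_ringD.
- by move=> x y; rewrite to_quotE skew_ringM.
by move=> c x; rewrite path_scaleE to_quotE skew_ringM.
Qed.

Lemma path_eval_relators (D : pzAlgType k) (E : Q -> D) (X : arrow (dquiver Q) -> D) :
  (forall i j, E i * E j = if i == j then E i else 0) ->
  (forall b : arrow (dquiver Q), E (qhead b) * X b = X b) ->
  (forall b : arrow (dquiver Q), X b * E (qtail b) = X b) ->
  (forall i, \sum_(b : arrow (dquiver Q) | qtail b == i)
     (arrow_sign k b)%:I * (X (arrow_rev b) * X b) = (- lam i)%:I * E i) ->
  forall x, S x -> (@path_eval k (dquiver Q) D E X x : D) = 0.
Proof.
move=> EE EX XE rel _ [i ->]; rewrite relator_morph; first last.
- exact: path_evalZ.
- exact: path_evalM.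
- exact: path_evalD.
apply: etrans (proj1 (double_relator X (E i) i) (rel i)).
congr (_ - _ - _).
- by apply: eq_bigr => a _; congr (_ * _); exact: path_eval_arr.
- by apply: eq_bigr => a _; congr (_ * _); exact: path_eval_arr.
by congr (_ * _); exact: path_eval_vtx.
Qed.

Section Lift.
Variables (D : pzAlgType k) (Pg : gT -> D) (E : Q -> D) (X : arrow (dquiver Q) -> D).
Variable phi : ring_quot S -> D.
Hypothesis phiD : forall x y, phi (x + y) = phi x + phi y.
Hypothesis phiM : forall x y, phi (x * y) = phi x * phi y.
Hypothesis phiZ : forall c x, phi (c%:I * x) = c%:I * phi x.
Hypothesis phi_vtx : forall i, phi (to_quot S (@vtx k (dquiver Q) i)) = E i.
Hypothesis phi_arr : forall b : arrow (dquiver Q), phi (to_quot S (arr k b)) = X b.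
Hypothesis PgM : forall g h, Pg (g * h)%g = Pg g * Pg h.
Hypothesis Pg1 : Pg 1%g = \sum_i E i.
Hypothesis PgE : forall g i, Pg g * E i = E (act g i) * Pg g.
Hypothesis PgX : forall g b, Pg g * X b = X (double_aact act g b) * Pg g.

Let phi0 : phi 0 = 0.
Proof. by apply: (addrI (phi 0)); rewrite -phiD !addr0. Qed.

Let Pg_phi g x : Pg g * phi x = phi (PA g x) * Pg g.
Proof.
elim/path_quot_ind: x => [x y IHx IHy|x y IHx IHy|c x IHx||i|b].
- by rewrite ractD !phiD mulrDr mulrDl IHx IHy.
- have -> : PA g (x * y) = (PA g x : ring_quot S) * PA g y := ractM PA g x y.
  exact: (intertwine_mul phiM IHx IHy).
- have -> : PA g (c%:I * x) = c%:I * (PA g x : ring_quot S).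
    by apply: etrans (ractM PA g _ x) _; congr (_ * _); exact: preproj_act_inalg.
  by apply: intertwine_scale; [exact: phiZ | exact: IHx].
- by rewrite ract0 phi0 mulr0 mul0r.
- apply: etrans (congr1 ( *%R (Pg g)) (phi_vtx i)) _; rewrite PgE; congr (_ * _).
  exact: esym (etrans (congr1 phi (preproj_act_vtx g i)) (phi_vtx _)).
apply: etrans (congr1 ( *%R (Pg g)) (phi_arr b)) _; rewrite PgX; congr (_ * _).
exact: esym (etrans (congr1 phi (preproj_act_arr g b)) (phi_arr _)).
Qed.

Let Pg1_phi : Pg 1%g = phi 1.
Proof.
rewrite Pg1 -(@path_quot_vtx1 k (dquiver Q) S).
rewrite (big_morph phi phiD phi0).
by apply: eq_bigr => i _; rewrite phi_vtx.
Qed.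

Definition pskew_lift : A -> D := skew_lift phi Pg.

Lemma pskew_liftD a b : pskew_lift (a + b) = pskew_lift a + pskew_lift b.
Proof. by apply: skew_liftD ; exact: phiD. Qed.

Lemma pskew_liftM a b : pskew_lift (a * b) = pskew_lift a * pskew_lift b.
Proof. by apply: skew_liftM. Qed.

Lemma pskew_lift_ring x : pskew_lift (skew_ring PA x) = phi x.
Proof. by apply: skew_lift_ring. Qed.

Lemma pskew_lift_group g : pskew_lift (pskew_group g) = Pg g.
Proof. by apply: skew_lift_group. Qed.

Lemma pskew_lift_vtx i : pskew_lift (pskew_vtx i) = E i.
Proof. exact: etrans (pskew_lift_ring _) (phi_vtx i). Qed.

Lemma pskew_lift_arr b : pskew_lift (pskew_arr b) = X b.
Proof. exact: etrans (pskew_lift_ring _) (phi_arr b). Qed.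

Lemma pskew_liftZ c a : pskew_lift (c%:I * a) = c%:I * pskew_lift a.
Proof.
have cE : pskew_lift c%:I = c%:I * pskew_lift 1.
  apply: etrans (pskew_lift_ring c%:I) _.
  rewrite -[c%:I in LHS]mulr1; apply: etrans (phiZ c 1) _.
  congr (_ * _); exact/esym/(pskew_lift_ring 1).
by rewrite pskew_liftM cE -mulrA -pskew_liftM mul1r.
Qed.

End Lift.
End PreprojSkew.

(** * Presentation of the algebra of the quiver of orbits *)

Section OrbitPreproj.
Variables (k : closedFieldType) (gT : finGroupType) (Q : quiver).
Variables (act : quiver_action gT Q) (C : orbit_choices act).
Variable irr : forall i : {i : Q | i \in reps C}, irr_reps k (qstab act (val i)).
Local Notation IG := (IG irr).
Local Notation QG := (QG irr).
Variable eta : IG -> k.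
Local Notation S := (@preprojG_relators k gT Q act C irr eta).
Local Notation B := (ring_quot S).
Implicit Types x y : IG.

Definition orb_vtx x : B := to_quot S (@vtx k QG x).
Definition orb_arr x y (l : 'I_(\dim {: AG x y})) : B := to_quot S (arr k (QG_arrow l)).

Lemma orb_ind (F : B -> Prop) :
  (forall a b, F a -> F b -> F (a + b)) -> (forall a b, F a -> F b -> F (a * b)) ->
  (forall c a, F a -> F (c%:I * a)) -> F 0 ->
  (forall x, F (orb_vtx x)) -> (forall x y (l : 'I_(\dim {: AG x y})), F (orb_arr l)) ->
  forall b, F b.
Proof.
move=> FD FM FZ F0 Fv Fa; apply: path_quot_ind => // -[[x y] l]; exact: Fa.
Qed.

Lemma AG_path_basis x y (l : 'I_(\dim {: AG x y})) :
  AG_path (tnth (AG_basis x y) l) = arr k (QG_arrow l).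
Proof.
have fB : free (AG_basis x y) := basis_free (vbasisP _).
rewrite /AG_path (bigD1 l) //= big1 => [|m nm].
  by rewrite (tnth_nth 0) coord_free // eqxx scale1r addr0.
by rewrite (tnth_nth 0) coord_free // eq_sym (negbTE nm) scale0r.
Qed.

Lemma orb_relator_morph (D : pzAlgType k) (F : path_alg k QG -> D) x :
  (forall a b, F (a + b) = F a + F b) -> (forall a b, F (a * b) = F a * F b) ->
  (forall c a, F (c *: a) = c%:I * F a) ->
  F (preprojG_relator eta x)
  = \sum_y \sum_l (\sum_m (coord (AG_basis y x) m
      (AG_eps (dual_vec (@AG_pair k gT Q act C irr x y) (AG_basis x y) l)))%:I
        * F (arr k (QG_arrow m))) * F (arr k (QG_arrow l)) - (eta x)%:I * F (@vtx k QG x).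
Proof.
move=> FD FM FZ.
have F0 : F 0 = 0 by apply: (addrI (F 0)); rewrite -FD !addr0.
have FN a : F (- a) = - F a by apply: (addrI (F a)); rewrite -FD !subrr.
rewrite /preprojG_relator FD FN FZ; congr (_ - _).
apply: etrans (big_morph F FD F0 _ _ _) _; apply: eq_bigr => y _.
apply: etrans (big_morph F FD F0 _ _ _) _; apply: eq_bigr => l _.
rewrite AG_path_basis; apply: etrans (FM _ _) _; congr (_ * _).
apply: etrans (big_morph F FD F0 _ _ _) _; apply: eq_bigr => m _; exact: FZ.
Qed.

Lemma orb_relation x :
  \sum_y \sum_l (\sum_m (coord (AG_basis y x) m
      (AG_eps (dual_vec (@AG_pair k gT Q act C irr x y) (AG_basis x y) l)))%:I
        * orb_arr m) * orb_arr l = (eta x)%:I * orb_vtx x.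
Proof.
apply: subr0_eq; apply: etrans (esym (orb_relator_morph (F := to_quot S) x _ _ _)) _.
- exact: to_quotD.
- exact: to_quotE.
- by move=> c a; rewrite path_scaleE; exact: to_quotE.
rewrite -[RHS](@to_quot0 k _ S).
by apply/to_quotP; rewrite subr0; apply: ideal_gen; exists x.
Qed.

Lemma path_eval_orb_relators (D : pzAlgType k) (E : IG -> D) (X : arrow QG -> D) :
  (forall x y, E x * E y = if x == y then E x else 0) ->
  (forall a : arrow QG, E (qhead a) * X a = X a) ->
  (forall a : arrow QG, X a * E (qtail a) = X a) ->
  (forall x, \sum_y \sum_l (\sum_m (coord (AG_basis y x) m
      (AG_eps (dual_vec (@AG_pair k gT Q act C irr x y) (AG_basis x y) l)))%:I
        * X (QG_arrow m)) * X (QG_arrow l) = (eta x)%:I * E x) ->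
  forall z, S z -> (@path_eval k QG D E X z : D) = 0.
Proof.
move=> EE EX XE rel _ [x ->]; rewrite orb_relator_morph; first last.
- exact: path_evalZ.
- exact: path_evalM.
- exact: path_evalD.
apply/eqP; rewrite subr_eq0; apply/eqP.
apply: etrans (etrans (rel x) _); last by congr (_ * _); apply/esym; exact: path_eval_vtx.
apply: eq_bigr => y _; apply: eq_bigr => l _; congr (_ * _); last exact: path_eval_arr.
by apply: eq_bigr => m _; congr (_ * _); exact: path_eval_arr.
Qed.

End OrbitPreproj.

(** * The relations of the skew group algebra hold for matrices over B *)

Section MatrixRelations.
Variables (k : closedFieldType) (gT : finGroupType) (Q : quiver).
Variables (act : quiver_action gT Q) (C : orbit_choices act).
Variable irr : forall i : {i : Q | i \in reps C}, irr_reps k (qstab act (val i)).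
Hypothesis kG : ([pchar k]^'.-group [set: gT])%g.
Local Notation IG := (IG irr).
Local Notation G x := (qstab act (IGv x)).
Local Notation T := ({x : IG & 'I_(IGdim x)} * gT)%type.
Variables (B : pzAlgType k) (vB : IG -> B).
Variable aB : forall x y : IG, 'I_(\dim {: AG x y}) -> B.
Hypothesis vBM : forall x y, vB x * vB y = if x == y then vB x else 0.
Hypothesis vaB : forall x y (l : 'I_(\dim {: AG x y})), vB y * aB l = aB l.
Hypothesis avB : forall x y (l : 'I_(\dim {: AG x y})), aB l * vB x = aB l.
Variable lam : Q -> k.
Hypothesis lamG : orbit_invariant act lam.
Hypothesis relB : forall x,
  \sum_y \sum_l (\sum_m (coord (AG_basis y x) m
      (AG_eps (dual_vec (@AG_pair k gT Q act C irr x y) (AG_basis x y) l)))%:I * aB m) * aB l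
  = ((IGdim x)%:R / #|G x|%:R * lam (IGv x))%:I * vB x.
Local Notation D := (sqmx B T).

Lemma to_sqmxM (M N : T -> T -> B) :
  to_sqmx M * to_sqmx N = to_sqmx (fun t u => \sum_r M t r * N r u) :> D.
Proof.
apply: sqmxP => t u; rewrite sqmxME to_sqmxE.
by apply: eq_bigr => r _; rewrite !to_sqmxE.
Qed.

Lemma to_sqmx_eq (M N : T -> T -> B) : (forall t u, M t u = N t u) -> to_sqmx M = to_sqmx N.
Proof. by move=> e; apply: sqmxP => t u; rewrite !to_sqmxE. Qed.

Definition group_sqmx g : D := to_sqmx (group_mx vB g).
Definition vertex_sqmx i : D := to_sqmx (vertex_mx vB i).
Definition arrow_sqmx (b : arrow (dquiver Q)) : D := to_sqmx (arrow_matrix aB b).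

Lemma vertex_sqmxM i j :
  vertex_sqmx i * vertex_sqmx j = if i == j then vertex_sqmx i else 0.
Proof.
rewrite [LHS]to_sqmxM; apply: sqmxP => t u; rewrite to_sqmxE (vertex_mxM kG vBM).
by case: eqP => _; rewrite ?to_sqmxE // !ffunE.
Qed.

Lemma arrow_sqmx_head (b : arrow (dquiver Q)) :
  vertex_sqmx (qhead b) * arrow_sqmx b = arrow_sqmx b.
Proof. by rewrite [LHS]to_sqmxM; apply: to_sqmx_eq => t u; exact: arrow_matrix_head. Qed.

Lemma arrow_sqmx_tail (b : arrow (dquiver Q)) :
  arrow_sqmx b * vertex_sqmx (qtail b) = arrow_sqmx b.
Proof. by rewrite [LHS]to_sqmxM; apply: to_sqmx_eq => t u; exact: arrow_matrix_tail. Qed.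

Lemma group_sqmxM g h : group_sqmx (g * h)%g = group_sqmx g * group_sqmx h.
Proof.
by rewrite [RHS]to_sqmxM; apply: to_sqmx_eq => t u; exact/esym/group_mxM.
Qed.

Lemma group_sqmx1 : group_sqmx 1%g = \sum_i vertex_sqmx i.
Proof.
apply: sqmxP => t u; rewrite to_sqmxE -sum_vertex_mx !sum_ffunE.
by apply: eq_bigr => i _; rewrite to_sqmxE.
Qed.

Lemma group_vertex_sqmx g i :
  group_sqmx g * vertex_sqmx i = vertex_sqmx (act g i) * group_sqmx g.
Proof.
rewrite [LHS]to_sqmxM [RHS]to_sqmxM; apply: to_sqmx_eq => t u.
by rewrite (group_vertex_mx kG vBM) (vertex_group_mx kG vBM).
Qed.

Lemma group_arrow_sqmx g b :
  group_sqmx g * arrow_sqmx b = arrow_sqmx (double_aact act g b) * group_sqmx g.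
Proof.
rewrite [LHS]to_sqmxM [RHS]to_sqmxM; apply: to_sqmx_eq => t u.
exact: group_arrow_matrix.
Qed.

Lemma relation_sqmx i : \sum_(b : arrow (dquiver Q) | qtail b == i)
    (arrow_sign k b)%:I * (arrow_sqmx (arrow_rev b) * arrow_sqmx b)
  = (- lam i)%:I * vertex_sqmx i.
Proof.
apply: sqmxP => t u; rewrite sqmxZE to_sqmxE -(relation_mx kG lamG relB) !sum_ffunE.
apply: eq_bigr => b _; rewrite sqmxZE sqmxME.
by under eq_bigr do rewrite !to_sqmxE.
Qed.

End MatrixRelations.

(** * Both homomorphisms for the actual algebras *)

Section PreprojEquivalence.
Variables (k : closedFieldType) (gT : finGroupType) (Q : quiver).
Variables (act : quiver_action gT Q) (C : orbit_choices act).
Variable irr : forall i : {i : Q | i \in reps C}, irr_reps k (qstab act (val i)).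
Hypothesis kG : ([pchar k]^'.-group [set: gT])%g.
Local Notation IG := (IG irr).
Local Notation G x := (qstab act (IGv x)).
Local Notation T := ({x : IG & 'I_(IGdim x)} * gT)%type.
Variables (lam : Q -> k) (lamG : orbit_invariant act lam).
Local Notation eta := (fun x : IG => (IGdim x)%:R / #|G x|%:R * lam (IGv x)).
Local Notation A := (skew_alg (preproj_action lamG)).
Local Notation B := (ring_quot (@preprojG_relators k gT Q act C irr eta)).
Implicit Types x y : IG.

Let gA : gT -> A := pskew_group lamG.
Let eA : Q -> A := pskew_vtx lamG.
Let xA : arrow (dquiver Q) -> A := pskew_arr lamG.
Let vB : IG -> B := @orb_vtx k gT Q act C irr eta.
Let aB x y : 'I_(\dim {: AG x y}) -> B := @orb_arr k gT Q act C irr eta x y.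

Let gA1 : gA 1%g = 1.
Proof. exact: skew_group1. Qed.
Let gAM g h : gA (g * h)%g = gA g * gA h.
Proof. exact: skew_groupM. Qed.
Let eAM i j : eA i * eA j = if i == j then eA i else 0.
Proof. exact: pskew_vtxM. Qed.
Let eA1 : \sum_i eA i = 1.
Proof. exact: pskew_vtx1. Qed.
Let geA g i : gA g * eA i = eA (act g i) * gA g.
Proof. exact: pskew_group_vtx. Qed.
Let exA (b : arrow (dquiver Q)) : eA (qhead b) * xA b = xA b.
Proof. exact: pskew_head. Qed.
Let xeA (b : arrow (dquiver Q)) : xA b * eA (qtail b) = xA b.
Proof. exact: pskew_tail. Qed.
Let gxA g b : gA g * xA b = xA (double_aact act g b) * gA g.
Proof. exact: pskew_group_arr. Qed.
Let vBM x y : vB x * vB y = if x == y then vB x else 0.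
Proof. exact: path_quot_vtxM. Qed.
Let vB1 : \sum_x vB x = 1.
Proof. exact: path_quot_vtx1. Qed.
Let vaB x y (l : 'I_(\dim {: AG x y})) : vB y * aB l = aB l.
Proof. exact: (path_quot_head _ (QG_arrow l)). Qed.
Let avB x y (l : 'I_(\dim {: AG x y})) : aB l * vB x = aB l.
Proof. exact: (path_quot_tail _ (QG_arrow l)). Qed.
Let relA := pskew_relation lamG.
Let relB := @orb_relation k gT Q act C irr eta.


Let D : pzAlgType k := sqmx B T.
Let EE := @vertex_sqmxM k gT Q act C irr kG B vB vBM.
Let EX := @arrow_sqmx_head k gT Q act C irr kG B vB aB vaB.
Let XE := @arrow_sqmx_tail k gT Q act C irr kG B vB aB avB.
Let relD := @relation_sqmx k gT Q act C irr kG B vB aB lam lamG relB.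

Let phi : ring_quot (preproj_relators lam) -> D :=
  @path_quot_lift k (dquiver Q) (preproj_relators lam) D (vertex_sqmx vB) (arrow_sqmx aB).
Let phi0 := path_eval_relators EE EX XE relD.
Let phiD := @path_quot_liftD k (dquiver Q) (preproj_relators lam) D _ _ EE EX phi0.
Let phiM := @path_quot_liftM k (dquiver Q) (preproj_relators lam) D _ _ EE EX phi0.
Let phiZ := @path_quot_liftZ k (dquiver Q) (preproj_relators lam) D _ _ EE EX phi0.
Let phi_vtx := @path_quot_lift_vtx k (dquiver Q) (preproj_relators lam) D _ _ EE EX phi0.
Let phi_arr := @path_quot_lift_arr k (dquiver Q) (preproj_relators lam) D _ _ EE EX XE phi0.

Let Th : A -> D := @pskew_lift k gT Q act lam lamG D (group_sqmx vB) phi.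

Let unit_vtx x : A := @mx_unit _ _ _ _ _ irr _ gA eA x (IGzero x) (IGzero x).
Let skew_arr (a : arrow (QG irr)) : A := skew_eval gA xA (arrow_vec (tagged a)).

Let UU x y : unit_vtx x * unit_vtx y = if x == y then unit_vtx x else 0.
Proof.
have [<-|n] := eqVneq x y; last exact: (mx_unitM_neq gAM eAM geA).
apply: etrans (mx_unitM_eq kG gAM eAM geA _ _ _ _) _.
by rewrite eqxx inalg1; exact: mul1r.
Qed.
Let UX (a : arrow (QG irr)) : unit_vtx (qhead a) * skew_arr a = skew_arr a.
Proof. exact: (proj1 (skew_arrow_target kG gAM eAM geA exA xeA gxA _)). Qed.
Let XU (a : arrow (QG irr)) : skew_arr a * unit_vtx (qtail a) = skew_arr a.
Proof. exact: (proj2 (skew_arrow_target kG gAM eAM geA exA xeA gxA _)). Qed.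
Let relU x := skew_relator kG gA1 gAM eAM eA1 geA exA xeA gxA relA x.


Let psi0 := path_eval_orb_relators UU UX XU relU.

Let th : B -> A := @path_quot_lift k (QG irr) _ A unit_vtx skew_arr.

Lemma preproj_equivalent : equivalent (Mod A) (Mod B).
Proof.
have PM := group_sqmxM kG vBM.
have P1 : group_sqmx vB 1%g = \sum_i vertex_sqmx vB i := group_sqmx1 vB.
have PE := group_vertex_sqmx kG vBM.
have PX := group_arrow_sqmx kG vaB avB.
apply: (@models_equivalent k gT Q act C irr kG A gA eA xA gA1 gAM eAM eA1 geA exA xeA gxA
  _ B vB aB vBM vB1 vaB avB _ (fun a t u => Th a t u) _ _ _ _ _ _ th).
- exact: pskew_ind.
- exact: orb_ind.
- move=> a b t u; rewrite -sqmxDE.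
  exact: (congr1 (fun M : D => M t u) (pskew_liftD _ phiD _ _)).
- move=> a b t u; rewrite -sqmxME.
  exact: (congr1 (fun M : D => M t u) (pskew_liftM phiD phiM phiZ phi_vtx phi_arr PM PE PX _ _)).
- move=> c a t u; rewrite -sqmxZE.
  exact: (congr1 (fun M : D => M t u) (pskew_liftZ phiD phiM phiZ phi_vtx phi_arr PM P1 PE PX _ _)).
- move=> g t u; rewrite -[RHS]to_sqmxE.
  exact: (congr1 (fun M : D => M t u) (pskew_lift_group lamG phiD phi_vtx PM P1 _)).
- move=> i t u; rewrite -[RHS]to_sqmxE.
  exact: (congr1 (fun M : D => M t u) (pskew_lift_vtx lamG phiD phiM phi_vtx P1 _)).
- move=> b t u; rewrite -[RHS]to_sqmxE.
  exact: (congr1 (fun M : D => M t u) (pskew_lift_arr lamG phiD phiM phi_vtx phi_arr P1 _)).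
- exact: (@path_quot_liftD k (QG irr) _ A _ _ UU UX psi0).
- exact: (@path_quot_liftM k (QG irr) _ A _ _ UU UX psi0).
- exact: (@path_quot_liftZ k (QG irr) _ A _ _ UU UX psi0).
- exact: (@path_quot_lift_vtx k (QG irr) _ A _ _ UU UX psi0).
by move=> x y l; exact: (@path_quot_lift_arr k (QG irr) _ A _ _ UU UX XU psi0 (QG_arrow l)).
Qed.

End PreprojEquivalence.

Theorem theorem1p4 (k : closedFieldType) (Q : quiver) (gT : finGroupType)
  (act : quiver_action gT Q) (act_faithful : faithful_action act)
  (char_k : forall p : nat, p \in [pchar k] -> ~~ (p %| #|gT|)%N)
  (C : orbit_choices act)
  (irr : forall i : {i : Q | i \in reps C}, irr_reps k (qstab act (val i)))
  (lam : Q -> k) (lamG : orbit_invariant act lam) :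
  equivalent
    (Mod (skew_alg (preproj_action lamG)))
    (Mod (preprojG (fun x : IG irr =>
            (IGdim x)%:R / #|qstab act (IGv x)|%:R * lam (IGv x))))
  /\
  equivalent
    (Mod (skew_alg (preproj_action (@orbit_invariant0 k gT Q act))))
    (Mod (preprojG (fun x : IG irr => 0))).
Proof.
(* The characteristic hypothesis in the form that passes to all stabilizers as subgroups. *)
have kG : ([pchar k]^'.-group [set: gT])%g.
  apply/pgroupP => p pp; rewrite cardsT => pd; rewrite inE /=.
  by apply/negP => pk; case/negP: (char_k p pk).
split; first exact: preproj_equivalent.
(* At [lam = 0] the parameters are products with 0; they equal the zero function only extensionally,
   and the algebra depends on the function itself. *)
suff H (eta : IG irr -> k) : eta =1 (fun x => (IGdim x)%:R / #|qstab act (IGv x)|%:R * 0) ->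
    equivalent (Mod (skew_alg (preproj_action (@orbit_invariant0 k gT Q act))))
      (Mod (preprojG eta)) by apply: H => x; rewrite mulr0.
by move=> /funext ->; exact: (preproj_equivalent irr kG (@orbit_invariant0 k gT Q act)).
Qed.
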